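(* Let $n\ge 3$, let $\Omega\subset\mathbb{R}^n$ be a bounded domain with $0\in\Omega$. Assume $V\in M(W^{1,2}(\Omega)\to W^{-1,2}(\Omega))$, $\vec f\in L^2(\Omega)^n$ is such that $|\vec f|^2$ is an admissible measure for $W_0^{1,2}(\Omega)$, and $g\in W^{-1,2}(\Omega)$. Let $u\in W^{1,2}(\Omega)$ be a weak solution of $-\Delta u+Vu=-\operatorname{div}\vec f+g$ in $\Omega$. Suppose there is $0<R\le 1$ with $B_R\subset\Omega$ and Dini moduli of continuity $\omega_1,\omega_2$, i.e. $\int_0^R\frac{\omega_i(r)}{r}\,dr<\infty$ for $i=1,2$, such that for every $0<r\le \frac R2$, every $\psi\in W^{1,2}(\Omega)$ and every $\varphi\in W_0^{1,2}(\Omega)$ with $\operatorname{supp}\varphi\subset\overline{B}_r$, $$|\langle V\psi,\varphi\rangle|\le \omega_1(s)\,\|\psi\|_{L^{1,2}_{r,s}}\,\|\nabla\varphi\|_{L^2(B_r)}\quad\text{for all } r<s\le 2r,$$ $$\int_{B_r}|\vec f|^2|\varphi|^2dx\le(\omega_2(r))^2\int_{B_r}|\nabla\varphi|^2dx,\qquad |\langle g,\varphi\rangle|\le\frac{\omega_2(r)}{r^2}|B_r|^{\frac{n+2}{2n}}\|\nabla\varphi\|_{L^2(B_r)}.$$ Then $u$ is continuous at $0$ in the $L^2$ sense. Moreover, let $C_0,\lambda,\delta_0$ be the constants fixed in the context, let $\bar r\in(0,R]$ be the solution of $$C_0|B_1|^{\frac{n+2}{2n}}\left(\omega_1(\bar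 r)+\frac1{1-\lambda}\int_0^{\bar r}\frac{\omega_1(s)}{s}ds\right)=\frac{\delta_0}{128},$$ and set $$A=\left(\frac1{|B_{\bar r}|}\int_{B_R}u^2dx\right)^{\frac12}+\frac{4|B_1|^{\frac{n+2}{2n}}}{\delta_0}\left(\omega_2(R)+\frac1{1-\lambda}\int_0^R\frac{\omega_2(s)}{s}ds\right).$$ Then there is a constant $C=C(n)$ and a real number $K$ with $|K|\le CA$ such that for all $0<r\le R$ $$\left(\frac1{|B_r|}\int_{B_r}|u-K|^2dx\right)^{\frac12}\le\Omega_1(r)+\Omega_2(r),$$ where $$\Omega_1(r)=\begin{cases}CA\left(\dfrac r{\bar r}+r\displaystyle\int_r^{\bar r}\frac{\omega_1(s)}{s^2}ds+\int_0^r\frac{\omega_1(s)}{s}ds\right),&0<r\le\bar r,\\ CA,&\bar r<r\le R,\end{cases}$$ $$\Omega_2(r)=\begin{cases}C\left(r\displaystyle\int_r^{\bar r}\frac{\omega_2(s)}{s^2}ds+\int_0^r\frac{\omega_2(s)}{s}ds\right),&0<r\le\bar r,\\ CA,&\bar r<r\le R.\end{cases}$$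
   Context: Notation: $B_r=B_r(0)\subset\mathbb{R}^n$ is the ball of radius $r$ centered at $0$; $|B_r|$ is its Lebesgue measure. $W^{-1,2}(\Omega)$ is the dual of $W_0^{1,2}(\Omega)$ (so $|\langle g,v\rangle|\le C\|\nabla v\|_{L^2(\Omega)}$), with pairing $\langle\cdot,\cdot\rangle$. $V\in M(W^{1,2}(\Omega)\to W^{-1,2}(\Omega))$ means: $V$ is a linear operator from $W^{1,2}(\Omega)$ to $W^{-1,2}(\Omega)$ such that $|\langle Vu,v\rangle|\le C\|u\|_{W^{1,2}(\Omega)}\|\nabla v\|_{L^2(\Omega)}$ for all $u\in W^{1,2}(\Omega)$, $v\in W_0^{1,2}(\Omega)$, with $C$ independent of $u,v$. A nonnegative density $q\in L^1(\Omega)$ is an admissible measure for $W_0^{1,2}(\Omega)$ if $\int_\Omega|\varphi|^2q\,dx\le C\|\nabla\varphi\|_{L^2(\Omega)}^2$ for all $\varphi\in W_0^{1,2}(\Omega)$, with $C$ independent of $\varphi$. Weak solution of $-\Delta u+Vu=-\operatorname{div}\vec f+g$ in $\Omega$: $u\in W^{1,2}(\Omega)$ with $\int_\Omega\nabla u\cdot\nabla\varphi\,dx+\langle Vu,\varphi\rangle=\int_\Omega\vec f\cdot\nabla\varphi\,dx+\langle g,\varphi\rangle$ for all $\varphi\in W_0^{1,2}(\Omega)$. For $0<r<s$: $\|\psi\|_{L^{1,2}_{r,s}}=\frac{\|\psi\|_{L^2(B_s)}}{s-r}+\|\nabla\psi\|_{L^2(B_s)}$. A modulus of continuity $\omega$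 is a non-decreasing, subadditive, continuous function with $\omega(0)=0$; it is Dini if $\int_0^R\frac{\omega(r)}r dr<\infty$. ''$u$ is continuous at $0$ in the $L^2$ sense'' means there is a constant $K$ with $\left(\frac1{|B_r|}\int_{B_r}|u-K|^2dx\right)^{1/2}\to0$ as $r\to0$. The constants $C_0>0$, $0<\lambda<1$, $\delta_0>0$ are fixed constants (depending only on $n$) with the following property: whenever $V\in M(W^{1,2}(B_1)\to W^{-1,2}(B_1))$, $\vec f\in L^2(B_1)^n$ with $|\vec f|^2$ admissible for $W_0^{1,2}(B_1)$, $g\in W^{-1,2}(B_1)$, and $u$ is a weak solution of $-\Delta u+Vu=-\operatorname{div}\vec f+g$ in $B_1$ with $\frac1{|B_1|}\int_{B_1}u^2dx\le1$, and for all $0<\rho\le\frac12$, $\psi\in W^{1,2}(B_1)$, $\varphi\in W_0^{1,2}(B_1)$ with $\operatorname{supp}\varphi\subset\overline B_\rho$ one has $|\langle V\psi,\varphi\rangle|\le\delta_0\|\psi\|_{L^{1,2}_{\rho,\theta}}\|\nabla\varphi\|_{L^2(B_\rho)}$ for all $\rho<\theta\le2\rho$, $|\langle g,\varphi\rangle|\le\delta_0\|\nabla\varphi\|_{L^2(B_\rho)}$, and $\int_{B_\rho}|\vec f|^2\varphi^2dx\le\delta_0^2\int_{B_\rho}|\nabla\varphi|^2dx$, then there is $l(x)=a+\vec b\cdot x$ with $\left(\frac1{|B_\lambda|}\int_{B_\lambda}|u-l|^2dx\right)^{1/2}\le\frac12\lambda$ and $|a|+|\vec b|\le C_0$. Such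 constants exist. *)

(* Defs.v *)
From HB Require Import structures.
From mathcomp Require Import all_boot all_order all_algebra.
From mathcomp Require Import all_classical all_reals all_analysis.

Set Implicit Arguments.
Unset Strict Implicit.
Unset Printing Implicit Defensive.

Import Order.TTheory GRing.Theory Num.Theory.
Import numFieldNormedType.Exports.

Local Open Scope classical_set_scope.
Local Open Scope ring_scope.

(* R^n is 'rV[R]_n. Its library norm is the sup norm, which gives the right
   topology; Euclidean lengths and balls are defined below. Its sigma-algebra
   is generated by the coordinates, i.e. it is the Borel one. *)

Definition rV_display : measure_display.
Proof. exact: default_measure_display. Qed.

Section rV_measurable.
Context {R : realType} {n : nat}.

Definition rV_coord (i : 'I_n) (x : 'rV[R]_n) : R := x ord0 i.

Let rV_set0 : g_sigma_preimage rV_coord set0.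
Proof. exact: sigma_algebra0. Qed.

Let rV_setC A : g_sigma_preimage rV_coord A -> g_sigma_preimage rV_coord (~` A).
Proof. exact: sigma_algebraC. Qed.

Let rV_bigcup (F : _^nat) : (forall i, g_sigma_preimage rV_coord (F i)) ->
  g_sigma_preimage rV_coord (\bigcup_i (F i)).
Proof. exact: sigma_algebra_bigcup. Qed.

HB.instance Definition _ := @isMeasurable.Build rV_display 'rV[R]_n
  (g_sigma_preimage rV_coord) rV_set0 rV_setC rV_bigcup.

Lemma measurable_rV_coord (i : 'I_n) : measurable_fun setT (rV_coord i).
Proof.
move=> _ Y mY; rewrite setTI; apply: sub_sigma_algebra => /=.
rewrite -bigcup_seq/=; exists i => /=; first by rewrite mem_index_enum.
by exists Y => //; rewrite setTI.
Qed.

Lemma measurable_fun_rV d (T : measurableType d) (f : T -> 'rV[R]_n) :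
  (forall i, measurable_fun setT (rV_coord i \o f)) -> measurable_fun setT f.
Proof.
move=> mf _ A mA; rewrite setTI.
suff : g_sigma_preimage (fun i => rV_coord i \o f) `<=` measurable.
  by apply; rewrite g_sigma_preimage_comp; exists A => //; rewrite setTI.
apply: smallest_sub; first exact: sigma_algebra_measurable.
by rewrite -bigcup_seq => B /= [i _ [Y mY <-]]; exact: mf.
Qed.

End rV_measurable.

Section lebesgue_rV.
Context {R : realType}.

Definition rV_cons n (p : measurableTypeR R * 'rV[R]_n) : 'rV[R]_n.+1 :=
  \row_i (if unlift ord0 i is Some j then p.2 ord0 j else p.1).

Lemma measurable_rV_cons n : measurable_fun setT (@rV_cons n).
Proof.
apply: measurable_fun_rV => i.
case: (unliftP ord0 i) => [j ->|->].
  rewrite [X in measurable_fun _ X](_ : _ = rV_coord j \o snd).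
    by apply: measurableT_comp; [exact: measurable_rV_coord|exact: measurable_snd].
  by apply/funext => p; rewrite /= /rV_coord mxE liftK.
rewrite [X in measurable_fun _ X](_ : _ = fst); first exact: measurable_fst.
by apply/funext => p; rewrite /= /rV_coord mxE unlift_none.
Qed.

Section step.
Variables (n : nat) (mu : {sigma_finite_measure set 'rV[R]_n -> \bar R}).

Definition lebesgue_step : set 'rV[R]_n.+1 -> \bar R :=
  pushforward (lebesgue_measure \x mu)%E (@rV_cons n).

Let step0 : lebesgue_step set0 = 0%E.
Proof. by rewrite /lebesgue_step /pushforward preimage_set0 measure0. Qed.

Let step_ge0 A : (0 <= lebesgue_step A)%E.
Proof. exact: (measure_ge0 (lebesgue_measure \x mu)%E). Qed.

Let step_sigma_additive : semi_sigma_additive lebesgue_step.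
Proof.
move=> F mF tF mUF; rewrite /lebesgue_step /pushforward preimage_bigcup.
have mpre A : measurable A -> measurable (@rV_cons n @^-1` A).
  by move=> mA; rewrite -[X in measurable X]setTI; exact: measurable_rV_cons.
apply: (@measure_semi_sigma_additive _ _ _ (lebesgue_measure \x mu)%E).
- by move=> k; exact: mpre.
- apply/trivIsetP => /= i j _ _ ij; rewrite -preimage_setI.
  by move/trivIsetP : tF => /(_ _ _ _ _ ij) ->//; rewrite preimage_set0.
- by rewrite -preimage_bigcup; exact: mpre.
Qed.

HB.instance Definition _ := isMeasure.Build _ _ _ lebesgue_step
  step0 step_ge0 step_sigma_additive.

Definition rV_uncons (x : 'rV[R]_n.+1) : measurableTypeR R * 'rV[R]_n :=
  (rV_coord ord0 x, \row_j rV_coord (lift ord0 j) x).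

Lemma rV_consK : cancel (@rV_cons n) rV_uncons.
Proof.
move=> [a y]; congr (_, _); first by rewrite /rV_coord mxE unlift_none.
by apply/rowP => j; rewrite mxE /rV_coord mxE liftK.
Qed.

Lemma measurable_rV_uncons : measurable_fun setT rV_uncons.
Proof.
apply/measurable_fun_pairP; split => /=.
  exact: measurable_rV_coord.
apply: measurable_fun_rV => i.
rewrite [X in measurable_fun _ X](_ : _ = rV_coord (lift ord0 i)).
  exact: measurable_rV_coord.
by apply/funext => x; rewrite /= /rV_coord mxE.
Qed.

Let step_sigma_finite : sigma_finite setT lebesgue_step.
Proof.
have /sigma_finiteP[F [TF ndF Foo]] := sigma_finiteT (@lebesgue_measure R).
have /sigma_finiteP[G [TG ndG Goo]] := sigma_finiteT mu.
exists (fun k => rV_uncons @^-1` (F k `*` G k)).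
  rewrite -preimage_bigcup -(preimage_setT rV_uncons) -setXTT TF TG.
  congr (_ @^-1` _); rewrite predeqE => -[x y]; split.
    move=> [/= [p _ Fpx] [k _ Gky]]; exists (maxn p k) => //; split.
    - by move: x Fpx; exact/subsetPset/ndF/leq_maxl.
    - by move: y Gky; exact/subsetPset/ndG/leq_maxr.
  by move=> [p _ []/= ? ?]; split; exists p.
move=> k; have [mF Fk] := Foo k; have [mG Gk] := Goo k; split.
  rewrite -[X in measurable X]setTI; apply: measurable_rV_uncons => //.
  exact: measurableX.
rewrite /lebesgue_step /pushforward (_ : _ @^-1` _ = F k `*` G k).
  by rewrite product_measure1E// lte_mul_pinfty// ge0_fin_numE.
by rewrite -comp_preimage (_ : _ \o _ = id)//; apply/funext => x /=; rewrite rV_consK.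
Qed.

HB.instance Definition _ := Measure_isSigmaFinite.Build _ _ _ lebesgue_step
  step_sigma_finite.

End step.

(* Lebesgue measure on R^n: the n-fold product of the one on R. *)
Fixpoint lebesgue_rV (n : nat) : {sigma_finite_measure set 'rV[R]_n -> \bar R} :=
  match n with
  | 0 => \d_(0 : 'rV[R]_0)
  | m.+1 => lebesgue_step (lebesgue_rV m)
  end.

Lemma lebesgue_rV_box n (A : 'I_n -> set (measurableTypeR R)) :
  (forall i, measurable (A i)) ->
  lebesgue_rV n [set x | forall i, A i (x ord0 i)] =
  (\big[*%E/1]_(i < n) lebesgue_measure (A i))%E.
Proof.
elim: n A => [|n ih] A mA.
  rewrite big_ord0 /= diracE mem_set//; first by move=> [].
rewrite big_ord_recl /= /lebesgue_step /pushforward.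
set B := [set x : 'rV[R]_n | forall i, A (lift ord0 i) (x ord0 i)].
have mB : measurable B.
  rewrite (_ : B = \big[setI/setT]_(i < n) (rV_coord i @^-1` A (lift ord0 i))).
    apply: bigsetI_measurable => i _.
    by rewrite -[X in measurable X]setTI; apply: measurable_rV_coord => //; exact: mA.
  by apply/seteqP; split => x; rewrite -bigcap_seq /= => h i;
     [move=> _; exact: h|exact: (h i (mem_index_enum _))].
rewrite (_ : _ @^-1` _ = A ord0 `*` B); first by rewrite product_measure1E//; congr (_ * _)%E; apply: ih => i.
apply/seteqP; split=> [[a y] /= h|[a y] /= [h0 h] i].
  split; first by have := h ord0; rewrite mxE unlift_none.
  by move=> i; have := h (lift ord0 i); rewrite mxE liftK.
by rewrite mxE; case: (unliftP ord0 i) => [j ->|->//]; exact: h.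
Qed.

End lebesgue_rV.

Section sobolev.
Context {R : realType} {n : nat}.
Local Notation E := 'rV[R]_n.
Local Notation leb := (@lebesgue_rV R n).
Implicit Types (D Om : set E) (u v w phi psi : E -> R) (F : E -> E).

Definition dot (x y : E) : R := \sum_(i < n) x ord0 i * y ord0 i.
Definition eucl (x : E) : R := Num.sqrt (dot x x).
Definition Ball (r : R) : set E := [set x | eucl x < r].
Definition cBall (r : R) : set E := [set x | eucl x <= r].
Definition vol D : R := fine (leb D).

Definition L2 D u : Prop :=
  measurable_fun D u /\ (\int[leb]_(x in D) (u x ^+ 2)%:E < +oo)%E.
Definition L2v D F : Prop := forall i, L2 D (fun x => F x ord0 i).

(* Real-valued integrals, only meaningful for functions in L2. *)
Definition L2norm D u : R := Num.sqrt (\int[leb]_(x in D) (u x ^+ 2)).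
Definition L2vnorm D F : R := Num.sqrt (\int[leb]_(x in D) dot (F x) (F x)).
Definition L2avg D u : R := Num.sqrt ((vol D)^-1 * \int[leb]_(x in D) (u x ^+ 2)).

Definition pderiv (i : 'I_n) u : E -> R := fun x => 'D_(delta_mx ord0 i) u x.

Definition smooth phi : Prop := forall s : seq 'I_n,
  let psi := foldr pderiv phi s in
  continuous psi /\ forall x i, derivable psi x (delta_mx ord0 i).

(* C_c^oo(Om) *)
Definition test_fun Om phi : Prop :=
  [/\ smooth phi, compact (closure [set x | phi x != 0])
    & closure [set x | phi x != 0] `<=` Om].

Definition weak_grad Om u F : Prop := L2v Om F /\
  forall phi, test_fun Om phi -> forall i,
    \int[leb]_(x in Om) (u x * pderiv i phi x) =
    - \int[leb]_(x in Om) (F x ord0 i * phi x).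

(* W^{1,2}(Om). Elements are functions on the whole space whose values outside
   of Om are irrelevant, and are not quotiented by a.e. equality. *)
Definition W12 Om u : Prop := L2 Om u /\ exists F, weak_grad Om u F.

(* The weak gradient, chosen among its a.e. equal versions. *)
Definition grad Om u : E -> E := get (weak_grad Om u).

Definition W12norm Om u : R :=
  Num.sqrt (L2norm Om u ^+ 2 + L2vnorm Om (grad Om u) ^+ 2).

Definition W012 Om v : Prop := W12 Om v /\
  forall e : R, 0 < e -> exists phi, test_fun Om phi /\
    W12norm Om (fun x => v x - phi x) < e.

(* W^{-1,2}(Om). An element is its pairing with functions of W_0^{1,2}(Om);
   the bound makes it insensitive to a.e. modifications of the argument. *)
Definition Wm12 Om (g : (E -> R) -> R) : Prop :=
  (forall (a : R) v w, W012 Om v -> W012 Om w ->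
     g (fun x => a * v x + w x) = a * g v + g w) /\
  exists C : R, forall v, W012 Om v -> `|g v| <= C * L2vnorm Om (grad Om v).

(* M(W^{1,2}(Om) -> W^{-1,2}(Om)); V u v is the pairing of V u with v. *)
Definition multiplier Om (V : (E -> R) -> (E -> R) -> R) : Prop :=
  [/\ forall u, W12 Om u -> Wm12 Om (V u),
      forall (a : R) u w v, W12 Om u -> W12 Om w -> W012 Om v ->
        V (fun x => a * u x + w x) v = a * V u v + V w v
    & exists C : R, forall u v, W12 Om u -> W012 Om v ->
        `|V u v| <= C * W12norm Om u * L2vnorm Om (grad Om v)].

Definition admissible Om (q : E -> R) : Prop :=
  [/\ forall x, Om x -> 0 <= q x,
      leb.-integrable Om (EFin \o q)
    & exists C : R, forall phi, W012 Om phi ->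
        (\int[leb]_(x in Om) (phi x ^+ 2 * q x)%:E
         <= (C * L2vnorm Om (grad Om phi) ^+ 2)%:E)%E].

(* - Delta u + V u = - div f + g in Om *)
Definition weak_solution Om V (f : E -> E) (g : (E -> R) -> R) u : Prop :=
  W12 Om u /\ forall phi, W012 Om phi ->
    \int[leb]_(x in Om) dot (grad Om u x) (grad Om phi x) + V u phi =
    \int[leb]_(x in Om) dot (f x) (grad Om phi x) + g phi.

(* The norm of L^{1,2}_{r,s}, for psi in W^{1,2}(Om) and Ball s inside Om. *)
Definition L12norm Om (r s : R) psi : R :=
  L2norm (Ball s) psi / (s - r) + L2vnorm (Ball s) (grad Om psi).

(* The essential support, relatively to Om. *)
Definition esupp Om phi : set E := [set x | forall U : set E, open U -> U x ->
  ~ leb.-negligible (U `&` Om `&` [set y | phi y != 0])].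

Definition L2_continuous_at0 u : Prop := exists K : R,
  L2avg (Ball r) (fun x => u x - K) @[r --> 0^'+] --> (0 : R).

(* The property of the constants of the approximation lemma in the unit ball. *)
Definition approximation_constants (C0 lam delta0 : R) : Prop :=
  [/\ 0 < C0, 0 < lam < 1, 0 < delta0 &
  forall V f g u,
    multiplier (Ball 1) V ->
    L2v (Ball 1) f -> admissible (Ball 1) (fun x => dot (f x) (f x)) ->
    Wm12 (Ball 1) g ->
    weak_solution (Ball 1) V f g u ->
    (vol (Ball 1))^-1 * \int[leb]_(x in Ball 1) (u x ^+ 2) <= 1 ->
    (forall (rho : R) psi phi, 0 < rho <= 2^-1 ->
       W12 (Ball 1) psi -> W012 (Ball 1) phi ->
       esupp (Ball 1) phi `<=` cBall rho ->
       [/\ forall theta : R, rho < theta <= 2 * rho ->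
             `|V psi phi| <= delta0 * L12norm (Ball 1) rho theta psi *
                             L2vnorm (Ball rho) (grad (Ball 1) phi),
           `|g phi| <= delta0 * L2vnorm (Ball rho) (grad (Ball 1) phi)
         & (\int[leb]_(x in Ball rho) (dot (f x) (f x) * phi x ^+ 2)%:E <=
            (delta0 ^+ 2 * \int[leb]_(x in Ball rho)
               dot (grad (Ball 1) phi x) (grad (Ball 1) phi x))%R%:E)%E]) ->
    exists (a : R) (b : E),
      L2avg (Ball lam) (fun x => u x - (a + dot b x)) <= 2^-1 * lam /\
      `|a| + eucl b <= C0].

End sobolev.

Section moduli.
Context {R : realType}.
Local Notation leb1 := (@lebesgue_measure R).

Definition modulus (omega : R -> R) : Prop :=
  [/\ omega 0 = 0,
      forall r s : R, 0 <= r -> r <= s -> omega r <= omega s,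
      forall r s : R, 0 <= r -> 0 <= s -> omega (r + s) <= omega r + omega s
    & {within [set r : R | 0 <= r], continuous omega}].

Definition Dini_modulus (rad : R) (omega : R -> R) : Prop :=
  modulus omega /\ (\int[leb1]_(r in `]0%R, rad[) (omega r / r)%:E < +oo)%E.

Definition dini_int (omega : R -> R) (r : R) : R :=
  \int[leb1]_(s in `]0, r[) (omega s / s).

Definition tail_int (omega : R -> R) (r rbar : R) : R :=
  \int[leb1]_(s in `]r, rbar[) (omega s / s ^+ 2).

Definition Omega1 (C A rbar : R) (omega1 : R -> R) (r : R) : R :=
  if r <= rbar then
    C * A * (r / rbar + r * tail_int omega1 r rbar + dini_int omega1 r)
  else C * A.

Definition Omega2 (C A rbar : R) (omega2 : R -> R) (r : R) : R :=
  if r <= rbar then C * (r * tail_int omega2 r rbar + dini_int omega2 r)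
  else C * A.

End moduli.

(* Main.v *)
Require Import Defs.
From HB Require Import structures.
From mathcomp Require Import all_boot all_order all_algebra.
From mathcomp Require Import all_classical all_reals all_analysis.
From mathcomp Require Import measurable_realfun.
From mathcomp Require Import ring lra.
Set Implicit Arguments.
Unset Strict Implicit.
Unset Printing Implicit Defensive.
Import Order.TTheory GRing.Theory Num.Theory.
Import numFieldNormedType.Exports.
Local Open Scope classical_set_scope.
Local Open Scope ring_scope.

(** The deviation of u from affine functions [l_k x = a_k + b_k . x] is followed
    along the scales d_k = lam^k d_0, in the manner of Campanato.

    Suppose that u is within T of [l x = a + b . x] in L^2 average on the ball of
    radius d. Then w x = (u - l) (d x) / T has average at most 1 on the unit
    ball, and it solves an equation of the same form. As V is an operator, it has
    to be transported: the new operator is [d^(2-n) <V (J psi), E phi>], where E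
    dilates phi and extends it by zero, while J first multiplies by a cutoff.
    What this leaves of V u, namely V applied to u - T J w, becomes a source. On
    a neighbourhood of the support of the admitted test functions u - T J w is
    the affine function l, so that this source has size
    omega1 d (|a| + |b| d). Hence the approximation property of the constants
    C0, lam, delta0 applies to w as soon as 2 omega1 d <= delta0 and
    kappa (omega2 d + omega1 d (|a| + |b| d)) <= delta0 T, and it yields an
    affine function with error lam T / 2 at scale lam d ([improve_at_scale]).

    Iterating, one may take
    T_{k+1} = lam T_k / 2 + q (omega2 d_{k+1} + omega1 d_{k+1} N_{k+1}), where N_k
    bounds |a_k| + |b_k| d_k and grows by C0 T_k. A discrete Gronwall inequality
    bounds all N_k by a constant M ([size_bound_le]), since the Dini integral
    bounds the sum of omega1 d_k. From then on the only modulus is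
    W = omega2 + M omega1, and X_k = |b_k| d_k + 2 C0 T_k satisfies
    X_{k+1} <= lam X_k + 2 C0 q W d_{k+1}. This recurrence alone gives the
    convergence of a_k to some K and the rate: sums of W d_j compare with the
    integral of W s / s, sums of W d_j / d_j with that of W s / s^2
    ([potential_step], [decay_tail], [L2_decay]).

    For the quantitative statement, the equation for rbar bounds the Dini
    integral of omega1 by a constant. Hence omega1 (lam^m rbar) <= delta0 / 2 for
    an m that depends on the constants only, and the iteration can start at
    lam^m rbar with T_0 and M proportional to A ([solution_modulus]).

    The transport of the equation rests on facts about Sobolev functions that are
    proved first: the effect of dilations on Lebesgue measure, uniqueness of weak
    gradients ([ae0_test], [weak_grad_unique]), extension by zero ([W012_ext]) and
    multiplication by a cutoff ([weak_grad_cutoff]). *)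

(** * Borel sets of R^n and open boxes *)

Section boxes.
Context {R : realType} {n : nat}.
Local Notation E := 'rV[R]_n.
Local Notation leb := (@lebesgue_rV R n).

Definition obox (a b : 'I_n -> R) : set E :=
  [set x | forall i, a i < x ord0 i < b i].

Lemma oboxE a b : obox a b =
  \big[setI/setT]_(i < n) (rV_coord i @^-1` `]a i, b i[).
Proof.
apply/seteqP; split => x; rewrite -bigcap_seq /= => h i.
  by move=> _ /=; rewrite in_itv /=; exact: h.
by have := h i (mem_index_enum _); rewrite /= in_itv.
Qed.

Lemma measurable_obox a b : measurable (obox a b).
Proof.
rewrite oboxE; apply: bigsetI_measurable => i _.
by rewrite -[X in measurable X]setTI; apply: measurable_rV_coord.
Qed.

Lemma leb_obox a b :
  leb (obox a b) = (\prod_(i < n) Num.max 0 (b i - a i))%:E.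
Proof.
pose A i := `]a i, b i[%classic.
have -> : obox a b = [set x | forall i, A i (x ord0 i)].
  by apply/seteqP; split => x h i; have := h i; rewrite /A /= in_itv.
rewrite (@lebesgue_rV_box R n A)//; last by move=> i; exact: measurable_itv.
rewrite (big_morph EFin EFinM erefl); apply: eq_bigr => i _.
rewrite lebesgue_measure_itv /= lte_fin; case: ltP => h.
  by rewrite -EFinD; congr _%:E; apply/esym/max_idPr; rewrite subr_ge0 ltW.
by congr _%:E; apply/esym/max_idPl; rewrite subr_le0.
Qed.

Lemma obox_setI a b c d : obox a b `&` obox c d =
  obox (fun i => Num.max (a i) (c i)) (fun i => Num.min (b i) (d i)).
Proof.
apply/seteqP; split => x /=.
  by move=> [h1 h2] i; rewrite gt_max lt_min; move: (h1 i) (h2 i) => /andP[-> ->] /andP[-> ->].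
move=> h; split=> i; move: (h i); rewrite gt_max lt_min =>
  /andP[/andP[h1 h2] /andP[h3 h4]]; exact/andP.
Qed.

Definition oboxes : set (set E) := [set A | exists a b, A = obox a b].

Lemma normr_coord (x : E) i : `|x ord0 i| <= `|x|.
Proof.
rewrite [leRHS]/Num.norm /= mx_normrE; apply/bigmax_geP; right => /=.
by exists (ord0, i).
Qed.

Definition ncube (k : nat) : set E := obox (fun=> - k%:R) (fun=> k%:R).

Lemma ncube_cover : \bigcup_k ncube k = setT.
Proof.
apply/seteqP; split => // x _.
have [k hk] : exists k : nat, `|x| < k%:R.
  by exists (Num.truncn `|x|).+1; exact: truncnS_gt.
exists k => // i; rewrite -ltr_norml; apply: le_lt_trans hk.
exact: normr_coord.
Qed.

(** A slab [x_i in ]a, b[] is the countable union of its intersections with the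
    cubes, and these intersections are open boxes. *)
Lemma oboxes_generate : @measurable _ E = <<s oboxes >>.
Proof.
apply/seteqP; split; last first.
  apply: smallest_sub; first exact: sigma_algebra_measurable.
  by move=> _ [a [b ->]]; exact: measurable_obox.
apply: smallest_sub; first exact: smallest_sigma_algebra.
rewrite -bigcup_seq => A /= [i _ [Y mY <-]]; rewrite setTI.
pose H : set (set R) := [set Z | <<s oboxes >> (rV_coord i @^-1` Z : set E)].
have sH : sigma_algebra setT H.
  split.
  - by rewrite /H /= preimage_set0; exact: sigma_algebra0.
  - move=> Z HZ; rewrite /H /= setTD preimage_setC.
    exact: sigma_algebraC.
  - move=> F HF; rewrite /H /= preimage_bigcup; exact: sigma_algebra_bigcup.
suff : @measurable _ (measurableTypeR R) `<=` H by apply.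
rewrite RGenOpens.measurableE; apply: smallest_sub => // _ [x [y ->]].
rewrite /H /=; have -> : rV_coord i @^-1` `]x, y[ = \bigcup_k (obox
    (fun j => if j == i then Num.max x (- k%:R) else - k%:R)
    (fun j => if j == i then Num.min y k%:R else k%:R) : set E).
  apply/seteqP; split => z /=; rewrite in_itv /=.
    move=> hz; have [k _ hk] : (\bigcup_k ncube k) z by rewrite ncube_cover.
    exists k => // j; case: eqP => [->|_]; last exact: hk.
    by rewrite gt_max lt_min; move: (hk i) hz => /andP[-> ->] /andP[-> ->].
  move=> [k _ /(_ i)]; rewrite eqxx gt_max lt_min.
  by move=> /andP[/andP[-> _] /andP[-> _]].
apply: sigma_algebra_bigcup => k; apply: sub_sigma_algebra.
by eexists; eexists.
Qed.

(** Open boxes are stable under intersection and generate the Borel sets, and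
    the cubes exhaust the space: this is the pi-lambda theorem. *)
Lemma eq_measure_obox (m1 m2 : {measure set E -> \bar R}) :
  (forall a b, m1 (obox a b) = m2 (obox a b)) ->
  (forall a b, m1 (obox a b) < +oo)%E ->
  forall A, measurable A -> m1 A = m2 A.
Proof.
move=> m12 moo; apply: (measure_unique oboxes ncube).
- exact: oboxes_generate.
- by move=> _ _ [a [b ->]] [c [d ->]]; rewrite obox_setI; eexists; eexists.
- by move=> k; eexists; eexists.
- exact: ncube_cover.
- by move=> _ [a [b ->]].
- by move=> k; exact: moo.
Qed.

Lemma nbhs_obox (U : set E) x : open U -> U x -> exists e : R, 0 < e /\
  obox (fun i => x ord0 i - e) (fun i => x ord0 i + e) `<=` U.
Proof.
move=> oU Ux; have /nbhs_ballP[e /= e0 he] := open_nbhs_nbhs (conj oU Ux).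
exists e; split=> // y hy; apply: he; split => // i j.
rewrite !ord1 /ball /= distrC ltr_distl; exact: hy.
Qed.

Definition rat_obox (pq : {ffun 'I_n -> rat} * {ffun 'I_n -> rat}) :=
  obox (fun i => ratr (pq.1 i)) (fun i => ratr (pq.2 i)).

(** The closed box is kept inside U as well, so that a bump which lives on the
    open box is a test function of U. *)
Lemma nbhs_rat_obox (U : set E) x : open U -> U x -> exists pq,
  [/\ rat_obox pq x, rat_obox pq `<=` U
    & [set y : E | forall i, ratr (pq.1 i) <= y ord0 i <= ratr (pq.2 i)] `<=` U].
Proof.
move=> oU Ux; have [e [e0 he]] := nbhs_obox oU Ux.
have /choice[p hp] i : exists q : rat, x ord0 i - e < ratr q < x ord0 i.
  by apply: rat_in_itvoo; rewrite ltrBlDr ltrDl.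
have /choice[q hq] i : exists q : rat, x ord0 i < ratr q < x ord0 i + e.
  by apply: rat_in_itvoo; rewrite ltrDl.
exists (finfun p, finfun q).
have h : [set y : E | forall i, ratr (finfun p i) <= y ord0 i <= ratr (finfun q i)] `<=` U.
  move=> y hy; apply: he => i; have := hy i; rewrite !ffunE.
  move: (hp i) (hq i) => /andP[h1 h2] /andP[h3 h4] /andP[h5 h6].
  by rewrite (lt_le_trans h1 h5) (le_lt_trans h6 h4).
split=> //.
  by move=> i; rewrite !ffunE; move: (hp i) (hq i) => /andP[_ ->] /andP[->].
by move=> y hy; apply: h => i; have /andP[/ltW-> /ltW->] := hy i.
Qed.

(** There are only countably many boxes with rational vertices. *)
Lemma open_measurable_rV (U : set E) : open U -> measurable U.
Proof.
move=> oU; pose F pq := if `[<rat_obox pq `<=` U>] then rat_obox pq else set0.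
have -> : U = \bigcup_pq F pq.
  apply/seteqP; split => [x Ux|x [pq _]]; last first.
    by rewrite /F; case: asboolP => // h; exact: h.
  have [pq [h1 h2 _]] := nbhs_rat_obox oU Ux.
  by exists pq => //; rewrite /F; case: asboolP.
apply: countable_bigcupT_measurable; first exact: countableP.
move=> pq; rewrite /F; case: asboolP => // _; exact: measurable_obox.
Qed.

Lemma continuous_measurable_rV (f : E -> R) : continuous f -> measurable_fun setT f.
Proof.
move=> /continuousP cf; apply: (measurability _ (RGenOpens.measurableE R)).
move=> _ [_ [x [y ->]] <-]; rewrite setTI; apply: open_measurable_rV.
by apply: cf; exact: interval_open.
Qed.

End boxes.

(** * Lebesgue measure and affine changes of variables *)

Section affine.
Context {R : realType} {n : nat}.
Local Notation E := 'rV[R]_n.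
Local Notation leb := (@lebesgue_rV R n).
Variables (c : R) (h : E).
Hypothesis c0 : 0 < c.

Definition aff (x : E) : E := c *: x + h.

Lemma measurable_aff : measurable_fun setT aff.
Proof.
apply: measurable_fun_rV => i.
rewrite (_ : _ \o _ = fun x : E => c * rV_coord i x + h ord0 i); last first.
  by apply/funext => x /=; rewrite /rV_coord /aff !mxE.
apply: measurable_funD => //; apply: measurable_funM => //.
exact: measurable_rV_coord.
Qed.

Lemma aff_obox a b : aff @^-1` (obox a b) =
  obox (fun i => (a i - h ord0 i) / c) (fun i => (b i - h ord0 i) / c).
Proof.
apply/seteqP; split => x /= hx i; have := hx i; rewrite /aff !mxE.
  by rewrite ltr_pdivrMr // ltr_pdivlMr // ltrBlDr ltrBrDr mulrC.
by rewrite ltr_pdivrMr // ltr_pdivlMr // ltrBlDr ltrBrDr mulrC.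
Qed.

Lemma cVn_ge0 : 0 <= c ^- n. Proof. by rewrite invr_ge0 exprn_ge0 // ltW. Qed.

Definition cVn : {nonneg R} := NngNum cVn_ge0.

(** Both sides are measures, and they agree on open boxes. *)
Lemma leb_aff (A : set E) : measurable A ->
  leb (aff @^-1` A) = mscale cVn leb A.
Proof.
have mT := measurable_aff.
pose m1 : {measure set E -> \bar R} :=
   measure_function_pushforward__canonical__measure_function_Measure leb mT.
pose m2 : {measure set E -> \bar R} := mscale cVn leb.
move=> mA; rewrite -[LHS]/(m1 A) -[RHS]/(m2 A).
apply: eq_measure_obox => //.
- move=> a b; rewrite /m1 /m2 /= /pushforward /mscale /= aff_obox !leb_obox.
  rewrite -EFinM; congr _%:E.
  rewrite -[c ^- n]exprVn -[X in c^-1 ^+ X]card_ord -prodr_const -big_split /=.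
  apply: eq_bigr => i _; rewrite -mulrBl opprB addrA addrNK.
  by rewrite [RHS]mulrC maxr_pMl ?invr_ge0 ?ltW // mul0r.
- by move=> a b; rewrite /m1 /= /pushforward aff_obox leb_obox ltry.
Qed.

Lemma ge0_integral_aff (D : set E) (f : E -> \bar R) :
  measurable D -> measurable_fun D f -> (forall x, D x -> 0 <= f x)%E ->
  (\int[leb]_(x in aff @^-1` D) f (aff x) = (c ^- n)%:E * \int[leb]_(x in D) f x)%E.
Proof.
move=> mD mf f0; have mT := measurable_aff.
rewrite -(@ge0_integral_pushforward _ _ _ _ R _ mT leb D f) //; last first.
  by move=> x /[!inE]; exact: f0.
rewrite -[(c ^- n)]/(cVn%:num) -ge0_integral_mscale //.
by apply: eq_measure_integral => A mA AD; exact: leb_aff.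
Qed.

Lemma measurable_fun_aff d (Y : measurableType d) (D : set E) (f : E -> Y) :
  measurable D -> measurable_fun D f -> measurable_fun (aff @^-1` D) (f \o aff).
Proof.
move=> mD mf mD' Z mZ.
have -> : aff @^-1` D `&` (f \o aff) @^-1` Z = aff @^-1` (D `&` f @^-1` Z) by [].
by rewrite -[X in measurable X]setTI; apply: measurable_aff => //; exact: mf.
Qed.

Lemma measurable_aff_preimage (D : set E) : measurable D -> measurable (aff @^-1` D).
Proof.
by move=> mD; rewrite -[X in measurable X]setTI; exact: measurable_aff.
Qed.

Lemma integrable_aff (D : set E) (f : E -> \bar R) : measurable D ->
  leb.-integrable D f -> leb.-integrable (aff @^-1` D) (f \o aff).
Proof.
move=> mD /integrableP[mf foo]; apply/integrableP; split.
  exact: measurable_fun_aff.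
rewrite (ge0_integral_aff (f := fun x => `|f x|%E)) //; last first.
  exact: measurableT_comp.
by rewrite lte_mul_pinfty // lee_fin cVn_ge0.
Qed.

Lemma integral_aff (D : set E) (f : E -> \bar R) :
  measurable D -> leb.-integrable D f ->
  (\int[leb]_(x in aff @^-1` D) f (aff x) = (c ^- n)%:E * \int[leb]_(x in D) f x)%E.
Proof.
move=> mD fi; have mf := measurable_int _ fi.
rewrite integralE [in RHS]integralE.
under [X in (X - _)%E]eq_integral do rewrite (funepos_comp f)/=.
under [X in (_ - X)%E]eq_integral do rewrite (funeneg_comp f)/=.
rewrite !ge0_integral_aff //; [|exact: measurable_funeneg|exact: measurable_funepos].
rewrite [RHS]muleBr //.
by apply: fin_num_adde_defl; rewrite fin_numN; exact: integrable_neg_fin_num.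
Qed.

Lemma Rintegral_aff (D : set E) (f : E -> R) :
  measurable D -> leb.-integrable D (EFin \o f) ->
  \int[leb]_(x in aff @^-1` D) f (aff x) = c ^- n * \int[leb]_(x in D) f x.
Proof.
move=> mD fi; rewrite /Rintegral (integral_aff (f := EFin \o f)) // fineM //.
exact: integrable_fin_num.
Qed.

End affine.

(** * Euclidean balls *)

Section geometry.
Context {R : realType} {n : nat}.
Local Notation E := 'rV[R]_n.
Local Notation leb := (@lebesgue_rV R n).
Implicit Types x y z : E.

Lemma dotC x y : dot x y = dot y x.
Proof. by apply: eq_bigr => i _; rewrite mulrC. Qed.

Lemma dotDl x y z : dot (x + y) z = dot x z + dot y z.
Proof. by rewrite -big_split /=; apply: eq_bigr => i _; rewrite mxE mulrDl. Qed.

Lemma dotZl c x y : dot (c *: x) y = c * dot x y.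
Proof. by rewrite mulr_sumr; apply: eq_bigr => i _; rewrite mxE mulrA. Qed.

Lemma dotDr x y z : dot z (x + y) = dot z x + dot z y.
Proof. by rewrite dotC dotDl !(dotC _ z). Qed.

Lemma dotZr c x y : dot y (c *: x) = c * dot y x.
Proof. by rewrite dotC dotZl dotC. Qed.

Lemma dot0l x : dot 0 x = 0.
Proof. by rewrite /dot big1 // => i _; rewrite mxE mul0r. Qed.

Lemma dot_ge0 x : 0 <= dot x x.
Proof. by apply: sumr_ge0 => i _; rewrite -expr2 sqr_ge0. Qed.

Lemma eucl_ge0 x : 0 <= eucl x. Proof. exact: sqrtr_ge0. Qed.

Lemma sqr_eucl x : eucl x ^+ 2 = dot x x.
Proof. by rewrite sqr_sqrtr // dot_ge0. Qed.

Lemma euclZ c x : eucl (c *: x) = `|c| * eucl x.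
Proof.
rewrite /eucl dotZl dotZr mulrA -expr2 sqrtrM ?sqr_ge0 //.
by rewrite sqrtr_sqr.
Qed.

Lemma eucl0 : eucl (0 : E) = 0.
Proof. by rewrite /eucl dot0l sqrtr0. Qed.

(** The square of the vector [(x.x) y - (x.y) x] is nonnegative. *)
Lemma cauchy_dot x y : `|dot x y| <= eucl x * eucl y.
Proof.
rewrite -[leRHS]ger0_norm ?mulr_ge0 ?eucl_ge0 //.
rewrite -ler_sqr ?nnegrE // !real_normK ?num_real // exprMn !sqr_eucl.
(* a null vector has null coordinates, which settles the degenerate case *)
have [x0|x0] := eqVneq (dot x x) 0.
  have -> : dot x y = 0; last by rewrite x0 mul0r expr0n.
  rewrite /dot big1 // => i _; suff -> : x ord0 i = 0 by rewrite mul0r.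
  apply/eqP; rewrite -sqrf_eq0; apply/eqP.
  have h j : true -> 0 <= x ord0 j * x ord0 j by rewrite -expr2 sqr_ge0.
  by have := (psumr_eq0P h) x0 i erefl; rewrite -expr2.
have := dot_ge0 (dot x x *: y + (- dot x y) *: x).
rewrite !dotDl !dotDr !dotZl !dotZr (dotC y x).
set a := dot x x; set b := dot x y; set d := dot y y => h.
have a0 : 0 < a by rewrite lt_neqAle eq_sym x0 dot_ge0.
rewrite -subr_ge0 -(pmulr_rge0 _ a0).
by move: h; congr (_ <= _); ring.
Qed.

Lemma euclD x y : eucl (x + y) <= eucl x + eucl y.
Proof.
rewrite -[leRHS]ger0_norm ?addr_ge0 ?eucl_ge0 //.
rewrite -[leLHS]ger0_norm ?eucl_ge0 //.
rewrite -ler_sqr ?nnegrE // !real_normK ?num_real // sqrrD !sqr_eucl.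
rewrite dotDl !dotDr (dotC y x).
by have := ler_norm (dot x y); have := cauchy_dot x y; lra.
Qed.

Lemma eucl_delta (i : 'I_n) : eucl (delta_mx ord0 i : E) = 1.
Proof.
rewrite /eucl /dot (bigD1 i) //= mxE !eqxx mulr1 big1 ?addr0 ?sqrtr1 // => j /negbTE ji.
by rewrite mxE eqxx ji mulr0.
Qed.

Lemma coord_eucl x i : `|x ord0 i| <= eucl x.
Proof.
rewrite -[leRHS]ger0_norm ?eucl_ge0 // -ler_sqr ?nnegrE // !real_normK ?num_real //.
rewrite sqr_eucl /dot (bigD1 i) //= -expr2 lerDl sumr_ge0 // => j _.
by rewrite -expr2 sqr_ge0.
Qed.

Lemma eucl_le_sup x e : 0 <= e -> (forall i, `|x ord0 i| <= e) -> eucl x <= n%:R * e.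
Proof.
move=> e0 h; rewrite -[leRHS]ger0_norm ?mulr_ge0 ?ler0n //.
rewrite -[leLHS]ger0_norm ?eucl_ge0 // -ler_sqr ?nnegrE //.
rewrite !real_normK ?num_real // sqr_eucl.
apply: (@le_trans _ _ (\sum_(i < n) e ^+ 2)).
  apply: ler_sum => i _; rewrite -expr2 -real_normK ?num_real //.
  by rewrite ler_sqr ?nnegrE // h.
rewrite sumr_const card_ord exprMn -[leLHS]mulr_natl; apply: ler_wpM2r; first exact: sqr_ge0.
by rewrite -natrX ler_nat; case: n => // m; rewrite leq_pmulr.
Qed.

Lemma continuous_sum (I : Type) (s : seq I) (f : I -> E -> R) :
  (forall i, continuous (f i)) -> continuous (fun x => \sum_(i <- s) f i x).
Proof.
move=> cf; elim: s => [|i s ih] x.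
  by rewrite (_ : (fun _ => _) = cst 0); [exact: cst_continuous|apply/funext => ?; rewrite big_nil].
rewrite (_ : (fun _ => _) = fun x => f i x + \sum_(j <- s) f j x).
  by apply: continuousD; [exact: cf|exact: ih].
by apply/funext => ?; rewrite big_cons.
Qed.

Lemma continuous_dot : continuous (fun x => dot x x).
Proof. by apply: continuous_sum => i x; apply: continuousM; exact: coord_continuous. Qed.

Lemma continuous_eucl : continuous (@eucl R n).
Proof. by move=> x; apply: continuous_comp; [exact: continuous_dot|exact: sqrt_continuous]. Qed.

Lemma open_Ball r : open (@Ball R n r).
Proof.
have -> : @Ball R n r = @eucl R n @^-1` `]-oo, r[%classic.
  by apply/seteqP; split => x; rewrite /Ball /= in_itv.
by apply: open_comp => // x _; exact: continuous_eucl.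
Qed.

Lemma closed_cBall r : closed (@cBall R n r).
Proof.
have -> : @cBall R n r = @eucl R n @^-1` `]-oo, r]%classic.
  by apply/seteqP; split => x; rewrite /cBall /= in_itv.
apply: preimage_closed; [|exact: lray_closed] => x _.
exact: continuous_eucl.
Qed.

Lemma measurable_Ball r : measurable (@Ball R n r).
Proof. by apply: open_measurable_rV; exact: open_Ball. Qed.

Lemma bounded_cBall r : bounded_set (@cBall R n r).
Proof.
exists r; split; first exact: num_real.
move=> M rM x /= hx; rewrite [leLHS]/Num.norm /= mx_normrE.
apply/bigmax_leP; split => /=.
  by apply: le_trans (ltW rM); apply: le_trans hx; exact: eucl_ge0.
move=> [i j] _ /=; rewrite ord1; apply: le_trans (coord_eucl _ _) _.
exact: le_trans hx (ltW rM).
Qed.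

Lemma bounded_Ball r : bounded_set (@Ball R n r).
Proof. by apply: sub_boundedr (bounded_cBall r) => M hM x /= /ltW; exact: hM. Qed.

Lemma compact_cBall r : compact (@cBall R n r).
Proof. by apply: bounded_closed_compact; [exact: bounded_cBall|exact: closed_cBall]. Qed.

Lemma bounded_leb (D : set E) : bounded_set D -> measurable D -> (leb D < +oo)%E.
Proof.
move=> [M [_ /(_ (M + 1))]]; rewrite ltrDl => /(_ ltr01) hM mD.
apply: (@le_lt_trans _ _ (leb (obox (fun=> - (M + 2)) (fun=> M + 2)))).
  apply: le_measure; rewrite ?inE //; first exact: measurable_obox.
  move=> x Dx i; rewrite -ltr_norml; apply: le_lt_trans (normr_coord _ _) _.
  by apply: le_lt_trans (hM _ Dx) _; lra.
by rewrite leb_obox ltry.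
Qed.

Lemma Ball_leb r : (leb (Ball r) < +oo)%E.
Proof. by apply: bounded_leb; [exact: bounded_Ball|exact: measurable_Ball]. Qed.

Lemma Ball_leb_gt0 r : 0 < r -> (0 < leb (Ball r))%E.
Proof.
move=> r0; pose e : R := r / (n.+1)%:R.
have e0 : 0 < e by rewrite divr_gt0.
apply: (@lt_le_trans _ _ (leb (obox (fun=> - e) (fun=> e)))).
  rewrite leb_obox lte_fin prodr_gt0 // => i _.
  by rewrite lt_max; apply/orP; right; lra.
apply: le_measure; rewrite ?inE //; [exact: measurable_obox|exact: measurable_Ball|].
move=> x hx; rewrite /Ball /=.
apply: (@le_lt_trans _ _ (n%:R * e)).
  by apply: eucl_le_sup => [|i]; [exact: ltW|rewrite ler_norml; have /andP[/ltW-> /ltW->] := hx i].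
by rewrite mulrCA -ltr_pdivlMl // mulVf ?gt_eqF // ltr_pdivrMr // mul1r ltr_nat.
Qed.

Lemma vol_gt0 r : 0 < r -> 0 < vol (@Ball R n r).
Proof. by move=> r0; rewrite fine_gt0 // Ball_leb_gt0 // Ball_leb. Qed.

Lemma aff_Ball c r : 0 < c -> aff c 0 @^-1` (@Ball R n r) = Ball (r / c).
Proof.
move=> c0; apply/seteqP; split => x; rewrite /Ball /aff /= addr0 euclZ gtr0_norm //.
  by rewrite ltr_pdivlMr // mulrC.
by rewrite ltr_pdivlMr // mulrC.
Qed.

Lemma vol_Ball r : 0 < r -> vol (@Ball R n r) = r ^+ n * vol (@Ball R n 1).
Proof.
move=> r0; have ri0 : 0 < r^-1 by rewrite invr_gt0.
have := leb_aff (0 : E) ri0 (measurable_Ball 1).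
rewrite aff_Ball // invrK mul1r /mscale /= exprVn invrK /vol => ->.
by rewrite fineM // ge0_fin_numE // Ball_leb.
Qed.

End geometry.

(** * Square-integrable functions and vector fields *)

Section L2.
Context {R : realType} {n : nat}.
Local Notation E := 'rV[R]_n.
Local Notation leb := (@lebesgue_rV R n).
Implicit Types (D : set E) (u v w : E -> R) (F G : E -> E).

(** A nonnegative quadratic form has a nonpositive discriminant. If a = 0 the
    form is affine in p for q = 1, and is negative for some p unless b = 0. *)
Lemma quadratic_ge0 (a b d : R) : 0 <= a -> 0 <= d ->
  (forall p q : R, 0 <= p ^+ 2 * a + 2 * p * q * b + q ^+ 2 * d) -> b ^+ 2 <= a * d.
Proof.
move=> a0 d0 h; have [a00|an0] := eqVneq a 0.
  have [->|bn0] := eqVneq b 0; first by rewrite expr0n /= mulr_ge0.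
  have := h (- (d + 1) / (2 * b)) 1; rewrite a00 mulr0 add0r expr1n mul1r.
  have -> : 2 * (- (d + 1) / (2 * b)) * 1 * b = - (d + 1) by field.
  by lra.
have := h (- b) a => h1.
have a1 : 0 < a by rewrite lt_neqAle eq_sym an0.
rewrite -subr_ge0 -(pmulr_rge0 _ a1).
by move: h1; congr (_ <= _); ring.
Qed.

Lemma Rintegral_mono (D D' : set E) u : measurable D -> measurable D' -> D' `<=` D ->
  leb.-integrable D (EFin \o u) -> (forall x, D x -> 0 <= u x) ->
  \int[leb]_(x in D') u x <= \int[leb]_(x in D) u x.
Proof.
move=> mD mD' DD iu u0; rewrite /Rintegral fine_le //.
- by apply: integrable_fin_num => //; apply: integrableS iu.
- exact: integrable_fin_num.
- apply: ge0_subset_integral => //; exact: measurable_int iu.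
Qed.

Lemma measurable_sqr D u : measurable_fun D u ->
  measurable_fun D (fun x => (u x ^+ 2)%:E).
Proof. by move=> mu; apply/measurable_EFinP; apply: measurable_funX. Qed.

Lemma integrable_sqr D u : L2 D u -> leb.-integrable D (EFin \o (fun x => u x ^+ 2)).
Proof.
move=> [mu foo]; apply/integrableP; split; first exact: measurable_sqr.
rewrite (eq_integral (fun x => (u x ^+ 2)%:E)) // => x _ /=.
by rewrite ger0_norm // sqr_ge0.
Qed.

Lemma integrable_L2 D u : measurable_fun D u ->
  leb.-integrable D (EFin \o (fun x => u x ^+ 2)) -> L2 D u.
Proof.
move=> mu /integrableP[_ foo]; split => //; move: foo.
rewrite (eq_integral (fun x => (u x ^+ 2)%:E)) // => x _ /=.
by rewrite ger0_norm // sqr_ge0.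
Qed.

Lemma integrable_le D u w : measurable D -> measurable_fun D u ->
  leb.-integrable D (EFin \o w) -> (forall x, D x -> `|u x| <= w x) ->
  leb.-integrable D (EFin \o u).
Proof.
move=> mD mu iw h; apply: (le_integrable mD _ _ iw); first exact/measurable_EFinP.
by move=> x Dx /=; rewrite lee_fin; apply: le_trans (h x Dx) _; exact: ler_norm.
Qed.

Lemma L2_le D u w : measurable D -> measurable_fun D u -> L2 D w ->
  (forall x, D x -> `|u x| <= `|w x|) -> L2 D u.
Proof.
move=> mD mu Lw h; apply: integrable_L2 => //.
apply: integrable_le (integrable_sqr Lw) _ => //; first exact: measurable_funX.
move=> x Dx; rewrite ger0_norm ?sqr_ge0 //.
rewrite -(real_normK (num_real (u x))) -(real_normK (num_real (w x))).
by rewrite ler_sqr ?nnegrE // h.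
Qed.

Lemma integrableM_L2 D u v : measurable D -> L2 D u -> L2 D v ->
  leb.-integrable D (EFin \o (fun x => u x * v x)).
Proof.
move=> mD Lu Lv.
have h := integrableD mD (integrable_sqr Lu) (integrable_sqr Lv).
apply: (integrable_le (w := fun x => u x ^+ 2 + v x ^+ 2)) => //.
  by apply: measurable_funM; [case: Lu|case: Lv].
move=> x _; rewrite ler_norml.
have := sqr_ge0 (u x + v x); have := sqr_ge0 (u x - v x).
by have := sqr_ge0 (u x); have := sqr_ge0 (v x); nra.
Qed.

Lemma L2_lin D a u v : measurable D -> L2 D u -> L2 D v -> L2 D (fun x => a * u x + v x).
Proof.
move=> mD Lu Lv; have [mu _] := Lu; have [mv _] := Lv.
have mw : measurable_fun D (fun x => a * u x + v x).
  by apply: measurable_funD => //; apply: measurable_funM.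
apply: integrable_L2 => //.
have h := integrableD mD (integrableZl mD (2 * a ^+ 2) (integrable_sqr Lu))
                        (integrableZl mD 2 (integrable_sqr Lv)).
apply: (integrable_le (w := fun x => 2 * a ^+ 2 * (u x ^+ 2) + 2 * (v x ^+ 2))) => //.
  exact: measurable_funX.
move=> x _; rewrite ger0_norm ?sqr_ge0 //.
by have := sqr_ge0 (a * u x - v x); nra.
Qed.

Lemma L2_0 D : measurable D -> L2 D (fun=> 0).
Proof.
move=> mD; split; first exact: measurable_cst.
by under eq_integral do rewrite expr0n /=; rewrite integral0.
Qed.

Lemma L2Z D a u : measurable D -> L2 D u -> L2 D (fun x => a * u x).
Proof.
move=> mD Lu; have := L2_lin a mD Lu (L2_0 mD).
by congr (L2 _ _); apply/funext => x; rewrite addr0.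
Qed.

Lemma L2D D u v : measurable D -> L2 D u -> L2 D v -> L2 D (fun x => u x + v x).
Proof.
move=> mD Lu Lv; have := L2_lin 1 mD Lu Lv.
by congr (L2 _ _); apply/funext => x; rewrite mul1r.
Qed.

Lemma L2B D u v : measurable D -> L2 D u -> L2 D v -> L2 D (fun x => u x - v x).
Proof.
move=> mD Lu Lv; have := L2_lin (-1) mD Lv Lu.
by congr (L2 _ _); apply/funext => x; rewrite mulN1r addrC.
Qed.

Lemma L2_sub D D' u : measurable D -> measurable D' -> D' `<=` D -> L2 D u -> L2 D' u.
Proof.
move=> mD mD' DD [mu foo]; split; first exact: measurable_funS mu.
apply: le_lt_trans foo; apply: ge0_subset_integral => //; first exact: measurable_sqr.
by move=> x _; rewrite lee_fin sqr_ge0.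
Qed.

Lemma integrable_cst D (M : R) : measurable D -> (leb D < +oo)%E ->
  leb.-integrable D (EFin \o (fun=> M)).
Proof.
move=> mD Doo; apply/integrableP; split; first exact: measurable_cst.
by rewrite /= integral_cst // lte_mul_pinfty.
Qed.

Lemma L2_bounded D u M : measurable D -> (leb D < +oo)%E -> measurable_fun D u ->
  (forall x, D x -> `|u x| <= M) -> L2 D u.
Proof.
move=> mD Doo mu uM; apply: (@L2_le _ _ (fun=> M)) => //.
  apply: integrable_L2; first exact: measurable_cst.
  exact: integrable_cst.
by move=> x Dx; apply: le_trans (uM x Dx) (ler_norm _).
Qed.

Lemma L2_mulb D u v M : measurable D -> measurable_fun D u ->
  (forall x, D x -> `|u x| <= M) -> L2 D v -> L2 D (fun x => u x * v x).
Proof.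
move=> mD mu uM Lv; apply: (L2_le (w := fun x => M * v x)) => //.
- by apply: measurable_funM => //; case: Lv.
- exact: L2Z.
move=> x Dx; rewrite !normrM ler_wpM2r //.
by apply: le_trans (uM x Dx) (ler_norm _).
Qed.

Lemma L2norm_ge0 D u : 0 <= L2norm D u. Proof. exact: sqrtr_ge0. Qed.

Lemma sqr_L2norm D u : L2norm D u ^+ 2 = \int[leb]_(x in D) (u x ^+ 2).
Proof. by rewrite sqr_sqrtr // Rintegral_ge0 // => x _; exact: sqr_ge0. Qed.

Lemma Rint_sqr_lin D p q u v : measurable D -> L2 D u -> L2 D v ->
  \int[leb]_(x in D) ((p * u x + q * v x) ^+ 2) =
  p ^+ 2 * \int[leb]_(x in D) (u x ^+ 2) + 2 * p * q * \int[leb]_(x in D) (u x * v x)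
  + q ^+ 2 * \int[leb]_(x in D) (v x ^+ 2).
Proof.
move=> mD Lu Lv.
have iu := integrable_sqr Lu; have iv := integrable_sqr Lv.
have iuv := integrableM_L2 mD Lu Lv.
rewrite -!RintegralZl // -!RintegralD //.
- by apply: eq_Rintegral => x _; ring.
- by apply: (integrableD mD (integrableZl mD (p ^+ 2) iu) (integrableZl mD (2 * p * q) iuv)).
- by apply: (integrableZl mD (q ^+ 2) iv).
- by apply: (integrableZl mD (p ^+ 2) iu).
- by apply: (integrableZl mD (2 * p * q) iuv).
Qed.

(** The quadratic form [int (p u + q v)^2] is nonnegative. *)
Lemma cauchy_L2 D u v : measurable D -> L2 D u -> L2 D v ->
  `|\int[leb]_(x in D) (u x * v x)| <= L2norm D u * L2norm D v.
Proof.
move=> mD Lu Lv.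
rewrite -[leRHS]ger0_norm ?mulr_ge0 ?L2norm_ge0 //.
rewrite -ler_sqr ?nnegrE // !real_normK ?num_real // exprMn !sqr_L2norm.
apply: quadratic_ge0; try by apply: Rintegral_ge0 => x _; exact: sqr_ge0.
move=> p q; rewrite -Rint_sqr_lin //.
by apply: Rintegral_ge0 => x _; exact: sqr_ge0.
Qed.

Lemma minkowski_L2 D u v : measurable D -> L2 D u -> L2 D v ->
  L2norm D (fun x => u x + v x) <= L2norm D u + L2norm D v.
Proof.
move=> mD Lu Lv; rewrite -[leRHS]ger0_norm ?addr_ge0 ?L2norm_ge0 //.
rewrite -[leLHS]ger0_norm ?L2norm_ge0 //.
rewrite -ler_sqr ?nnegrE // !real_normK ?num_real // sqrrD !sqr_L2norm.
have := Rint_sqr_lin 1 1 mD Lu Lv; rewrite expr1n !mul1r !mulr1.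
under eq_Rintegral do rewrite !mul1r.
move=> ->; rewrite lerD2r lerD2l -[leRHS]mulr_natl ler_pM2l //.
exact: le_trans (ler_norm _) (cauchy_L2 mD Lu Lv).
Qed.

Lemma L2normZ D c u : measurable D -> L2 D u ->
  L2norm D (fun x => c * u x) = `|c| * L2norm D u.
Proof.
move=> mD Lu; rewrite /L2norm; under eq_Rintegral do rewrite exprMn.
rewrite RintegralZl //; last exact: integrable_sqr.
by rewrite sqrtrM ?sqr_ge0 // sqrtr_sqr.
Qed.

Lemma L2norm_mono D D' u : measurable D -> measurable D' -> D' `<=` D -> L2 D u ->
  L2norm D' u <= L2norm D u.
Proof.
move=> mD mD' DD Lu; rewrite ler_wsqrtr //; apply: Rintegral_mono => //.
  exact: integrable_sqr.
by move=> x _; exact: sqr_ge0.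
Qed.

Lemma L2norm_le D u v : measurable D -> L2 D u -> L2 D v ->
  (forall x, D x -> `|u x| <= `|v x|) -> L2norm D u <= L2norm D v.
Proof.
move=> mD Lu Lv h; rewrite ler_wsqrtr // le_Rintegral //; try exact: integrable_sqr.
move=> x Dx; rewrite -(real_normK (num_real (u x))) -(real_normK (num_real (v x))).
by rewrite ler_sqr ?nnegrE // h.
Qed.

Lemma eq_L2norm D u v : (forall x, D x -> u x = v x) -> L2norm D u = L2norm D v.
Proof.
by move=> h; congr Num.sqrt; apply: eq_Rintegral => x /[!inE] Dx; rewrite h.
Qed.

Lemma eq_L2 D u v : (forall x, D x -> u x = v x) -> L2 D u -> L2 D v.
Proof.
move=> h [mu foo]; split; first by apply: eq_measurable_fun mu => x /[!inE] /h.
by rewrite (eq_integral (fun x => (u x ^+ 2)%:E)) // => x /[!inE] Dx; rewrite h.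
Qed.

Lemma L2v_integrable_dot D F G : measurable D -> L2v D F -> L2v D G ->
  leb.-integrable D (EFin \o (fun x => dot (F x) (G x))).
Proof.
move=> mD LF LG.
rewrite (_ : _ \o _ = fun x => (\sum_(i < n) (F x ord0 i * G x ord0 i)%:E)%E).
  by apply: integrable_sum => // i _; exact: integrableM_L2.
by apply/funext => x /=; rewrite sumEFin.
Qed.

Lemma L2v_dot_sum D F G : measurable D -> L2v D F -> L2v D G ->
  \int[leb]_(x in D) dot (F x) (G x) =
  \sum_(i < n) \int[leb]_(x in D) (F x ord0 i * G x ord0 i).
Proof.
move=> mD LF LG.
have h (s : seq 'I_n) : leb.-integrable D (EFin \o (fun x => \sum_(i <- s) F x ord0 i * G x ord0 i))
   /\ \int[leb]_(x in D) (\sum_(i <- s) F x ord0 i * G x ord0 i) =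
  \sum_(i <- s) \int[leb]_(x in D) (F x ord0 i * G x ord0 i).
  elim: s => [|i s [ih1 ih2]]; split.
  - rewrite (_ : _ \o _ = cst 0%E); first exact: integrable0.
    by apply/funext => x /=; rewrite big_nil.
  - rewrite big_nil; under eq_Rintegral do rewrite big_nil.
    by rewrite Rintegral_cst // mul0r.
  - rewrite (_ : _ \o _ = (fun x => (F x ord0 i * G x ord0 i)%:E +
       (\sum_(i <- s) F x ord0 i * G x ord0 i)%R%:E)%E).
      apply: (integrableD mD _ ih1); exact: (integrableM_L2 mD (LF i) (LG i)).
    by apply/funext => x /=; rewrite big_cons.
  - under eq_Rintegral do rewrite big_cons.
    by rewrite big_cons RintegralD // ?ih2 //; exact: integrableM_L2.
by case: (h (index_enum 'I_n)).
Qed.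

Lemma sqr_L2vnorm D F : L2vnorm D F ^+ 2 = \int[leb]_(x in D) dot (F x) (F x).
Proof. by rewrite sqr_sqrtr // Rintegral_ge0 // => x _; exact: dot_ge0. Qed.

Lemma L2vnorm_ge0 D F : 0 <= L2vnorm D F. Proof. exact: sqrtr_ge0. Qed.

Lemma L2norm_coord D F i : measurable D -> L2v D F ->
  L2norm D (fun x => F x ord0 i) <= L2vnorm D F.
Proof.
move=> mD LF; rewrite ler_wsqrtr // le_Rintegral //.
- exact: integrable_sqr.
- exact: L2v_integrable_dot.
move=> x Dx; rewrite /dot (bigD1 i) //= -expr2 lerDl sumr_ge0 // => j _.
by rewrite -expr2 sqr_ge0.
Qed.

Lemma L2v_sub D D' F : measurable D -> measurable D' -> D' `<=` D -> L2v D F -> L2v D' F.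
Proof. by move=> mD mD' DD LF i; exact: L2_sub (LF i). Qed.

Lemma L2v_lin D a F G : measurable D -> L2v D F -> L2v D G ->
  L2v D (fun x => a *: F x + G x).
Proof.
move=> mD LF LG i; have := L2_lin a mD (LF i) (LG i).
by congr (L2 _ _); apply/funext => x; rewrite !mxE.
Qed.

Lemma L2v_0 D : measurable D -> L2v D (fun=> 0).
Proof.
move=> mD i; have := L2_0 mD; congr (L2 _ _); apply/funext => x; by rewrite mxE.
Qed.

Lemma L2vZ D a F : measurable D -> L2v D F -> L2v D (fun x => a *: F x).
Proof.
move=> mD LF; have := L2v_lin a mD LF (L2v_0 mD).
by congr (L2v _ _); apply/funext => x; rewrite addr0.
Qed.

Lemma L2vnorm_mono D D' F : measurable D -> measurable D' -> D' `<=` D -> L2v D F ->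
  L2vnorm D' F <= L2vnorm D F.
Proof.
move=> mD mD' DD LF; rewrite ler_wsqrtr //; apply: Rintegral_mono => //.
  exact: L2v_integrable_dot.
by move=> x _; exact: dot_ge0.
Qed.

Lemma L2vnormZ D c F : measurable D -> L2v D F ->
  L2vnorm D (fun x => c *: F x) = `|c| * L2vnorm D F.
Proof.
move=> mD LF; rewrite /L2vnorm.
under eq_Rintegral do rewrite dotZl dotZr mulrA -expr2.
rewrite RintegralZl //; last exact: L2v_integrable_dot.
by rewrite sqrtrM ?sqr_ge0 // sqrtr_sqr.
Qed.

Lemma measurable_dot D F G : (forall i, measurable_fun D (fun x => F x ord0 i)) ->
  (forall i, measurable_fun D (fun x => G x ord0 i)) ->
  measurable_fun D (fun x => dot (F x) (G x)).
Proof.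
move=> mF mG; rewrite /dot.
have h (s : seq 'I_n) : measurable_fun D (fun x => \sum_(i <- s) F x ord0 i * G x ord0 i).
  elim: s => [|i s ih].
    rewrite (_ : (fun _ => _) = cst 0); first exact: measurable_cst.
    by apply/funext => x; rewrite big_nil.
  rewrite (_ : (fun _ => _) = (fun x => F x ord0 i * G x ord0 i) \+
    (fun x => \sum_(i <- s) F x ord0 i * G x ord0 i)); last first.
    by apply/funext => x; rewrite big_cons.
  by apply: measurable_funD => //; apply: measurable_funM.
exact: h.
Qed.

Lemma ae_eq_Rintegral D u v : measurable D -> measurable_fun D u -> measurable_fun D v ->
  u = v %[ae leb in D] -> \int[leb]_(x in D) u x = \int[leb]_(x in D) v x.
Proof.
move=> mD mu mv uv; congr fine; apply: ae_eq_integral => //.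
- exact/measurable_EFinP.
- exact/measurable_EFinP.
- exact: (ae_eq_comp EFin uv).
Qed.

Lemma ae_L2vnorm D F G : measurable D -> L2v D F -> L2v D G ->
  F = G %[ae leb in D] -> L2vnorm D F = L2vnorm D G.
Proof.
move=> mD LF LG FG; congr Num.sqrt; apply: ae_eq_Rintegral => //.
- by apply: measurable_dot => i; case: (LF i).
- by apply: measurable_dot => i; case: (LG i).
- exact: (ae_eq_comp (fun y => dot y y) FG).
Qed.

Lemma ae_int_dot D F G H : measurable D -> L2v D F -> L2v D G -> L2v D H ->
  F = G %[ae leb in D] ->
  \int[leb]_(x in D) dot (F x) (H x) = \int[leb]_(x in D) dot (G x) (H x).
Proof.
move=> mD LF LG LH FG; apply: ae_eq_Rintegral => //.
- by apply: measurable_dot => i; [case: (LF i)|case: (LH i)].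
- by apply: measurable_dot => i; [case: (LG i)|case: (LH i)].
- exact: (ae_eq_comp2 (fun x y => dot y (H x)) FG).
Qed.

(** Integrals over a ball and over a larger domain are compared through
    extension by zero. *)
Definition ext (V : nmodType) D (u : E -> V) (x : E) : V := if x \in D then u x else 0.

Lemma ext_in (V : nmodType) D (u : E -> V) x : D x -> ext D u x = u x.
Proof. by move=> Dx; rewrite /ext mem_set. Qed.

Lemma ext_out (V : nmodType) D (u : E -> V) x : ~ D x -> ext D u x = 0.
Proof. by move=> Dx; rewrite /ext memNset. Qed.

Lemma ext_coord D F i x : ext D F x ord0 i = ext D (fun x => F x ord0 i) x.
Proof. by rewrite /ext; case: ifP => // _; rewrite mxE. Qed.

Lemma Rintegral_ext D D' u : D' `<=` D ->
  \int[leb]_(x in D) ext D' u x = \int[leb]_(x in D') u x.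
Proof.
by move=> DD; rewrite -[X in \int[leb]_(x in X) u x](setIidr DD) Rintegral_mkcondr.
Qed.

Lemma integral_ext D D' u : D' `<=` D ->
  (\int[leb]_(x in D) (ext D' u x)%:E = \int[leb]_(x in D') (u x)%:E)%E.
Proof.
move=> DD; rewrite -[X in (\int[leb]_(x in X) (u x)%:E)%E](setIidr DD) integral_mkcondr.
by apply: eq_integral => x _; rewrite /ext patchE; case: ifP.
Qed.

Lemma measurable_ext D D' u : measurable D -> measurable D' ->
  measurable_fun D' u -> measurable_fun D (ext D' u).
Proof.
move=> mD mD' mu; apply: measurable_funTS.
exact: (measurable_restrictT u mD').1.
Qed.

Lemma ext_sqr D u x : ext D u x ^+ 2 = ext D (fun x => u x ^+ 2) x.
Proof. by rewrite /ext; case: ifP => // _; rewrite expr0n. Qed.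

Lemma L2_ext D D' u : measurable D -> measurable D' -> D' `<=` D -> L2 D' u -> L2 D (ext D' u).
Proof.
move=> mD mD' DD [mu foo]; split; first exact: measurable_ext.
by under eq_integral do rewrite ext_sqr; rewrite integral_ext.
Qed.

Lemma L2norm_ext D D' u : D' `<=` D -> L2norm D (ext D' u) = L2norm D' u.
Proof.
move=> DD; rewrite /L2norm; under eq_Rintegral do rewrite ext_sqr.
by rewrite Rintegral_ext.
Qed.

Lemma L2v_ext D D' F : measurable D -> measurable D' -> D' `<=` D -> L2v D' F -> L2v D (ext D' F).
Proof.
move=> mD mD' DD LF i; have := L2_ext mD mD' DD (LF i).
by congr (L2 _ _); apply/funext => x; rewrite ext_coord.
Qed.

Lemma dot_ext D F G x : dot (ext D F x) (G x) = ext D (fun x => dot (F x) (G x)) x.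
Proof. by rewrite /ext; case: ifP => // _; rewrite dot0l. Qed.

Lemma L2vnorm_ext D D' F : D' `<=` D -> L2vnorm D (ext D' F) = L2vnorm D' F.
Proof.
move=> DD; rewrite /L2vnorm; congr Num.sqrt; rewrite -(Rintegral_ext _ DD).
by apply: eq_Rintegral => x _; rewrite /ext; case: ifP => // _; rewrite dot0l.
Qed.

End L2.

(** * Flat functions at the origin *)

Section flat.
Context {R : realType}.
Implicit Types (t y : R) (k : nat).

(** The functions t^-k exp(-1/t), extended by zero. This family is stable under
    differentiation up to linear combinations, so one induction covers all of
    its members. *)
Definition flat k t : R := if 0 < t then t^-1 ^+ k * expR (- t^-1) else 0.

Lemma flat_le0 k t : t <= 0 -> flat k t = 0.
Proof. by rewrite /flat leNgt => /negbTE ->. Qed.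

Lemma flat_gt0 k t : 0 < t -> 0 < flat k t.
Proof. by move=> t0; rewrite /flat t0 mulr_gt0 ?expR_gt0 // exprn_gt0 // invr_gt0. Qed.

Lemma flat_ge0 k t : 0 <= flat k t.
Proof. by have [t0|t0] := ltP 0 t; [exact/ltW/flat_gt0|rewrite flat_le0]. Qed.

(** The exponential series gives [exp(1/t) >= t^-(k+2) / (k+2)!]. A quadratic
    bound makes the derivative at the origin vanish. *)
Lemma flat_bound k t : flat k t <= (k.+2)`!%:R * t ^+ 2.
Proof.
have [t0|t0] := ltP 0 t; last by rewrite flat_le0 // mulr_ge0 ?sqr_ge0.
have y0 : 0 < t^-1 by rewrite invr_gt0.
rewrite /flat t0 expRN.
have h : t^-1 ^+ k.+2 / (k.+2)`!%:R <= expR t^-1.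
  by apply: le_trans (expR_ge1Dxn k.+1 (ltW y0)); rewrite lerDr.
rewrite ler_pdivrMr ?expR_gt0 //.
apply: (@le_trans _ _ ((k.+2)`!%:R * t ^+ 2 * (t^-1 ^+ k.+2 / (k.+2)`!%:R))).
  rewrite le_eqVlt; apply/orP; left; apply/eqP.
  have f0 : (k.+2)`!%:R != 0 :> R by rewrite pnatr_eq0 -lt0n fact_gt0.
  have tn : t != 0 by rewrite gt_eqF.
  rewrite [t^-1 ^+ k.+2]exprS [t^-1 ^+ k.+1]exprS.
  move: f0; set N : R := _%:R => f0; set Y := t^-1 ^+ k.
  by field; rewrite tn f0.
by rewrite ler_wpM2l // mulr_ge0 ?sqr_ge0.
Qed.

Lemma is_derive_flat_pos k t : 0 < t ->
  is_derive t 1 (flat k) (flat k.+2 t - k%:R * flat k.+1 t).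
Proof.
move=> t0; have tn : t != 0 by rewrite gt_eqF.
apply: (@near_eq_is_derive _ _ _ ((fun y : R => y ^+ k * expR (- y)) \o (fun s : R => s^-1))).
  by near=> s; rewrite /flat /= ifT //; near: s; exact: lt_nbhsr.
have h1 : is_derive (t^-1) 1 (fun y : R => y ^+ k * expR (- y))
   (k%:R * t^-1 ^+ k.-1 * expR (- t^-1) - t^-1 ^+ k * expR (- t^-1)).
  have hX : is_derive t^-1 1 (fun y : R => y ^+ k) (k%:R * t^-1 ^+ k.-1).
    have := @exprn_derivable R k t^-1 1.
    by move=> h; split => //; rewrite exp_derive /GRing.scale /= mulr1.
  have hE : is_derive t^-1 1 (fun y : R => expR (- y)) (- expR (- t^-1)).
    have hN : is_derive t^-1 1 (fun y : R => - y) (-1) by apply: is_deriveNid.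
    by have := is_derive1_comp (is_derive_expR (- t^-1)) hN; rewrite mulrN1.
  apply: (is_derive_eq (is_deriveM hX hE)).
  rewrite /GRing.scale /=; ring.
have h2 : is_derive t 1 (fun s : R => s^-1) (- t ^- 2).
  by have := @is_deriveV R id t 1 1 tn (is_derive_id _ _); rewrite /GRing.scale /= mulr1.
apply: (is_derive_eq (is_derive1_comp h1 h2)).
rewrite /flat t0; case: k {h1} => [|k] /=; rewrite ?mul0r !exprS; field; exact: tn.
Unshelve. all: by end_near. Qed.

Lemma is_derive_flat k t : is_derive t 1 (flat k) (flat k.+2 t - k%:R * flat k.+1 t).
Proof.
have [t0|t0|<-] := ltgtP 0 t; first exact: is_derive_flat_pos.
  rewrite !flat_le0 ?ltW // mulr0 subrr.
  apply: (@near_eq_is_derive _ _ _ (cst 0)).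
    by near=> s; rewrite flat_le0 //; apply: ltW; near: s; exact: lt_nbhsl.
rewrite !flat_le0 // mulr0 subrr.
have h : h^-1 *: ((flat k \o shift 0) (h *: 1) - flat k 0) @[h --> 0^'] --> (0 : R).
  apply/cvgr0Pnorm_le => e e0; near=> h.
  rewrite /= addr0 (flat_le0 k (lexx 0)) subr0 /GRing.scale /= mulr1 normrM normfV.
  have hn : h != 0 by near: h; exact: nbhs_dnbhs_neq.
  rewrite ler_pdivrMl ?normr_gt0 // ger0_norm ?flat_ge0 //.
  apply: le_trans (flat_bound _ _) _.
  rewrite -(real_normK (num_real h)) expr2 mulrA mulrC ler_wpM2l //.
  rewrite mulrC -ler_pdivlMr; last by rewrite ltr0n fact_gt0.
  near: h; apply: dnbhs0_le.
  by rewrite divr_gt0 // ltr0n fact_gt0.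
by split; [apply/cvg_ex; exists 0|exact/cvg_lim].
Unshelve. all: by end_near. Qed.

Lemma continuous_flat k : continuous (flat k).
Proof.
by move=> t; apply: differentiable_continuous; apply/derivable1_diffP; case: (is_derive_flat k t).
Qed.

End flat.

(** * Smooth functions of several variables *)

Section smooth.
Context {R : realType} {n : nat}.
Local Notation E := 'rV[R]_n.
Implicit Types (f g : E -> R) (x v : E) (k : nat) (i : 'I_n).
Local Notation "''e_' i" := (delta_mx ord0 i : E) (at level 8, format "''e_' i").

(** Differentiability of order k by recursion on k. Partial derivatives of
    products and compositions are sums of products, which this recursion follows
    better than a quantification over lists of indices. *)
Fixpoint Ck k f : Prop := match k with
  | 0 => continuous f
  | k'.+1 => continuous f /\ forall i, (forall x, derivable f x 'e_i) /\ Ck k' (pderiv i f)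
  end.

Definition Coo f := forall k, Ck k f.

Lemma Ck_continuous k f : Ck k f -> continuous f.
Proof. by case: k => // k []. Qed.

Lemma Coo_pderiv f i : Coo f -> Coo (pderiv i f).
Proof. by move=> h k; case: (h k.+1) => _ /(_ i) []. Qed.

Lemma smoothP f : smooth f <-> Coo f.
Proof.
split.
  move=> sf k; elim: k f sf => [|k ih] f sf /=; first by case: (sf [::]).
  split; first by case: (sf [::]).
  move=> i; split; first by move=> x; case: (sf [::]).
  apply: ih => s; have := sf (rcons s i); by rewrite /= foldr_rcons.
move=> cf s; elim/last_ind: s f cf => [|s i ih] f cf.
  by split=> [|x i] /=; [exact: (cf 0)|case: (cf 1) => _ /(_ i) []].
by rewrite /= foldr_rcons; apply: ih; exact: Coo_pderiv.
Qed.

Lemma CkS k f : Ck k.+1 f -> Ck k f.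
Proof.
elim: k f => [|k ih] f; first by case.
by move=> [cf h]; split => // i; have [h1 h2] := h i; split => //; exact: ih.
Qed.

Lemma Ck_intro k f (g : 'I_n -> E -> R) : continuous f ->
  (forall i x, is_derive x 'e_i f (g i x)) -> (forall i, Ck k (g i)) -> Ck k.+1 f.
Proof.
move=> cf df ck; split => // i; split; first by move=> x; case: (df i x).
rewrite (_ : pderiv i f = g i) //; by apply/funext => x; case: (df i x).
Qed.

Lemma Coo_is_derive f i x : Coo f -> is_derive x 'e_i f (pderiv i f x).
Proof. by move=> cf; split => //; case: (cf 1) => _ /(_ i) []. Qed.

Lemma Ck_is_derive k f i x : Ck k.+1 f -> is_derive x 'e_i f (pderiv i f x).
Proof. by move=> [_ /(_ i) [h _]]; split. Qed.

Lemma Ck_cst k (c : R) : Ck k (cst c : E -> R).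
Proof.
elim: k c => [|k ih] c; first by move=> x; exact: cst_continuous.
apply: (@Ck_intro _ _ (fun _ => cst 0)).
- by move=> x; exact: cst_continuous.
- by move=> i; exact: ih.
Qed.

Lemma Ck_add k f g : Ck k f -> Ck k g -> Ck k (fun x => f x + g x).
Proof.
elim: k f g => [|k ih] f g cf cg; first by move=> x; apply: continuousD; [exact: cf|exact: cg].
apply: (@Ck_intro _ _ (fun i x => pderiv i f x + pderiv i g x)).
- by move=> x; apply: continuousD; [exact: (Ck_continuous cf)|exact: (Ck_continuous cg)].
- by move=> i x; exact: is_deriveD (Ck_is_derive i x cf) (Ck_is_derive i x cg).
- by move=> i; apply: ih; [case: cf => _ /(_ i) []|case: cg => _ /(_ i) []].
Qed.

Lemma Ck_mul k f g : Ck k f -> Ck k g -> Ck k (fun x => f x * g x).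
Proof.
elim: k f g => [|k ih] f g cf cg; first by move=> x; apply: continuousM; [exact: cf|exact: cg].
apply: (@Ck_intro _ _ (fun i x => f x * pderiv i g x + g x * pderiv i f x)).
- by move=> x; apply: continuousM; [exact: (Ck_continuous cf)|exact: (Ck_continuous cg)].
- by move=> i x; exact: is_deriveM (Ck_is_derive i x cf) (Ck_is_derive i x cg).
- move=> i; apply: Ck_add; apply: ih; try exact: CkS.
    by case: cg => _ /(_ i) [].
  by case: cf => _ /(_ i) [].
Qed.

Lemma Coo_cst (c : R) : Coo (cst c). Proof. by move=> k; exact: Ck_cst. Qed.
Lemma Coo_add f g : Coo f -> Coo g -> Coo (fun x => f x + g x).
Proof. by move=> cf cg k; exact: Ck_add. Qed.
Lemma Coo_mul f g : Coo f -> Coo g -> Coo (fun x => f x * g x).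
Proof. by move=> cf cg k; exact: Ck_mul. Qed.
Lemma Coo_scale c f : Coo f -> Coo (fun x => c * f x).
Proof. by move=> cf; apply: Coo_mul => //; exact: Coo_cst. Qed.

(** Reduces directional derivatives to one variable, for the chain rule and the
    mean value theorem. *)
Lemma is_derive_line (V : normedModType R) (f : V -> R) (x v : V) (d : R) :
  is_derive x v f d <-> is_derive (0 : R) 1 (fun t : R => f (t *: v + x)) d.
Proof.
have e : (fun h : R => h^-1 *: (((fun t : R => f (t *: v + x)) \o shift 0) (h *: 1)
       - f (0 *: v + x))) = (fun h : R => h^-1 *: ((f \o shift x) (h *: v) - f x)).
  by apply/funext => h /=; rewrite addr0 scale0r add0r /GRing.scale /= mulr1.
split => -[h1 h2]; split.
- by rewrite /derivable e.
- by rewrite /derive e.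
- by move: h1; rewrite /derivable e.
- by move: h2; rewrite /derive e.
Qed.

Lemma is_derive_coord i j x : is_derive x 'e_j (fun y : E => y ord0 i) (i == j)%:R.
Proof.
apply/is_derive_line; rewrite (_ : (fun _ => _) = fun t : R => t * (i == j)%:R + x ord0 i).
  by apply: is_derive_eq; rewrite /GRing.scale /= ?mulr1 ?mulr0 ?addr0 ?add0r //.
by apply/funext => t; rewrite !mxE eqxx.
Qed.

Lemma Coo_coord i : Coo (fun x : E => x ord0 i).
Proof.
case=> [|k]; first exact: coord_continuous.
apply: (@Ck_intro _ _ (fun j => cst (i == j)%:R)); first exact: coord_continuous.
  by move=> j x; exact: is_derive_coord.
by move=> j; exact: Ck_cst.
Qed.

Lemma Coo_sum (I : Type) (s : seq I) (f : I -> E -> R) : (forall j, Coo (f j)) ->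
  Coo (fun x => \sum_(i <- s) f i x).
Proof.
move=> cf; elim: s => [|i s ih].
  by rewrite (_ : (fun _ => _) = cst 0); [exact: Coo_cst|apply/funext => ?; rewrite big_nil].
rewrite (_ : (fun _ => _) = fun x => f i x + \sum_(j <- s) f j x); first exact: Coo_add.
by apply/funext => ?; rewrite big_cons.
Qed.

Lemma Coo_prod (I : Type) (s : seq I) (f : I -> E -> R) : (forall j, Coo (f j)) ->
  Coo (fun x => \prod_(i <- s) f i x).
Proof.
move=> cf; elim: s => [|i s ih].
  by rewrite (_ : (fun _ => _) = cst 1); [exact: Coo_cst|apply/funext => ?; rewrite big_nil].
rewrite (_ : (fun _ => _) = fun x => f i x * \prod_(j <- s) f j x); first exact: Coo_mul.
by apply/funext => ?; rewrite big_cons.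
Qed.

Lemma Coo_dotr (b : E) : Coo (fun x => dot b x).
Proof. by apply: Coo_sum => i; apply: Coo_scale; exact: Coo_coord. Qed.

Lemma Coo_dot : Coo (fun x : E => dot x x).
Proof. by apply: Coo_sum => i; apply: Coo_mul; exact: Coo_coord. Qed.

Lemma is_derive_comp1 (h : R -> R) f x v (a d : R) :
  is_derive (f x) 1 h a -> is_derive x v f d -> is_derive x v (h \o f) (a * d).
Proof.
move=> dh /is_derive_line df; apply/is_derive_line.
apply: (is_derive1_comp (f := h)) => //.
by rewrite scale0r add0r.
Qed.

(** The induction is on the order of differentiability for all k at once, since
    the derivative of [flat k] involves [flat k.+1] and [flat k.+2]. *)
Lemma Coo_flat k f : Coo f -> Coo (flat k \o f).
Proof.
move=> cf j; elim: j k => [|j ih] k.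
  move=> x; apply: continuous_comp; first exact: (cf 0).
  exact: continuous_flat.
apply: (@Ck_intro _ _ (fun i x => ((flat k.+2 \o f) x + (- k%:R) * (flat k.+1 \o f) x) * pderiv i f x)).
- by move=> x; apply: continuous_comp; [exact: (cf 0)|exact: continuous_flat].
- move=> i x; rewrite mulNr; apply: is_derive_comp1; first exact: is_derive_flat.
  exact: Coo_is_derive.
- move=> i; apply: Ck_mul; last exact: Coo_pderiv.
  by apply: Ck_add => //; apply: Ck_mul => //; exact: Ck_cst.
Qed.

Lemma continuous_inv f : continuous f -> (forall x, f x != 0) -> continuous (fun x => (f x)^-1).
Proof. by move=> cf f0 x; apply: continuousV => //; exact: cf. Qed.

Lemma Coo_inv f : Coo f -> (forall x, f x != 0) -> Coo (fun x => (f x)^-1).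
Proof.
move=> cf f0; elim => [|j ih]; first by apply: continuous_inv => //; exact: (cf 0).
apply: (@Ck_intro _ _ (fun i x => (-1 * ((f x)^-1 * (f x)^-1)) * pderiv i f x)).
- by apply: continuous_inv => //; exact: (cf 0).
- move=> i x; have [h1 h2] := Coo_is_derive i x cf; split; first exact: derivableV.
  by rewrite deriveV // h2 /GRing.scale /= expr2 invfM mulN1r.
- move=> i; apply: Ck_mul; last exact: Coo_pderiv.
  by apply: Ck_mul; [exact: Ck_cst|exact: Ck_mul].
Qed.

Lemma is_derive_rescale c f x v (d : R) : is_derive (c *: x) v f d ->
  is_derive x v (fun y => f (c *: y)) (c * d).
Proof.
move=> /is_derive_line df; apply/is_derive_line.
rewrite (_ : (fun _ => _) = (fun t : R => f (t *: v + c *: x)) \o (fun t : R => c * t)); last first.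
  by apply/funext => t /=; rewrite scalerDr scalerA.
rewrite mulrC; apply: is_derive1_comp; first by rewrite mulr0.
by apply: is_derive_eq; rewrite /GRing.scale /= mulr1.
Qed.

Lemma continuous_rescale c f : continuous f -> continuous (fun x => f (c *: x)).
Proof.
move=> cf x; apply: (continuous_comp (f := fun y : E => c *: y)).
  exact: scaler_continuous.
exact: cf.
Qed.

Lemma Coo_rescale c f : Coo f -> Coo (fun x => f (c *: x)).
Proof.
move=> cf k; elim: k f cf => [|k ih] f cf; first by apply: continuous_rescale; exact: (cf 0).
apply: (@Ck_intro _ _ (fun i x => c * pderiv i f (c *: x))).
- by apply: continuous_rescale; exact: (cf 0).
- by move=> i x; apply: is_derive_rescale; exact: Coo_is_derive.
- by move=> i; apply: Ck_mul; [exact: Ck_cst|apply: ih; exact: Coo_pderiv].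
Qed.

Lemma pderiv_rescale c f i x : Coo f ->
  pderiv i (fun y => f (c *: y)) x = c * pderiv i f (c *: x).
Proof. by move=> cf; apply: derive_val; apply: is_derive_rescale; exact: Coo_is_derive. Qed.

Lemma pderivM f g i x : Coo f -> Coo g ->
  pderiv i (fun y => f y * g y) x = f x * pderiv i g x + g x * pderiv i f x.
Proof. by move=> cf cg; apply: derive_val; apply: is_deriveM; exact: Coo_is_derive. Qed.

Lemma pderiv_lin c f g i x : Coo f -> Coo g ->
  pderiv i (fun y => c * f y + g y) x = c * pderiv i f x + pderiv i g x.
Proof.
move=> cf cg; apply: derive_val; apply: is_deriveD; last exact: Coo_is_derive.
by have := is_deriveZ c (Coo_is_derive i x cf).
Qed.

Lemma pderiv_dotr b i x : pderiv i (fun y => dot b y) x = b ord0 i.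
Proof.
apply: derive_val; apply/is_derive_line.
rewrite (_ : (fun _ => _) = fun t : R => t * b ord0 i + dot b x).
  by apply: is_derive_eq; rewrite /GRing.scale /= ?mulr1 ?mulr0 ?addr0 ?add0r.
apply/funext => t; rewrite dotDr dotZr; congr (_ * _ + _).
rewrite /dot (bigD1 i) //= mxE !eqxx mulr1 big1 ?addr0 // => j /negbTE ji.
by rewrite mxE eqxx ji mulr0.
Qed.

End smooth.

(** * Smooth transition *)

Section step.
Context {R : realType}.
Implicit Types (t : R).

(** Vanishes on the negative half-line and equals 1 after 1. *)
Definition step t : R := flat 0 t / (flat 0 t + flat 0 (1 - t)).

Lemma step_den_gt0 t : 0 < flat 0 t + flat 0 (1 - t).
Proof.
have [t0|t0] := ltP 0 t; first by rewrite ltr_wpDr ?flat_ge0 ?flat_gt0.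
by rewrite ltr_wpDl ?flat_ge0 // flat_gt0 //; lra.
Qed.

Lemma step_le0 t : t <= 0 -> step t = 0.
Proof. by move=> t0; rewrite /step flat_le0 // mul0r. Qed.

Lemma step_ge1 t : 1 <= t -> step t = 1.
Proof.
move=> t1; rewrite /step (@flat_le0 _ _ (1 - t)) ?subr_le0 // addr0 divff // gt_eqF //.
by apply: flat_gt0; lra.
Qed.

Lemma step_ge0 t : 0 <= step t.
Proof. by rewrite divr_ge0 ?flat_ge0 // ltW // step_den_gt0. Qed.

Lemma step_le1 t : step t <= 1.
Proof. by rewrite ler_pdivrMr ?step_den_gt0 // mul1r lerDl flat_ge0. Qed.

End step.

(** * Test functions *)

Section test_functions.
Context {R : realType} {n : nat}.
Local Notation E := 'rV[R]_n.
Local Notation leb := (@lebesgue_rV R n).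
Implicit Types (f g phi : E -> R) (x v : E) (k : nat) (i : 'I_n) (D Om K : set E).

Lemma Coo_step f : Coo f -> Coo (step \o f).
Proof.
move=> cf; apply: Coo_mul; first exact: Coo_flat.
apply: Coo_inv; last by move=> x; rewrite gt_eqF // step_den_gt0.
apply: Coo_add; first exact: Coo_flat.
apply: (Coo_flat 0 (f := fun x => 1 - f x)).
have := Coo_add (Coo_cst 1) (Coo_scale (-1) cf).
by under eq_fun do rewrite mulN1r.
Qed.

Lemma Rint_dct D (f_ : nat -> E -> R) f g : measurable D ->
  (forall k, measurable_fun D (f_ k)) ->
  (forall x, D x -> f_ ^~ x @ \oo --> f x) ->
  leb.-integrable D (EFin \o g) ->
  (forall k x, D x -> `|f_ k x| <= g x) ->
  leb.-integrable D (EFin \o f) /\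
  (\int[leb]_(x in D) f_ k x) @[k --> \oo] --> \int[leb]_(x in D) f x.
Proof.
move=> mD mf cf ig fg.
have mf' : measurable_fun D f by apply: measurable_fun_cvg cf.
have [|||||h1 _ h3] := @dominated_convergence _ _ _ leb D mD (fun k => EFin \o f_ k) (EFin \o f) (EFin \o g).
- by move=> k; exact/measurable_EFinP.
- exact/measurable_EFinP.
- by apply: aeW => x Dx; apply: cvg_comp (cf x Dx) _.
- exact: ig.
- by apply: aeW => x k Dx /=; rewrite lee_fin fg.
split => //; apply: fine_cvg.
by rewrite /Rintegral fineK //; exact: integrable_fin_num.
Qed.

Lemma test_fun_intro Om K phi : Coo phi -> compact K -> K `<=` Om ->
  (forall x, phi x != 0 -> K x) -> test_fun Om phi.
Proof.
move=> sp cK KO hK.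
have clK : closure [set x | phi x != 0] `<=` K.
  have /closure_id -> : closed K by apply: compact_closed => //; exact: norm_hausdorff.
  by apply: closure_subset => x; exact: hK.
split; first exact/smoothP.
  by apply: subclosed_compact cK clK; exact: closed_closure.
by move=> x /clK; exact: KO.
Qed.

Definition tsupp phi : set E := closure [set x | phi x != 0].

Lemma tsupp_out phi x : ~ tsupp phi x -> phi x = 0.
Proof.
move=> h; apply/eqP; apply: contraPT h => /negP/negP h; apply.
exact: subset_closure.
Qed.

Lemma test_Coo Om phi : test_fun Om phi -> Coo phi.
Proof. by case=> /smoothP. Qed.

Lemma pderiv_tsupp phi i x : ~ tsupp phi x -> pderiv i phi x = 0.
Proof.
move=> h; rewrite /pderiv (@near_eq_derive _ _ _ phi (cst 0)); first exact: derive_cst.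
have : open (~` tsupp phi) by apply: closed_openC; exact: closed_closure.
move=> o; have : nbhs x (~` tsupp phi) by apply: open_nbhs_nbhs.
by apply: filterS => y; exact: tsupp_out.
Qed.

Lemma test_pderiv Om phi i : test_fun Om phi -> test_fun Om (pderiv i phi).
Proof.
move=> tp; have [_ c s] := tp; apply: (test_fun_intro (K := tsupp phi)) => //.
  by apply: Coo_pderiv; exact: test_Coo tp.
by move=> x; apply: contraPP => h; rewrite pderiv_tsupp // eqxx.
Qed.

Lemma test_sub Om Om' phi : Om `<=` Om' -> test_fun Om phi -> test_fun Om' phi.
Proof. by move=> OO [a b c]; split => // x /c; exact: OO. Qed.

Lemma test_mul Om f phi : Coo f -> test_fun Om phi -> test_fun Om (fun x => f x * phi x).
Proof.
move=> cf tp; have [_ c s] := tp; apply: (test_fun_intro (K := tsupp phi)) => //.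
  by apply: Coo_mul => //; exact: test_Coo tp.
by move=> x; apply: contraPP => h; rewrite (tsupp_out h) mulr0 eqxx.
Qed.

Lemma test_out Om phi x : test_fun Om phi -> ~ Om x -> phi x = 0.
Proof. by move=> [_ _ c] nx; apply: tsupp_out => /c. Qed.

Lemma test_pderiv_out Om phi i x : test_fun Om phi -> ~ Om x -> pderiv i phi x = 0.
Proof. by move=> /(test_pderiv i) /test_out; exact. Qed.

Lemma test_rescale Om Om' c phi : 0 < c -> (forall x, Om x -> Om' (c^-1 *: x)) ->
  test_fun Om phi -> test_fun Om' (fun x => phi (c *: x)).
Proof.
move=> c0 OO tp; have [_ cp s] := tp.
apply: (test_fun_intro (K := (fun x => c^-1 *: x) @` tsupp phi)).
- by apply: Coo_rescale; exact: test_Coo tp.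
- apply: continuous_compact => //; apply: continuous_subspaceT => x.
  exact: scaler_continuous.
- by move=> _ [x /s sx <-]; exact: OO.
- move=> x h; exists (c *: x); first exact: subset_closure.
  by rewrite scalerA mulVf ?scale1r // gt_eqF.
Qed.

Lemma test_bounded Om phi : test_fun Om phi -> exists M : R, forall x, `|phi x| <= M.
Proof.
move=> tp; have [_ c _] := tp.
have : bounded_set (phi @` tsupp phi).
  apply: compact_bounded; apply: continuous_compact => //.
  by apply: continuous_subspaceT; exact: (test_Coo tp 0).
move=> [M [_ /(_ (`|M| + 1))]].
have h : M < `|M| + 1 by apply: le_lt_trans (ler_norm _) _; rewrite ltrDl.
move=> /(_ h) hM; exists (`|M| + 1) => x.
have [tx|tx] := pselect (tsupp phi x); first by apply: hM; exists x.
by rewrite tsupp_out // normr0 addr_ge0.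
Qed.

Lemma test_supp_ball Om phi : test_fun Om phi ->
  exists2 r : R, 0 < r & forall x, ~ Ball r x -> phi x = 0.
Proof.
move=> [_ c _]; have [M [_ /(_ (`|M| + 1))]] := compact_bounded c.
have h : M < `|M| + 1 by apply: le_lt_trans (ler_norm _) _; rewrite ltrDl.
move=> /(_ h) hM; exists (n%:R * (`|M| + 1) + 1).
  by rewrite ltr_wpDl // mulr_ge0 ?ler0n // addr_ge0.
move=> x nx; apply: tsupp_out => tx; apply: nx.
rewrite /Ball /=; apply: (@le_lt_trans _ _ (n%:R * (`|M| + 1))); last by rewrite ltrDl.
apply: eucl_le_sup; first by rewrite addr_ge0.
by move=> i; apply: le_trans (normr_coord _ _) (hM _ tx).
Qed.

Lemma Coo_measurable f D : measurable D -> Coo f -> measurable_fun D f.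
Proof. by move=> mD cf; apply: measurable_funTS; apply: continuous_measurable_rV; exact: (cf 0). Qed.

Lemma test_dominated Om phi : test_fun Om phi -> exists M r : R, 0 < r /\
  forall x, `|phi x| <= ext (Ball r) (fun=> M) x.
Proof.
move=> tp; have [M hM] := test_bounded tp; have [r r0 hr] := test_supp_ball tp.
exists M, r; split => // x; have [bx|bx] := pselect (Ball r x); first by rewrite ext_in.
by rewrite ext_out // hr // normr0.
Qed.

Lemma integrable_ext_cst r (M : R) D : measurable D ->
  leb.-integrable D (EFin \o ext (Ball r) (fun=> M)).
Proof.
move=> mD; apply: (integrableS measurableT) => //.
have mB := @measurable_Ball R n r.
apply/integrableP; split.
  apply/measurable_EFinP; apply: measurable_ext => //; exact: measurable_cst.
rewrite (eq_integral (fun x => (ext (Ball r) (fun=> `|M|) x)%:E)); last first.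
  by move=> x _ /=; rewrite /ext; case: ifP => //; rewrite normr0.
rewrite integral_ext // integral_cst // lte_mul_pinfty //; exact: Ball_leb.
Qed.

Lemma test_integrable Om phi D : measurable D -> test_fun Om phi ->
  leb.-integrable D (EFin \o phi).
Proof.
move=> mD tp; have [M [r [r0 h]]] := test_dominated tp.
apply: integrable_le (integrable_ext_cst r M mD) _ => //.
exact: Coo_measurable (test_Coo tp).
Qed.

Lemma test_L2 Om phi D : measurable D -> test_fun Om phi -> L2 D phi.
Proof.
move=> mD tp; apply: integrable_L2; first exact: Coo_measurable (test_Coo tp).
apply: test_integrable => //; rewrite (_ : (fun _ => _) = fun x => phi x * phi x).
  exact: test_mul (test_Coo tp) tp.
by apply/funext => x; rewrite expr2.
Qed.

Lemma Rint_translate (h : E) f : leb.-integrable setT (EFin \o f) ->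
  \int[leb]_x f (x + h) = \int[leb]_x f x.
Proof.
move=> fi; have := Rintegral_aff h ltr01 measurableT fi.
by rewrite preimage_setT expr1n invr1 mul1r => <-; apply: eq_Rintegral => x _; rewrite /aff scale1r.
Qed.

Lemma MVT_line f v (df : E -> R) (M : R) x (h : R) : 0 < h ->
  (forall x, is_derive x v f (df x)) -> (forall x, `|df x| <= M) ->
  `|h^-1 * (f (x + h *: v) - f x)| <= M.
Proof.
move=> h0 fd dM.
have dg (t : R) : is_derive t 1 (fun t : R => f (t *: v + x)) (df (t *: v + x)).
  apply/is_derive_line; rewrite (_ : (fun _ => _) = (fun s => f (s *: v + (t *: v + x)))).
    by have /is_derive_line := fd (t *: v + x).
  by apply/funext => s; congr f; rewrite [s%:A]mulr1 scalerDl addrA.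
have [|c _ e] := MVT h0 (fun t _ => dg t).
  apply: continuous_subspaceT => t; apply: differentiable_continuous.
  by apply/derivable1_diffP; case: (dg t).
have -> : f x = f (0 *: v + x) by rewrite scale0r add0r.
rewrite (addrC x) e subr0 mulrC mulfK ?gt_eqF //.
Qed.

(** Difference quotients of phi have integral zero by translation invariance.
    They are bounded by the mean value theorem and live on a fixed ball, so the
    limit follows by dominated convergence. *)
Lemma Rint_pderiv_test phi i : test_fun setT phi -> \int[leb]_x pderiv i phi x = 0.
Proof.
move=> tp; set v : E := delta_mx ord0 i.
have cp := test_Coo tp.
have [M hM] := test_bounded (test_pderiv i tp).
have [r r0 hr] := test_supp_ball tp.
pose D k x := (k.+1%:R^-1 : R)^-1 * (phi (x + k.+1%:R^-1 *: v) - phi x).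
have cD x : setT x -> D ^~ x @ \oo --> pderiv i phi x.
  move=> _; have [/cvg_ex[/= l hl] d] := Coo_is_derive i x cp.
  have -> : pderiv i phi x = l by rewrite -d; apply/cvg_lim.
  have h0 : (fun k : nat => k.+1%:R^-1 : R) @ \oo --> 0^'.
    move=> A /= hA; have h : \forall k \near \oo, (harmonic k != 0 :> R -> A (harmonic k)).
      exact: (@cvg_harmonic R _ hA).
    rewrite /=; apply: filterS h => k; apply.
    by rewrite gt_eqF // harmonic_gt0.
  have := cvg_comp _ _ h0 hl; apply: cvg_trans; apply: near_eq_cvg; near=> k.
  by rewrite /D /= /GRing.scale /= (addrC x).
(* translations by at most a unit vector stay in the ball of radius r + 1 *)
have ig : leb.-integrable setT (EFin \o ext (Ball (r + 1)) (fun=> M)).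
  exact: integrable_ext_cst.
have ip : leb.-integrable setT (EFin \o phi) by exact: test_integrable tp.
have ipt (w : E) : leb.-integrable setT (EFin \o (fun x => phi (x + w))).
  have := integrable_aff w ltr01 measurableT ip; rewrite preimage_setT.
  by congr (integrable _ _ _); apply/funext => x /=; rewrite /aff scale1r.
have iD k : leb.-integrable setT (EFin \o D k).
  apply: (integrableZl measurableT (k.+1%:R^-1)^-1 (f := EFin \o (fun x => phi (x + k.+1%:R^-1 *: v) - phi x))).
  exact: (integrableB measurableT (ipt _) ip).
have mD k : measurable_fun setT (D k).
  by apply/measurable_EFinP; exact: measurable_int (iD k).
have DM k x : setT x -> `|D k x| <= ext (Ball (r + 1)) (fun=> M) x.
  move=> _; have k0 : 0 < k.+1%:R^-1 :> R by rewrite invr_gt0.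
  have [bx|bx] := pselect (Ball (r + 1) x).
    rewrite ext_in // /D; apply: (@MVT_line _ _ (pderiv i phi)) => // y.
    exact: Coo_is_derive.
  rewrite ext_out // /D (hr x) ?subr0; last first.
    by move=> hx; apply: bx; apply: lt_trans hx _; rewrite ltrDl.
  rewrite hr ?mulr0 ?normr0 // => hx; apply: bx; rewrite /Ball /=.
  have -> : x = (x + k.+1%:R^-1 *: v) + (- k.+1%:R^-1) *: v by rewrite scaleNr addrK.
  apply: le_lt_trans (euclD _ _) _; apply: ltr_leD => //.
  rewrite euclZ normrN gtr0_norm // eucl_delta mulr1 invf_le1 // ler1n.
  by [].
have [_ lim0] := Rint_dct measurableT mD cD ig DM.
have Dk0 k : \int[leb]_x D k x = 0.
  rewrite /D RintegralZl //; last exact: (integrableB measurableT (ipt _) ip).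
  by rewrite RintegralB // Rint_translate // subrr mulr0.
move: lim0; under eq_fun do rewrite Dk0.
move=> lim0; rewrite -(cvg_lim _ lim0) //; apply/cvg_lim => //; exact: cvg_cst.
Unshelve. all: by end_near. Qed.

End test_functions.

(** * Measures with a density *)

Section density.
Context {R : realType} {n : nat}.
Local Notation E := 'rV[R]_n.
Local Notation leb := (@lebesgue_rV R n).
Variable f : E -> R.
Hypothesis (mf : measurable_fun setT f) (f0 : forall x, 0 <= f x).

Definition density (A : set E) : \bar R := (\int[leb]_(x in A) (f x)%:E)%E.

Let density0 : density set0 = 0%E. Proof. exact: integral_set0. Qed.
Let density_ge0 A : (0 <= density A)%E.
Proof. by apply: integral_ge0 => x _; rewrite lee_fin. Qed.
Let density_sigma_additive : semi_sigma_additive density.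
Proof.
move=> F mF tF mUF; rewrite /density ge0_integral_bigcup //.
- by apply: is_cvg_ereal_nneg_natsum_cond => k _ _; exact: density_ge0.
- by apply/measurable_EFinP; exact: measurable_funTS.
- by move=> x _; rewrite lee_fin.
Qed.
HB.instance Definition _ := isMeasure.Build _ _ _ density
  density0 density_ge0 density_sigma_additive.
Definition densitym : {measure set E -> \bar R} := density.
End density.

(** * The fundamental lemma of the calculus of variations *)

Section fundamental_lemma.
Context {R : realType} {n : nat}.
Local Notation E := 'rV[R]_n.
Local Notation leb := (@lebesgue_rV R n).
Implicit Types (f g h u v phi chi : E -> R) (x : E) (i : 'I_n) (D Om K : set E) (F G : E -> E).

Definition cbox (a b : 'I_n -> R) : set E := [set x | forall i, a i <= x ord0 i <= b i].

Lemma closed_cbox a b : closed (cbox a b).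
Proof.
have -> : cbox a b = \bigcap_(i in setT) ((fun x : E => x ord0 i) @^-1` `[a i, b i]%classic).
  by apply/seteqP; split => x h i => [_|]; have := h i; rewrite /= in_itv //; exact.
apply: closed_bigI => i _; apply: preimage_closed; last exact: itv_closed.
by move=> x _; exact: coord_continuous.
Qed.

Lemma compact_cbox a b : compact (cbox a b).
Proof.
apply: bounded_closed_compact; last exact: closed_cbox.
exists (\sum_i (`|a i| + `|b i|)); split; first exact: num_real.
move=> M hM x hx; apply: le_trans (ltW hM).
rewrite [leLHS]/Num.norm /= mx_normrE; apply/bigmax_leP; split => /=.
  by apply: sumr_ge0 => i _; rewrite addr_ge0.
move=> [j i] _ /=; rewrite (ord1 j) (bigD1 i) //=.
apply: (@le_trans _ _ (`|a i| + `|b i|)); last first.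
  by rewrite lerDl sumr_ge0 // => k _; rewrite addr_ge0.
have /andP[h1 h2] := hx i; rewrite ler_norml.
have := ler_norm (b i); have := ler_norm (- a i); rewrite normrN.
by have := normr_ge0 (a i); have := normr_ge0 (b i); lra.
Qed.

(** Test functions with values in [0, 1] that converge to the indicator of an
    open box. *)
Definition boxbump (a b : 'I_n -> R) (k : nat) (x : E) : R :=
  \prod_(i < n) (step (k%:R * (x ord0 i - a i)) * step (k%:R * (b i - x ord0 i))).

Lemma Coo_boxbump a b k : Coo (boxbump a b k).
Proof.
apply: Coo_prod => i; apply: Coo_mul.
  apply: (Coo_step (f := fun x : E => k%:R * (x ord0 i - a i))).
  by apply: Coo_scale; apply: Coo_add; [exact: Coo_coord|exact: Coo_cst].
apply: (Coo_step (f := fun x : E => k%:R * (b i - x ord0 i))).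
apply: Coo_scale; apply: Coo_add; first exact: Coo_cst.
rewrite (_ : (fun _ => _) = fun x : E => -1 * x ord0 i).
  by apply: Coo_scale; exact: Coo_coord.
by apply/funext => x; rewrite mulN1r.
Qed.

Lemma boxbump_ge0 a b k x : 0 <= boxbump a b k x.
Proof. by apply: prodr_ge0 => i _; rewrite mulr_ge0 ?step_ge0. Qed.

Lemma boxbump_le1 a b k x : boxbump a b k x <= 1.
Proof.
suff /andP[] : 0 <= boxbump a b k x <= 1 by [].
rewrite /boxbump; apply: (big_ind (fun y : R => 0 <= y <= 1)); first by rewrite ler01 lexx.
  by move=> y z /andP[y0 y1] /andP[z0 z1]; rewrite mulr_ge0 //= mulr_ile1.
by move=> i _; rewrite mulr_ge0 ?step_ge0 //= mulr_ile1 ?step_ge0 ?step_le1.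
Qed.

Lemma boxbump_out a b k x : ~ obox a b x -> boxbump a b k x = 0.
Proof.
move=> nx; have [i hi] : exists i, ~~ (a i < x ord0 i < b i).
  by apply/existsP; apply: contra_notT nx => /existsPn h i; have := h i; rewrite negbK.
apply/eqP; rewrite prodf_seq_eq0; apply/hasP; exists i; first exact: mem_index_enum.
rewrite /= mulf_eq0; move: hi; rewrite negb_and -!leNgt => /orP[h|h].
  by rewrite step_le0 ?eqxx // mulr_ge0_le0 // subr_le0.
by rewrite [X in _ || (X == 0)]step_le0 ?eqxx ?orbT // mulr_ge0_le0 // subr_le0.
Qed.

Lemma step_cvg1 (t : R) : 0 < t -> step (k%:R * t) @[k --> \oo] --> (1 : R).
Proof.
move=> t0; apply: cvg_near_cst; near=> k.
apply/eqP; rewrite step_ge1 // -ler_pdivrMr // mul1r; near: k.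
exact: nbhs_infty_ger.
Unshelve. all: by end_near. Qed.

Lemma cvgM1 (s t : nat -> R) : s @ \oo --> (1 : R) -> t @ \oo --> (1 : R) ->
  (fun k => s k * t k) @ \oo --> (1 : R).
Proof. by move=> hs ht; rewrite -[X in _ --> X]mulr1; apply: cvgM. Qed.

Lemma boxbump_cvg a b x : obox a b x -> boxbump a b k x @[k --> \oo] --> (1 : R).
Proof.
move=> bx; rewrite /boxbump.
elim: (index_enum 'I_n) => [|i s ih].
  by under eq_fun do rewrite big_nil; exact: cvg_cst.
under eq_fun do rewrite big_cons.
apply: cvgM1 => //; have /andP[h1 h2] := bx i.
by apply: cvgM1; apply: step_cvg1; rewrite subr_gt0.
Qed.

Lemma Rint_supp D D' f : D `<=` D' -> (forall x, D' x -> ~ D x -> f x = 0) ->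
  \int[leb]_(x in D') f x = \int[leb]_(x in D) f x.
Proof.
move=> DD h; rewrite -(Rintegral_ext _ DD); apply: eq_Rintegral => x /[!inE] Dx.
by have [dx|dx] := pselect (D x); [rewrite ext_in|rewrite ext_out // h].
Qed.

Lemma obox_sub_cbox a b : obox a b `<=` cbox a b.
Proof. by move=> x h i; have /andP[/ltW-> /ltW->] := h i. Qed.

(** The integral over the box is the limit of the integrals against box bumps,
    which are test functions of Om as the closed box lies in Om. *)
Lemma Rint_obox0 Om h a b : open Om -> cbox a b `<=` Om -> L2 Om h ->
  (forall chi, test_fun Om chi -> \int[leb]_(x in Om) (h x * chi x) = 0) ->
  leb.-integrable (obox a b) (EFin \o h) /\ \int[leb]_(x in obox a b) h x = 0.
Proof.
move=> oO bO Lh h0; set Q := obox a b.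
have mO := open_measurable_rV oO.
have mQ : measurable Q := measurable_obox a b.
have QO : Q `<=` Om by move=> x /obox_sub_cbox /bO.
have LQ := L2_sub mO mQ QO Lh.
have Qoo : (leb Q < +oo)%E by rewrite leb_obox ltry.
have ih : leb.-integrable Q (EFin \o h).
  have L1 : L2 Q (fun=> 1 : R).
    by apply: (@L2_bounded _ _ _ _ 1) => // x _; rewrite normr1.
  have := integrableM_L2 mQ LQ L1.
  by congr (integrable _ _ _); apply/funext => x /=; rewrite mulr1.
split => //.
have mh : measurable_fun Q h by case: LQ.
have [|x Qx|||_ lim] := @Rint_dct R n Q (fun k x => h x * boxbump a b k x) h (fun x => `|h x|) mQ.
- move=> k; apply: measurable_funM => //; exact: (Coo_measurable mQ (Coo_boxbump a b k)).
- rewrite -[X in _ --> X]mulr1; apply: cvgM; first exact: cvg_cst.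
  exact: boxbump_cvg.
- exact: (integrable_norm ih).
- move=> k x Qx; rewrite normrM (ger0_norm (boxbump_ge0 _ _ _ _)).
  by rewrite ler_piMr // boxbump_le1.
have e0 k : \int[leb]_(x in Q) (h x * boxbump a b k x) = 0.
  rewrite -(Rint_supp QO); last by move=> x _ nQ; rewrite boxbump_out // mulr0.
  apply: h0; apply: (test_fun_intro (K := cbox a b)) => //; first exact: Coo_boxbump.
    exact: compact_cbox.
  move=> x; apply: contra_neqP => nx; apply: boxbump_out => bx; apply: nx.
  exact: obox_sub_cbox.
move: lim; under eq_fun do rewrite e0.
by move=> lim; rewrite -(cvg_lim _ lim) //; apply/cvg_lim => //; exact: cvg_cst.
Qed.

(** The positive and negative parts of h have the same integral over all
    sub-boxes, hence define the same measure, hence agree almost everywhere. *)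
Lemma ae0_cbox Om h a b : open Om -> cbox a b `<=` Om -> L2 Om h ->
  (forall chi, test_fun Om chi -> \int[leb]_(x in Om) (h x * chi x) = 0) ->
  h = (fun=> 0) %[ae leb in obox a b].
Proof.
move=> oO bO Lh h0; set Q := obox a b.
have mQ : measurable Q := measurable_obox a b.
have [ih _] := Rint_obox0 oO bO Lh h0.
have mh : measurable_fun Q h by move/measurable_int: ih => /measurable_EFinP.
pose p := ext Q (fun x => Num.max (h x) 0).
pose m := ext Q (fun x => Num.max (- h x) 0).
have mp : measurable_fun setT p.
  by apply: measurable_ext => //; apply: measurable_maxr.
have mm : measurable_fun setT m.
  by apply: measurable_ext => //; apply: measurable_maxr => //; exact: measurable_funN.
have p0 x : 0 <= p x by rewrite /p /ext; case: ifP => // _; rewrite le_max lexx orbT.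
have m0 x : 0 <= m x by rewrite /m /ext; case: ifP => // _; rewrite le_max lexx orbT.
have iabs : leb.-integrable setT (EFin \o ext Q (fun x => `|h x|)).
  apply/integrableP; split.
    by apply/measurable_EFinP; apply: measurable_ext => //; exact: measurableT_comp.
  rewrite (eq_integral (fun x => (ext Q (fun x => `|h x|) x)%:E)); last first.
    by move=> x _ /=; rewrite /ext; case: ifP => // _; rewrite ?normr_id ?normr0.
  by rewrite integral_ext //; have /integrableP[] := ih.
have ip : leb.-integrable setT (EFin \o p).
  apply: integrable_le iabs _ => // x _; rewrite ger0_norm // /p /ext.
  by case: ifP => // _; rewrite ge_max ler_norm normr_ge0.
have im : leb.-integrable setT (EFin \o m).
  apply: integrable_le iabs _ => // x _; rewrite ger0_norm // /m /ext.
  by case: ifP => // _; rewrite ge_max normr_ge0 andbT -normrN ler_norm.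
have pmh x : p x - m x = ext Q h x.
  rewrite /p /m /ext; case: ifP => _; last by rewrite subr0.
  by have [h1|h1] := leP 0 (h x); rewrite /Num.max; case: ltP; case: ltP; lra.
have pm A : measurable A -> density p A = density m A.
  pose m1 : {measure set E -> \bar R} :=
    densitym mp p0.
  pose m2 : {measure set E -> \bar R} :=
    densitym mm m0.
  move=> mA; rewrite -[LHS]/(m1 A) -[RHS]/(m2 A).
  have fin f B : leb.-integrable setT (EFin \o f) -> measurable B ->
      (\int[leb]_(x in B) (f x)%:E)%E \is a fin_num.
    by move=> fi mB; apply: integrable_fin_num => //; exact: (integrableS measurableT).
  apply: eq_measure_obox => // c d; have mB := measurable_obox c d.
    have e : \int[leb]_(x in obox c d) p x = \int[leb]_(x in obox c d) m x.
      apply/eqP; rewrite -subr_eq0 -RintegralB //.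
      - under eq_Rintegral do rewrite pmh.
        have -> : \int[leb]_(x in obox c d) ext Q h x = \int[leb]_(x in obox c d `&` Q) h x.
          by rewrite Rintegral_mkcondr.
        rewrite obox_setI; apply/eqP.
        have [//|_ ->//] := @Rint_obox0 Om h (fun i => Num.max (c i) (a i))
            (fun i => Num.min (d i) (b i)) oO _ Lh h0.
        move=> x hx; apply: bO => i; have := hx i.
        by rewrite ge_max le_min => /andP[/andP[_ ->] /andP[_ ->]].
      - exact: (integrableS measurableT).
      - exact: (integrableS measurableT).
    rewrite /m1 /m2 /= /density -(fineK (fin _ _ ip mB)) -(fineK (fin _ _ im mB)).
    by congr _%:E.
  rewrite /m1 /= /density.
  by have /fin_numPlt/andP[_] := fin _ _ ip mB.
have : ae_eq leb Q (EFin \o p) (EFin \o m).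
  apply: integral_ae_eq => //.
  - exact: (integrableS measurableT).
  - by apply/measurable_EFinP; exact: measurable_funTS.
  - by move=> A _ mA; exact: pm.
apply: filterS => x hx Qx; have [e] := hx Qx.
by have := pmh x; rewrite ext_in // => <-; rewrite e subrr.
Qed.

(** Countably many rational boxes with closure in Om cover Om. *)
Theorem ae0_test Om h : open Om -> L2 Om h ->
  (forall chi, test_fun Om chi -> \int[leb]_(x in Om) (h x * chi x) = 0) ->
  h = (fun=> 0) %[ae leb in Om].
Proof.
move=> oO Lh h0.
(* the exceptional points of the k-th rational box *)
pose bad k : set E := [set x | if (unpickle k : option ({ffun 'I_n -> rat} * {ffun 'I_n -> rat})) is Some pq then
   [/\ rat_obox pq x, cbox (fun i => ratr (pq.1 i)) (fun i => ratr (pq.2 i)) `<=` Om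
    & h x <> 0] else False].
have nbad k : leb.-negligible (bad k).
  rewrite /bad; case: unpickle => [pq|]; last first.
    by apply: negligibleS (negligible_set0 _) => x.
  have [sub|nsub] := pselect (cbox (fun i => ratr (pq.1 i)) (fun i => ratr (pq.2 i)) `<=` Om).
    apply: negligibleS (ae0_cbox oO sub Lh h0) => x [h1 _ h2] /= h3.
    by apply: h2; apply: h3.
  by apply: negligibleS (negligible_set0 _) => x [].
apply: negligibleS (negligible_bigcup nbad) => x /= hx.
have [Ox hn] : Om x /\ h x <> 0 by apply/not_implyP.
have [pq [h1 h2 h3]] := nbhs_rat_obox oO Ox.
by exists (pickle pq) => //; rewrite /bad /= pickleK.
Qed.

End fundamental_lemma.

(** * Weak gradients and Sobolev functions *)

Section weak_gradient.
Context {R : realType} {n : nat}.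
Local Notation E := 'rV[R]_n.
Local Notation leb := (@lebesgue_rV R n).
Implicit Types (f g h u v phi chi : E -> R) (x : E) (i : 'I_n) (D Om : set E) (F G : E -> E).

(** The partial derivatives of the test function [f chi] have integral zero. *)
Lemma ibp Om f chi i : open Om -> Coo f -> test_fun Om chi ->
  \int[leb]_(x in Om) (f x * pderiv i chi x) = - \int[leb]_(x in Om) (pderiv i f x * chi x).
Proof.
move=> oO cf tc; have mO := open_measurable_rV oO.
have cc := test_Coo tc.
have t1 : test_fun Om (fun x => f x * pderiv i chi x) := test_mul cf (test_pderiv i tc).
have t2 : test_fun Om (fun x => pderiv i f x * chi x) := test_mul (Coo_pderiv i cf) tc.
apply/eqP; rewrite -subr_eq0 opprK -RintegralD //; last 2 first.
- exact: test_integrable t1.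
- exact: test_integrable t2.
have := Rint_pderiv_test i (test_sub (@subsetT _ Om) (test_mul cf tc)).
rewrite (@Rint_supp _ _ Om setT) //; last first.
  by move=> x _ nx; rewrite pderivM // (test_out tc nx) (test_pderiv_out i tc nx) mulr0 mul0r addr0.
move=> <-; apply/eqP; apply: eq_Rintegral => x _.
by rewrite pderivM // [X in _ + X]mulrC.
Qed.

Definition pgrad f : E -> E := fun x => \row_i pderiv i f x.

Lemma pgradE f x i : pgrad f x ord0 i = pderiv i f x. Proof. by rewrite mxE. Qed.

Lemma weak_grad_Coo Om f : open Om -> Coo f -> (forall i, L2 Om (pderiv i f)) ->
  weak_grad Om f (pgrad f).
Proof.
move=> oO cf Lf; split.
  by move=> i; under eq_fun do rewrite pgradE.
move=> chi tc i; rewrite ibp //; congr (- _); apply: eq_Rintegral => x _.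
by rewrite pgradE.
Qed.

Lemma weak_grad_test Om Om' phi : open Om' -> test_fun Om phi -> weak_grad Om' phi (pgrad phi).
Proof.
move=> oO tp; apply: weak_grad_Coo => //; first exact: test_Coo tp.
move=> i; apply: test_L2 (test_pderiv i tp); exact: open_measurable_rV.
Qed.

Lemma W12_intro Om u F : L2 Om u -> weak_grad Om u F -> W12 Om u.
Proof. by move=> Lu wF; split => //; exists F. Qed.

Lemma grad_spec Om u : W12 Om u -> weak_grad Om u (grad Om u).
Proof. by move=> [_ ex]; exact: getPex. Qed.

(** The difference of two weak gradients is orthogonal to all test functions. *)
Lemma weak_grad_unique Om u F G : open Om -> weak_grad Om u F -> weak_grad Om u G ->
  F = G %[ae leb in Om].
Proof.
move=> oO [LF hF] [LG hG]; have mO := open_measurable_rV oO.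
have h i : (fun x => F x ord0 i - G x ord0 i) = (fun=> 0) %[ae leb in Om].
  apply: ae0_test => //; first exact: L2B.
  move=> chi tc; have Lc := test_L2 mO tc.
  under eq_Rintegral do rewrite mulrBl.
  rewrite RintegralB //; try exact: integrableM_L2.
  by rewrite -[X in X - _]opprK -hF // -[X in _ - X]opprK -hG // subrr.
have : \forall x \ae leb, forall i, Om x -> F x ord0 i - G x ord0 i = 0.
  by apply: filter_forall => i; exact: h.
apply: filterS => x hx Ox; apply/rowP => i; apply/eqP; rewrite -subr_eq0.
by rewrite hx.
Qed.

Lemma grad_ae Om u F : open Om -> weak_grad Om u F -> grad Om u = F %[ae leb in Om].
Proof.
move=> oO wF; apply: (weak_grad_unique oO _ (wF)).
by apply: getPex; exists F.
Qed.

Lemma ae_sub D D' (T : Type) (F G : E -> T) : D' `<=` D -> F = G %[ae leb in D] -> F = G %[ae leb in D'].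
Proof. by move=> DD; apply: filterS => x h /DD. Qed.

Lemma grad_L2v Om u F : weak_grad Om u F -> L2v Om (grad Om u).
Proof. by move=> wF; have [] : weak_grad Om u (grad Om u) by apply: getPex; exists F. Qed.

Lemma L2vnorm_grad Om D u F : open Om -> measurable D -> D `<=` Om -> weak_grad Om u F ->
  L2vnorm D (grad Om u) = L2vnorm D F.
Proof.
move=> oO mD DO wF; have mO := open_measurable_rV oO.
apply: ae_L2vnorm => //.
- exact: L2v_sub (grad_L2v wF).
- by apply: L2v_sub DO _ => //; case: wF.
- by apply: ae_sub DO _; exact: grad_ae.
Qed.

Lemma W12normE Om u F : open Om -> weak_grad Om u F ->
  W12norm Om u = Num.sqrt (L2norm Om u ^+ 2 + L2vnorm Om F ^+ 2).
Proof.
move=> oO wF; rewrite /W12norm (L2vnorm_grad oO _ _ wF) //; exact: open_measurable_rV.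
Qed.

Lemma sqrtr_le_add (a b c : R) : 0 <= c -> a <= c ^+ 2 + b ^+ 2 -> Num.sqrt a <= c + `|b|.
Proof.
move=> c0 h; rewrite -[leRHS]ger0_norm ?addr_ge0 // -sqrtr_sqr ler_wsqrtr //.
apply: le_trans h _; rewrite sqrrD real_normK ?num_real //.
by rewrite lerD2r lerDl mulrn_wge0 // mulr_ge0.
Qed.

Lemma L2norm_W12norm Om u : L2norm Om u <= W12norm Om u.
Proof.
rewrite -[leLHS]ger0_norm ?L2norm_ge0 // -sqrtr_sqr ler_wsqrtr //.
by rewrite lerDl sqr_ge0.
Qed.

Lemma W12norm_ge0 Om u : 0 <= W12norm Om u. Proof. exact: sqrtr_ge0. Qed.

Lemma weak_grad_sub Om D u F : open Om -> open D -> D `<=` Om ->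
  weak_grad Om u F -> weak_grad D u F.
Proof.
move=> oO oD DO [LF hF]; split.
  by apply: L2v_sub DO LF; exact: open_measurable_rV.
move=> chi tc i; have := hF chi (test_sub DO tc) i.
rewrite (Rint_supp DO); last by move=> x _ nx; rewrite (test_pderiv_out i tc nx) mulr0.
by move=> ->; rewrite (Rint_supp DO) // => x _ nx; rewrite (test_out tc nx) mulr0.
Qed.

Lemma eq_weak_grad D u v F G : (forall x, D x -> u x = v x) -> (forall x, D x -> F x = G x) ->
  weak_grad D u F -> weak_grad D v G.
Proof.
move=> uv FG [LF hF]; split.
  by move=> i; apply: eq_L2 (LF i) => x Dx; rewrite FG.
move=> chi tc i; have := hF chi tc i => h.
rewrite (@eq_Rintegral _ _ _ leb D (fun x => u x * pderiv i chi x)); last first.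
  by move=> x /[!inE] Dx; rewrite uv.
by rewrite h; congr (- _); apply: eq_Rintegral => x /[!inE] Dx; rewrite FG.
Qed.

Lemma weak_grad_lin Om a u v F G : open Om -> L2 Om u -> L2 Om v ->
  weak_grad Om u F -> weak_grad Om v G ->
  weak_grad Om (fun x => a * u x + v x) (fun x => a *: F x + G x).
Proof.
move=> oO Lu Lv [LF hF] [LG hG]; have mO := open_measurable_rV oO.
split; first exact: L2v_lin.
move=> chi tc i; have Lc := test_L2 mO tc; have Ldc := test_L2 mO (test_pderiv i tc).
have lin (p q r : E -> R) : L2 Om p -> L2 Om q -> L2 Om r ->
   \int[leb]_(x in Om) ((a * p x + q x) * r x) =
   a * \int[leb]_(x in Om) (p x * r x) + \int[leb]_(x in Om) (q x * r x).
  move=> Lp Lq Lr; have ip := integrableM_L2 mO Lp Lr; have iq := integrableM_L2 mO Lq Lr.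
  rewrite -RintegralZl // -RintegralD //; last exact: (integrableZl mO a ip).
  by apply: eq_Rintegral => x _; rewrite mulrDl mulrA.
rewrite lin // hF // hG // mulrN -opprD -lin //.
by congr (- _); apply: eq_Rintegral => x _; rewrite !mxE.
Qed.

Lemma W12_lin Om a u v : open Om -> W12 Om u -> W12 Om v -> W12 Om (fun x => a * u x + v x).
Proof.
move=> oO Wu Wv; have [Lu _] := Wu; have [Lv _] := Wv.
apply: (W12_intro _ (weak_grad_lin a oO Lu Lv (grad_spec Wu) (grad_spec Wv))).
by apply: L2_lin => //; exact: open_measurable_rV.
Qed.

Definition affine (a : R) (b : E) x : R := a + dot b x.

Lemma Coo_affine a b : Coo (affine a b).
Proof. by apply: Coo_add; [exact: Coo_cst|exact: Coo_dotr]. Qed.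

Lemma pderiv_affine a b i x : pderiv i (affine a b) x = b ord0 i.
Proof.
have -> : affine a b = (fun y => 1 * (cst a) y + dot b y).
  by apply/funext => y; rewrite /affine mul1r.
rewrite pderiv_lin; [|exact: Coo_cst|exact: Coo_dotr].
by rewrite pderiv_dotr /pderiv derive_cst mulr0 add0r.
Qed.

Lemma affine_L2 Om a b : bounded_set Om -> measurable Om -> L2 Om (affine a b).
Proof.
move=> bO mO; have [M [_ /(_ (`|M| + 1))]] := bO.
have h : M < `|M| + 1 by apply: le_lt_trans (ler_norm _) _; rewrite ltrDl.
move=> /(_ h) hM; apply: (@L2_bounded _ _ _ _ (`|a| + eucl b * (n%:R * (`|M| + 1)))) => //.
- exact: bounded_leb.
- exact: Coo_measurable (Coo_affine a b).
- move=> x Ox; apply: le_trans (ler_normD _ _) _; rewrite lerD2l.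
  apply: le_trans (cauchy_dot _ _) _; rewrite ler_wpM2l ?eucl_ge0 //.
  apply: eucl_le_sup; first by rewrite addr_ge0.
  by move=> i; apply: le_trans (normr_coord _ _) (hM _ Ox).
Qed.

Lemma weak_grad_affine Om a b : bounded_set Om -> open Om ->
  weak_grad Om (affine a b) (fun=> b).
Proof.
move=> bO oO; have mO := open_measurable_rV oO.
have := @weak_grad_Coo Om (affine a b) oO (Coo_affine a b).
have -> : pgrad (affine a b) = fun=> b.
  by apply/funext => x; apply/rowP => i; rewrite pgradE pderiv_affine.
apply=> i; apply: (@L2_bounded _ _ _ _ `|b ord0 i|) => //; first exact: bounded_leb.
  exact: Coo_measurable (Coo_pderiv i (Coo_affine a b)).
by move=> x _; rewrite pderiv_affine.
Qed.

Lemma W012_approx D v (e : R) : open D -> W012 D v -> 0 < e ->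
  exists phi, [/\ test_fun D phi, L2norm D (fun x => v x - phi x) < e &
   L2vnorm D (fun x => grad D v x - pgrad phi x) < e].
Proof.
move=> oD [Wv hv] e0; have [phi [tp hp]] := hv e e0; exists phi; split => //.
  exact: le_lt_trans (L2norm_W12norm _ _) hp.
apply: le_lt_trans hp; rewrite (W12normE (F := fun x => grad D v x - pgrad phi x)) //.
  rewrite -[leLHS]ger0_norm ?L2vnorm_ge0 // -sqrtr_sqr ler_wsqrtr //.
  by rewrite lerDr sqr_ge0.
have mD := open_measurable_rV oD; have [Lv _] := Wv.
have := weak_grad_lin (-1) oD (test_L2 mD tp) Lv (weak_grad_test oD tp) (grad_spec Wv).
by apply: eq_weak_grad => x _; rewrite ?mulN1r ?scaleN1r addrC.
Qed.

(** Here chi need not vanish on the boundary of D: the formula expresses that v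
    does. It holds for test functions of D in place of v, and both sides are
    continuous in v for the Sobolev norm. *)
Lemma W012_ibp D Om v chi i : open D -> open Om -> D `<=` Om -> W012 D v ->
  test_fun Om chi ->
  \int[leb]_(x in D) (v x * pderiv i chi x) = - \int[leb]_(x in D) (grad D v x ord0 i * chi x).
Proof.
move=> oD oO DO Wv tc; have mD := open_measurable_rV oD; have [[Lv ex] _] := Wv.
have [LG _] : weak_grad D v (grad D v) by apply: getPex.
have Lc := test_L2 mD tc; have Ldc := test_L2 mD (test_pderiv i tc).
apply/eqP; rewrite -subr_eq0 opprK -normr_le0; apply/ler_addgt0Pl => e e0; rewrite addr0.
pose M := L2norm D (pderiv i chi) + L2norm D chi + 1.
have M0 : 0 < M by rewrite ltr_wpDl // addr_ge0 ?L2norm_ge0.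
have [phi [tp h1 h2]] := W012_approx oD Wv (divr_gt0 e0 M0).
have Lp := test_L2 mD tp; have Ldp := test_L2 mD (test_pderiv i tp).
have e1 : \int[leb]_(x in D) (phi x * pderiv i chi x) = - \int[leb]_(x in D) (pderiv i phi x * chi x).
  have := ibp i oO (test_Coo tp) tc.
  rewrite (Rint_supp DO); last by move=> x _ nx; rewrite (test_out tp nx) mul0r.
  by move=> ->; rewrite (Rint_supp DO) // => x _ nx; rewrite (test_pderiv_out i tp nx) mul0r.
have LGi := LG i.
have -> : \int[leb]_(x in D) (v x * pderiv i chi x) + \int[leb]_(x in D) (grad D v x ord0 i * chi x)
  = \int[leb]_(x in D) ((v x - phi x) * pderiv i chi x) +
    \int[leb]_(x in D) ((grad D v x ord0 i - pderiv i phi x) * chi x).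
  have -> : \int[leb]_(x in D) ((v x - phi x) * pderiv i chi x) =
     \int[leb]_(x in D) (v x * pderiv i chi x) - \int[leb]_(x in D) (phi x * pderiv i chi x).
    by rewrite -RintegralB //; [apply: eq_Rintegral => x _; rewrite mulrBl|exact: integrableM_L2..].
  have -> : \int[leb]_(x in D) ((grad D v x ord0 i - pderiv i phi x) * chi x) =
     \int[leb]_(x in D) (grad D v x ord0 i * chi x) - \int[leb]_(x in D) (pderiv i phi x * chi x).
    by rewrite -RintegralB //; [apply: eq_Rintegral => x _; rewrite mulrBl|exact: integrableM_L2..].
  by rewrite e1; ring.
apply: le_trans (ler_normD _ _) _.
have c1 := cauchy_L2 mD (L2B mD Lv Lp) Ldc.
have c2 := cauchy_L2 mD (L2B mD LGi Ldp) Lc.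
have h3 : L2norm D (fun x => grad D v x ord0 i - pderiv i phi x) <= e / M.
  apply: le_trans (ltW h2); have := @L2norm_coord _ _ D (fun x => grad D v x - pgrad phi x) i mD.
  under [X in L2norm D X]eq_fun do rewrite !mxE.
  apply; have [Lpg _] := weak_grad_test oD tp.
  have := L2v_lin (-1) mD Lpg LG; by congr (L2v _ _); apply/funext => x; rewrite scaleN1r addrC.
apply: (@le_trans _ _ (e / M * (L2norm D (pderiv i chi) + L2norm D chi))).
  rewrite mulrDr; apply: lerD.
    by apply: le_trans c1 _; rewrite ler_wpM2r ?L2norm_ge0 // ltW.
  by apply: le_trans c2 _; rewrite ler_wpM2r ?L2norm_ge0.
by rewrite mulrAC ler_pdivrMr // ler_wpM2l ?(ltW e0) // /M lerDl.
Qed.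

Lemma W012_weak_grad_ext D Om v : open D -> open Om -> D `<=` Om -> W012 D v ->
  weak_grad Om (ext D v) (ext D (grad D v)).
Proof.
move=> oD oO DO Wv; have mD := open_measurable_rV oD; have mO := open_measurable_rV oO.
have [[Lv ex] _] := Wv; have [LG _] : weak_grad D v (grad D v) by apply: getPex.
split; first exact: L2v_ext.
move=> chi tc i; have := W012_ibp i oD oO DO Wv tc.
have extM (p q : E -> R) x : ext D p x * q x = ext D (fun y => p y * q y) x.
  by rewrite /ext; case: ifP => // _; rewrite mul0r.
under [X in _ = - X -> _]eq_Rintegral do [].
rewrite -(Rintegral_ext (fun x => v x * pderiv i chi x) DO).
rewrite -(Rintegral_ext (fun x => grad D v x ord0 i * chi x) DO) => h.
under eq_Rintegral do rewrite extM; rewrite h; congr (- _).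
by apply: eq_Rintegral => x _; rewrite ext_coord extM.
Qed.

Lemma W012_ext D Om v : open D -> open Om -> D `<=` Om -> W012 D v -> W012 Om (ext D v).
Proof.
move=> oD oO DO Wv; have mD := open_measurable_rV oD; have mO := open_measurable_rV oO.
have wg := W012_weak_grad_ext oD oO DO Wv; have [[Lv ex] _] := Wv.
have [LG _] : weak_grad D v (grad D v) by apply: getPex.
split; first by apply: W12_intro wg; exact: L2_ext.
move=> e e0; have e2 : 0 < e / 2 by rewrite divr_gt0.
have [phi [tp h1 h2]] := W012_approx oD Wv e2.
exists phi; split; first exact: test_sub tp.
have eqv : (fun x => ext D v x - phi x) = ext D (fun x => v x - phi x).
  apply/funext => x; rewrite /ext; case: ifPn => // /negP nx.
  by rewrite (test_out tp) ?subr0 // => Dx; apply: nx; rewrite inE.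
have wg' : weak_grad Om (fun x => ext D v x - phi x) (ext D (fun x => grad D v x - pgrad phi x)).
  have := weak_grad_lin (-1) oO (test_L2 mO tp) (L2_ext mO mD DO Lv) (weak_grad_test oO tp) wg.
  apply: eq_weak_grad => x _; first by rewrite mulN1r addrC.
  rewrite scaleN1r addrC /ext; case: ifPn => // /negP nx.
  apply/rowP => j; rewrite !mxE (test_pderiv_out j tp) ?subr0 // => Dx; apply: nx; rewrite inE //.
rewrite (W12normE oO wg') eqv L2norm_ext // L2vnorm_ext //.
apply: le_lt_trans (@sqrtr_le_add _ (L2vnorm D (fun x => grad D v x - pgrad phi x)) _ (L2norm_ge0 _ _) (lexx _)) _.
by rewrite ger0_norm ?L2vnorm_ge0 // [e]splitr ltrD.
Qed.

(** Clear for test functions, then by density. This is why affine functions can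
    be subtracted from a solution without changing the equation. *)
Lemma W012_int_grad0 D v i : open D -> (leb D < +oo)%E -> W012 D v ->
  \int[leb]_(x in D) grad D v x ord0 i = 0.
Proof.
move=> oD Doo Wv; have mD := open_measurable_rV oD; have [[Lv ex] _] := Wv.
have [LG _] : weak_grad D v (grad D v) by apply: getPex.
have L1 : L2 D (fun=> 1 : R) by apply: (@L2_bounded _ _ _ _ 1) => // x _; rewrite normr1.
apply/eqP; rewrite -normr_le0; apply/ler_addgt0Pl => e e0; rewrite addr0.
pose M := L2norm D (fun=> 1) + 1.
have M0 : 0 < M by rewrite ltr_wpDl // L2norm_ge0.
have [phi [tp _ h2]] := W012_approx oD Wv (divr_gt0 e0 M0).
have Ldp := test_L2 mD (test_pderiv i tp).
have LGi := LG i.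
have p0 : \int[leb]_(x in D) pderiv i phi x = 0.
  rewrite -(Rint_pderiv_test i (test_sub (@subsetT _ D) tp)).
  by rewrite (@Rint_supp _ _ D setT) // => x _ nx; rewrite (test_pderiv_out i tp nx).
have -> : \int[leb]_(x in D) grad D v x ord0 i =
   \int[leb]_(x in D) ((grad D v x ord0 i - pderiv i phi x) * 1).
  rewrite -[LHS]subr0 -[X in _ - X = _]p0 -RintegralB //.
  - by apply: eq_Rintegral => x _; rewrite mulr1.
  - have := integrableM_L2 mD LGi L1; by congr (integrable _ _ _); apply/funext => x /=; rewrite mulr1.
  - have := integrableM_L2 mD Ldp L1; by congr (integrable _ _ _); apply/funext => x /=; rewrite mulr1.
apply: le_trans (cauchy_L2 mD (L2B mD LGi Ldp) L1) _.
have h3 : L2norm D (fun x => grad D v x ord0 i - pderiv i phi x) <= e / M.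
  apply: le_trans (ltW h2); have := @L2norm_coord _ _ D (fun x => grad D v x - pgrad phi x) i mD.
  under [X in L2norm D X]eq_fun do rewrite !mxE.
  apply; have [Lpg _] := weak_grad_test oD tp.
  have := L2v_lin (-1) mD Lpg LG; by congr (L2v _ _); apply/funext => x; rewrite scaleN1r addrC.
apply: (@le_trans _ _ (e / M * L2norm D (fun=> 1))); first by rewrite ler_wpM2r ?L2norm_ge0.
by rewrite mulrAC ler_pdivrMr // ler_wpM2l ?(ltW e0) // /M lerDl.
Qed.

(** The product rule. If chi is a test function of Om then [eta chi] is one of D,
    so that the weak gradient of u in D suffices. *)
Lemma weak_grad_cutoff D Om eta u F : open D -> open Om -> D `<=` Om -> test_fun D eta ->
  L2 D u -> weak_grad D u F ->
  weak_grad Om (ext D (fun x => eta x * u x))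
    (ext D (fun x => eta x *: F x + u x *: pgrad eta x)).
Proof.
move=> oD oO DO te Lu [LF hF]; have mD := open_measurable_rV oD; have mO := open_measurable_rV oO.
have ce := test_Coo te.
have [M hM] := test_bounded te.
have LFe i : L2 D (fun x => eta x * F x ord0 i).
  by apply: L2_mulb (LF i) => //; exact: Coo_measurable ce.
have Lue i : L2 D (fun x => pderiv i eta x * u x).
  have [M' hM'] := test_bounded (test_pderiv i te).
  apply: L2_mulb Lu => //; exact: Coo_measurable (Coo_pderiv i ce).
split.
  apply: L2v_ext => // i; have := L2D mD (LFe i) (Lue i); congr (L2 _ _).
  by apply/funext => x; rewrite !mxE mulrC [X in _ + X]mulrC [X in X + _]mulrC.
move=> chi tc i; have cc := test_Coo tc.
have tec : test_fun D (fun x => eta x * chi x).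
  have := test_mul cc te; by congr (test_fun _ _); apply/funext => x; rewrite mulrC.
have extM (p q : E -> R) x : ext D p x * q x = ext D (fun y => p y * q y) x.
  by rewrite /ext; case: ifP => // _; rewrite mul0r.
have Lc := test_L2 mD tc; have Ldc := test_L2 mD (test_pderiv i tc).
have Ldtec := test_L2 mD (test_pderiv i tec).
under eq_Rintegral do rewrite extM.
rewrite (Rintegral_ext _ DO).
under [X in - X]eq_Rintegral do rewrite ext_coord extM.
rewrite (Rintegral_ext _ DO).
have := hF _ tec i => h.
have -> : \int[leb]_(x in D) (eta x * u x * pderiv i chi x) =
   \int[leb]_(x in D) (u x * pderiv i (fun y => eta y * chi y) x) -
   \int[leb]_(x in D) ((pderiv i eta x * u x) * chi x).
  rewrite -RintegralB //; [|exact: integrableM_L2..].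
  by apply: eq_Rintegral => x _; rewrite pderivM //; ring.
rewrite h -opprD -RintegralD //; last 2 first.
- by apply: integrableM_L2 => //; exact: test_L2 tec.
- exact: integrableM_L2.
by congr (- _); apply: eq_Rintegral => x _; rewrite !mxE; ring.
Qed.

End weak_gradient.

(** * Dilations *)

Section rescaling.
Context {R : realType} {n : nat}.
Local Notation E := 'rV[R]_n.
Local Notation leb := (@lebesgue_rV R n).
Implicit Types (f g h u v phi chi : E -> R) (x : E) (i : 'I_n) (D Om : set E) (F G : E -> E).
Variable c : R.
Hypothesis c0 : 0 < c.

Definition dilated D : set E := [set x | D (c *: x)].
Definition dilate (T : Type) (u : E -> T) : E -> T := fun x => u (c *: x).

Lemma dilated_aff D : dilated D = aff c 0 @^-1` D.
Proof. by apply/seteqP; split => x; rewrite /dilated /aff /= addr0. Qed.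

Lemma dilate_aff (T : Type) (u : E -> T) : dilate u = u \o aff c 0.
Proof. by apply/funext => x; rewrite /dilate /aff /= addr0. Qed.

Lemma dilated_Ball r : dilated (Ball r) = Ball (r / c).
Proof. by rewrite dilated_aff aff_Ball. Qed.

Lemma measurable_dilated D : measurable D -> measurable (dilated D).
Proof. by move=> mD; rewrite dilated_aff; exact: measurable_aff_preimage. Qed.

Lemma open_dilated D : open D -> open (dilated D).
Proof.
move=> oD; apply: open_comp => // x _; exact: scaler_continuous.
Qed.

Lemma measurable_dilate D u : measurable D -> measurable_fun D u -> measurable_fun (dilated D) (dilate u).
Proof. by move=> mD mu; rewrite dilated_aff dilate_aff; exact: measurable_fun_aff. Qed.

Lemma integrable_dilate D u : measurable D -> leb.-integrable D (EFin \o u) ->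
  leb.-integrable (dilated D) (EFin \o dilate u).
Proof. by move=> mD iu; rewrite dilated_aff dilate_aff; exact: (integrable_aff 0 c0 mD iu). Qed.

Lemma Rint_dilate D u : measurable D -> leb.-integrable D (EFin \o u) ->
  \int[leb]_(x in dilated D) dilate u x = c ^- n * \int[leb]_(x in D) u x.
Proof. by move=> mD iu; rewrite dilated_aff dilate_aff; exact: Rintegral_aff. Qed.

Lemma ge0_int_dilate D u : measurable D -> measurable_fun D u -> (forall x, D x -> 0 <= u x) ->
  (\int[leb]_(x in dilated D) (dilate u x)%:E = (c ^- n)%:E * \int[leb]_(x in D) (u x)%:E)%E.
Proof.
move=> mD mu u0; rewrite dilated_aff dilate_aff.
rewrite -(ge0_integral_aff 0 c0 (f := EFin \o u)) //.
exact/measurable_EFinP.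
Qed.

Lemma L2_dilate D u : measurable D -> L2 D u -> L2 (dilated D) (dilate u).
Proof.
move=> mD Lu; apply: integrable_L2; first by apply: measurable_dilate => //; case: Lu.
exact: (integrable_dilate mD (integrable_sqr Lu)).
Qed.

Lemma L2norm_dilate D u : measurable D -> L2 D u ->
  L2norm (dilated D) (dilate u) = Num.sqrt (c ^- n) * L2norm D u.
Proof.
move=> mD Lu; rewrite /L2norm (Rint_dilate mD (integrable_sqr Lu)) sqrtrM //.
exact: cVn_ge0.
Qed.

Lemma L2v_dilate D F : measurable D -> L2v D F -> L2v (dilated D) (dilate F).
Proof. by move=> mD LF i; exact: (L2_dilate mD (LF i)). Qed.

Lemma L2vnorm_dilate D F : measurable D -> L2v D F ->
  L2vnorm (dilated D) (dilate F) = Num.sqrt (c ^- n) * L2vnorm D F.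
Proof.
move=> mD LF; rewrite /L2vnorm (Rint_dilate mD (L2v_integrable_dot mD LF LF)) sqrtrM //.
exact: cVn_ge0.
Qed.

Lemma dilate_inv x : c^-1 *: (c *: x) = x.
Proof. by rewrite scalerA mulVf ?scale1r // gt_eqF. Qed.

Lemma dilate_inv' x : c *: (c^-1 *: x) = x.
Proof. by rewrite scalerA mulfV ?scale1r // gt_eqF. Qed.

Lemma test_dilate D phi : test_fun D phi -> test_fun (dilated D) (dilate phi).
Proof.
move=> tp; apply: test_rescale c0 _ tp => x Dx; by rewrite /dilated /= dilate_inv'.
Qed.

Lemma weak_grad_dilate D u F : open D -> L2 D u -> weak_grad D u F ->
  weak_grad (dilated D) (dilate u) (fun x => c *: dilate F x).
Proof.
move=> oD Lu [LF hF]; have mD := open_measurable_rV oD.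
split; first by apply: L2vZ; [exact: measurable_dilated|exact: L2v_dilate].
move=> chi tc i; pose chi' x := chi (c^-1 *: x).
have tc' : test_fun D chi'.
  by apply: test_rescale tc => [|x]; [rewrite invr_gt0|rewrite /dilated /= invrK].
have cc' := test_Coo tc'.
have chiE : chi = dilate chi' by apply/funext => x; rewrite /dilate /chi' dilate_inv.
have dE x : pderiv i chi x = c * dilate (pderiv i chi') x.
  by rewrite chiE /dilate pderiv_rescale.
have L1 := test_L2 mD tc'; have L2' := test_L2 mD (test_pderiv i tc').
have i1 := integrableM_L2 mD Lu L2'; have i2 := integrableM_L2 mD (LF i) L1.
transitivity (c * \int[leb]_(x in dilated D) dilate (fun x => u x * pderiv i chi' x) x).
  rewrite -RintegralZl //; [|exact: measurable_dilated|exact: integrable_dilate].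
  by apply: eq_Rintegral => x _; rewrite dE /dilate; ring.
rewrite Rint_dilate // hF // mulrN mulrN -Rint_dilate // -RintegralZl //;
  [|exact: measurable_dilated|exact: integrable_dilate].
by congr (- _); apply: eq_Rintegral => x _; rewrite /dilate !mxE /chi' dilate_inv mulrA.
Qed.

Lemma W12_dilate D u : open D -> W12 D u -> W12 (dilated D) (dilate u).
Proof.
move=> oD Wu; have [Lu _] := Wu; have mD := open_measurable_rV oD.
exact: (W12_intro (L2_dilate mD Lu) (weak_grad_dilate oD Lu (grad_spec Wu))).
Qed.

Lemma W012_dilate D v : open D -> W012 D v -> W012 (dilated D) (dilate v).
Proof.
move=> oD Wv; have [Wv1 _] := Wv; have [Lv _] := Wv1; have mD := open_measurable_rV oD.
split; first exact: W12_dilate.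
have [LG hG] := grad_spec Wv1.
move=> e e0; pose M := Num.sqrt (c ^- n) * (1 + c) + 1.
have M0 : 0 < M by rewrite ltr_wpDl // mulr_ge0 ?sqrtr_ge0 // addr_ge0 // ltW.
have [phi [tp h1 h2]] := W012_approx oD Wv (divr_gt0 e0 M0).
exists (dilate phi); split; first exact: test_dilate.
have Lp := test_L2 mD tp; have Lvp := L2B mD Lv Lp.
have wg : weak_grad D (fun x => v x - phi x) (fun x => grad D v x - pgrad phi x).
  have := weak_grad_lin (-1) oD Lp Lv (weak_grad_test oD tp) (grad_spec Wv1).
  by apply: eq_weak_grad => x _; rewrite ?mulN1r ?scaleN1r addrC.
have wgr := weak_grad_dilate oD Lvp wg.
rewrite (W12normE (open_dilated oD) wgr).
have [LGp _] := wg.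
rewrite (L2norm_dilate mD Lvp) L2vnormZ; [|exact: measurable_dilated|exact: L2v_dilate].
rewrite (L2vnorm_dilate mD LGp) (gtr0_norm c0).
set s := Num.sqrt _ in M M0 h1 h2 *; have s0 : 0 <= s := sqrtr_ge0 _.
set p := s * L2norm _ _; set q := c * _.
have p0 : 0 <= p by rewrite mulr_ge0 ?L2norm_ge0.
apply: le_lt_trans (@sqrtr_le_add R _ q p p0 (lexx _)) _; rewrite /p /q.
rewrite ger0_norm; last by rewrite !mulr_ge0 ?L2vnorm_ge0 // ltW.
apply: (@le_lt_trans _ _ (s * (1 + c) * (e / M))).
  rewrite [leRHS](_ : _ = s * (e / M) + c * (s * (e / M))); last by ring.
  by apply: lerD; rewrite ?ler_wpM2l // ?ltW // ler_wpM2l // ltW.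
by rewrite mulrA ltr_pdivrMr // mulrC ltr_pM2l // /M ltrDl.
Qed.

Lemma negligible_dilate (A : set E) : leb.-negligible A -> leb.-negligible (dilated A).
Proof.
move=> [N [mN N0 AN]]; exists (dilated N); split; first exact: measurable_dilated.
  by rewrite dilated_aff (leb_aff 0 c0 mN) /mscale /= N0 mule0.
by move=> x /AN.
Qed.

Lemma esupp_dilate D phi r : 0 < r -> esupp D phi `<=` cBall r ->
  esupp (dilated D) (dilate phi) `<=` cBall (r / c).
Proof.
move=> r0 sp x hx; rewrite /cBall /= ler_pdivlMr // mulrC -[c in c * _](gtr0_norm c0) -euclZ.
apply: sp => U oU Ux neg; apply: (hx (dilated U)) => //; first exact: open_dilated.
have := negligible_dilate neg; apply: negligibleS => y [[h1 h2] h3]; by split.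
Qed.

End rescaling.

(** * Essential supports and extension by zero *)

Section esupp_ext.
Context {R : realType} {n : nat}.
Local Notation E := 'rV[R]_n.
Lemma esupp_ext (D Om : set E) (phi : E -> R) (r : R) : D `<=` Om ->
  esupp D phi `<=` cBall r -> esupp Om (ext D phi) `<=` cBall r.
Proof.
move=> DO sp x hx; apply: sp => U oU Ux neg; apply: (hx U) => //.
apply: negligibleS neg => y [[h1 h2] /= h3].
have Dy : D y by apply: contrapT => nD; move: h3; rewrite ext_out // eqxx.
by rewrite ext_in in h3.
Qed.
End esupp_ext.

(** * Transport between the unit ball and the domain *)

Section transfer.
Context {R : realType} {n : nat}.
Local Notation E := 'rV[R]_n.
Local Notation leb := (@lebesgue_rV R n).
Implicit Types (u v phi psi chi : E -> R) (x : E) (i : 'I_n) (D Om : set E) (F G : E -> E).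

(** A smooth transition in the variable [eucl x ^+ 2]. *)
Lemma cutoff_exists : exists eta : E -> R, test_fun (Ball 1) eta /\
  forall x, Ball (3/4) x -> eta x = 1.
Proof.
(* P vanishes for eucl x = 7/8, and 13/64 = (7/8)^2 - (3/4)^2 *)
pose P x : R := 64 / 13 * (49 / 64 + -1 * dot x x).
have cP : Coo P.
  apply: Coo_scale; apply: Coo_add; first exact: Coo_cst.
  by apply: Coo_scale; exact: Coo_dot.
exists (step \o P); split; last first.
  move=> x; rewrite /Ball /= => bx; apply: step_ge1; rewrite /P -sqr_eucl.
  have := eucl_ge0 x; move: bx; set e := eucl x => h1 h0.
  have : e ^+ 2 <= (3 / 4) ^+ 2 by nra.
  by lra.
apply: (test_fun_intro (K := cBall (7 / 8))).
- exact: Coo_step.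
- exact: compact_cBall.
- by move=> x; rewrite /cBall /Ball /= => h; lra.
- move=> x; rewrite /cBall /=; apply: contraNT; rewrite -ltNge => h; apply/eqP; apply: step_le0.
  rewrite /P -sqr_eucl; have : (7 / 8) ^+ 2 <= eucl x ^+ 2.
    by rewrite ler_sqr ?nnegrE ?eucl_ge0 // ltW.
  by lra.
Qed.

Lemma weak_grad_ae Om u F G : open Om -> L2v Om G -> F = G %[ae leb in Om] ->
  weak_grad Om u F -> weak_grad Om u G.
Proof.
move=> oO LG FG [LF hF]; have mO := open_measurable_rV oO; split => // chi tc i.
rewrite hF //; congr (- _); have Lc := test_L2 mO tc; apply: ae_eq_Rintegral => //.
- by apply: measurable_funM; [case: (LF i)|case: Lc].
- by apply: measurable_funM; [case: (LG i)|case: Lc].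
- exact: (ae_eq_comp2 (fun x (y : E) => y ord0 i * chi x) FG).
Qed.

(** Weak gradients are local: only the restriction to D matters. *)
Lemma L2vnorm_grad_local Om D u v F G : open Om -> open D -> D `<=` Om ->
  weak_grad Om u F -> weak_grad D v G -> (forall x, D x -> u x = v x) ->
  L2vnorm D (grad Om u) = L2vnorm D G.
Proof.
move=> oO oD DO wF wG uv; have mD := open_measurable_rV oD.
rewrite (L2vnorm_grad oO mD DO wF).
have wF' := weak_grad_sub oO oD DO wF.
have wG' : weak_grad D u G by apply: (eq_weak_grad _ _ wG) => // x /uv.
by apply: ae_L2vnorm => //; [case: wF'|case: wG'|exact: weak_grad_unique wF' wG'].
Qed.

Lemma L2avg_mono D D' u : measurable D -> measurable D' -> D' `<=` D -> L2 D u ->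
  0 < vol D' -> 0 < vol D ->
  L2avg D' u <= Num.sqrt (vol D / vol D') * L2avg D u.
Proof.
move=> mD mD' DD Lu v' v0; rewrite /L2avg -sqrtrM; last by rewrite divr_ge0 // ltW.
set I := \int[leb]_(x in D) _.
have -> : vol D / vol D' * ((vol D)^-1 * I) = (vol D')^-1 * I by field; rewrite !gt_eqF.
rewrite ler_wsqrtr //; apply: ler_wpM2l; first by rewrite invr_ge0 ltW.
by apply: Rintegral_mono => //; [exact: integrable_sqr|move=> x _; exact: sqr_ge0].
Qed.

Lemma L2avgE D u : 0 <= vol D -> L2avg D u = Num.sqrt (vol D)^-1 * L2norm D u.
Proof. by move=> v0; rewrite /L2avg sqrtrM // invr_ge0. Qed.

Section scale.
Variable d : R.
Hypothesis d0 : 0 < d.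
Local Notation B1 := (@Ball R n 1).
Let di0 : 0 < d^-1. Proof. by rewrite invr_gt0. Qed.

(** d^(n/2), the factor by which dilations act on L^2 norms. *)
Definition half_pow : R := Num.sqrt (d ^+ n).
Lemma half_pow_gt0 : 0 < half_pow. Proof. by rewrite sqrtr_gt0 exprn_gt0. Qed.
Lemma half_pow_sqr : half_pow ^+ 2 = d ^+ n. Proof. by rewrite sqr_sqrtr // exprn_ge0 // ltW. Qed.
Lemma sqrt_dVn : Num.sqrt ((d^-1) ^- n) = half_pow.
Proof. by rewrite -exprVn invrK. Qed.

Lemma dilated_dVBall r : dilated d^-1 (Ball r) = @Ball R n (d * r).
Proof. by rewrite dilated_Ball // invrK mulrC. Qed.

Lemma dilated_dBall r : dilated d (@Ball R n (d * r)) = Ball r.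
Proof. by rewrite dilated_Ball // [d * r]mulrC mulfK ?gt_eqF. Qed.

Lemma Ball_sub (r s : R) : r <= s -> @Ball R n r `<=` Ball s.
Proof. by move=> rls x /= h; exact: lt_le_trans rls. Qed.

Lemma L2avg_dilate r u : 0 < r -> L2 (Ball (d * r)) u -> L2avg (Ball r) (dilate d u) = L2avg (Ball (d * r)) u.
Proof.
move=> r0 Lu; have mB : measurable (@Ball R n (d * r)) := measurable_Ball _.
rewrite /L2avg -{1 2}(dilated_dBall r) (Rint_dilate d0 mB (integrable_sqr Lu)) dilated_dBall.
rewrite mulrA -invfM; congr (Num.sqrt (_^-1 * _)).
rewrite (vol_Ball r0) (vol_Ball (mulr_gt0 d0 r0)) exprMn; ring.
Qed.

(** Functions of W_0^{1,2} of the unit ball extend by zero after dilation. *)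
Definition zlift phi : E -> R := ext (Ball d) (dilate d^-1 phi).

Variable Om : set E.
Hypotheses (oO : open Om) (BO : Ball d `<=` Om).

Let rsB1 : dilated d^-1 B1 = Ball d. Proof. by rewrite dilated_dVBall mulr1. Qed.
Let oB r : open (@Ball R n r). Proof. exact: open_Ball. Qed.
Let mB r : measurable (@Ball R n r). Proof. exact: measurable_Ball. Qed.
Let mO : measurable Om. Proof. exact: open_measurable_rV. Qed.

Lemma W012_zlift phi : W012 B1 phi -> W012 Om (zlift phi).
Proof.
move=> Wp; have := W012_dilate di0 (@oB 1) Wp; rewrite rsB1 => Wr.
by apply: W012_ext => //; exact: (@oB d).
Qed.

Definition glift F : E -> E := fun x => d^-1 *: dilate d^-1 F x.

Lemma L2v_glift r F : L2v (Ball r) F -> L2v (Ball (d * r)) (glift F).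
Proof.
move=> LF; apply: L2vZ => //; rewrite -dilated_dVBall; exact: L2v_dilate.
Qed.

Lemma L2vnorm_glift r F : L2v (Ball r) F ->
  L2vnorm (Ball (d * r)) (glift F) = half_pow / d * L2vnorm (Ball r) F.
Proof.
move=> LF; have LrF : L2v (Ball (d * r)) (dilate d^-1 F) by rewrite -dilated_dVBall; exact: L2v_dilate.
rewrite /glift L2vnormZ // -dilated_dVBall L2vnorm_dilate // sqrt_dVn gtr0_norm //.
by rewrite mulrCA mulrA.
Qed.

Lemma weak_grad_zlift phi : W012 B1 phi ->
  weak_grad Om (zlift phi) (ext (Ball d) (glift (grad B1 phi))).
Proof.
move=> Wp; have [Wp1 _] := Wp; have [Lp _] := Wp1.
have := W012_dilate di0 (@oB 1) Wp; rewrite rsB1 => Wr.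
have wr : weak_grad (Ball d) (dilate d^-1 phi) (glift (grad B1 phi)).
  by rewrite -rsB1; apply: weak_grad_dilate => //; exact: grad_spec.
have wg := W012_weak_grad_ext (@oB d) oO BO Wr.
apply: weak_grad_ae wg => //; first by apply: L2v_ext => //; case: wr.
have := grad_ae (@oB d) wr; apply: filterS => x hx _; rewrite /ext; case: ifPn => //.
by rewrite inE => Dx; apply: hx.
Qed.

Lemma zlift_norm phi rho : W012 B1 phi -> rho <= 1 ->
  L2vnorm (Ball (d * rho)) (grad Om (zlift phi)) = half_pow / d * L2vnorm (Ball rho) (grad B1 phi).
Proof.
move=> Wp r1; have wE := weak_grad_zlift Wp; have [Wp1 _] := Wp.
have [LG _] := grad_spec Wp1.
have sub : Ball (d * rho) `<=` @Ball R n d by apply: Ball_sub; rewrite ger_pMr.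
rewrite (L2vnorm_grad oO (mB _) _ wE); last exact: subset_trans BO.
rewrite -L2vnorm_glift; last by apply: L2v_sub LG => //; exact: Ball_sub.
by congr Num.sqrt; apply: eq_Rintegral => x /[!inE] /sub hx; rewrite ext_in.
Qed.

Lemma zlift_norm_Om phi : W012 B1 phi ->
  L2vnorm Om (grad Om (zlift phi)) = half_pow / d * L2vnorm B1 (grad B1 phi).
Proof.
move=> Wp; have wE := weak_grad_zlift Wp; have [Wp1 _] := Wp.
have [LG _] := grad_spec Wp1.
rewrite (L2vnorm_grad oO mO _ wE) // L2vnorm_ext //.
by rewrite -{1}(mulr1 d) L2vnorm_glift.
Qed.

(** A function of Om is tested against a lifted function: the change of variables
    gives d^n, and the gradient of the lift gives 1/d. *)
Lemma zlift_int_dot phi F : W012 B1 phi -> L2v Om F ->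
  \int[leb]_(x in Om) dot (F x) (grad Om (zlift phi) x) =
  d ^+ n / d * \int[leb]_(x in B1) dot (dilate d F x) (grad B1 phi x).
Proof.
move=> Wp LF; have wE := weak_grad_zlift Wp; have [Wp1 _] := Wp.
have [LG _] := grad_spec Wp1.
have LFd : L2v (Ball d) F by apply: L2v_sub LF.
have LGx : L2v (Ball d) (glift (grad B1 phi)) by rewrite -(mulr1 d); exact: L2v_glift.
have LE := grad_L2v wE; have [LE' _] := wE.
have -> : \int[leb]_(x in Om) dot (F x) (grad Om (zlift phi) x) =
   \int[leb]_(x in Om) dot (grad Om (zlift phi) x) (F x).
  by apply: eq_Rintegral => x _; rewrite dotC.
rewrite (ae_int_dot mO LE LE' LF (grad_ae oO wE)).
under eq_Rintegral do rewrite dot_ext.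
rewrite Rintegral_ext //.
have eB : dilated d (Ball d) = B1 by rewrite -{2}(mulr1 d) dilated_dBall.
have e : (fun x => dot (dilate d F x) (grad B1 phi x)) =
     dilate d (fun x => d * dot (glift (grad B1 phi) x) (F x)).
  apply/funext => x; rewrite /dilate /glift /dilate dotZl dilate_inv // mulrA mulfV ?gt_eqF // mul1r.
  by rewrite dotC.
have iG := L2v_integrable_dot (mB d) LGx LFd.
have h := Rint_dilate d0 (mB d) (integrableZl (mB d) d iG).
rewrite eB in h; rewrite e h RintegralZl //.
set I := \int[leb]_(x in _) _.
by field; rewrite !gt_eqF // exprn_gt0.
Qed.

Variable eta : E -> R.
Hypotheses (teta : test_fun B1 eta) (eta1 : forall x, Ball (3 / 4) x -> eta x = 1).

Definition etad := dilate d^-1 eta.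
(** Functions of W^{1,2} of the unit ball need a cutoff before they can be
    extended by zero. The cutoff is 1 on the ball of radius 3/4. *)
Definition clift psi : E -> R := ext (Ball d) (fun x => etad x * dilate d^-1 psi x).
Definition clift_grad psi : E -> E :=
  ext (Ball d) (fun x => etad x *: glift (grad B1 psi) x + dilate d^-1 psi x *: pgrad etad x).

Lemma test_etad : test_fun (Ball d) etad.
Proof. by rewrite -rsB1; exact: test_dilate. Qed.

Lemma L2_rsd psi : L2 B1 psi -> L2 (Ball d) (dilate d^-1 psi).
Proof. by move=> Lp; rewrite -rsB1; exact: L2_dilate. Qed.

Lemma weak_grad_rsd psi : W12 B1 psi -> weak_grad (Ball d) (dilate d^-1 psi) (glift (grad B1 psi)).
Proof.
move=> Wp; rewrite -rsB1; apply: weak_grad_dilate => //; [by case: Wp|exact: grad_spec].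
Qed.

Lemma weak_grad_clift psi : W12 B1 psi -> weak_grad Om (clift psi) (clift_grad psi).
Proof.
move=> Wp; have [Lp _] := Wp; apply: weak_grad_cutoff => //; first exact: test_etad.
  exact: L2_rsd.
exact: weak_grad_rsd.
Qed.

Lemma L2_clift psi : L2 B1 psi -> L2 Om (clift psi).
Proof.
move=> Lp; apply: L2_ext => //; have [M hM] := test_bounded test_etad.
apply: L2_mulb (L2_rsd Lp) => //; exact: Coo_measurable (test_Coo test_etad).
Qed.

Lemma W12_clift psi : W12 B1 psi -> W12 Om (clift psi).
Proof.
by move=> Wp; have [Lp _] := Wp; apply: W12_intro (weak_grad_clift Wp); exact: L2_clift.
Qed.

Lemma clift_in psi x : Ball (d * (3 / 4)) x -> clift psi x = dilate d^-1 psi x.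
Proof.
move=> bx; rewrite /clift ext_in; last by apply: Ball_sub bx; rewrite ger_pMr //; lra.
rewrite /etad /dilate eta1 ?mul1r // /Ball /= euclZ gtr0_norm // mulrC ltr_pdivrMr //.
by rewrite mulrC.
Qed.

Lemma clift_lin a psi chi : clift (fun x => a * psi x + chi x) = (fun x => a * clift psi x + clift chi x).
Proof.
apply/funext => x; rewrite /clift /ext; case: ifP => _; last by rewrite mulr0 addr0.
by rewrite /dilate mulrDr mulrCA.
Qed.

Lemma zlift_lin a phi chi : zlift (fun x => a * phi x + chi x) = (fun x => a * zlift phi x + zlift chi x).
Proof. by apply/funext => x; rewrite /zlift /ext; case: ifP => _ //; rewrite mulr0 addr0. Qed.

(** Both terms of the norm scale alike, which makes the hypothesis on V scale
    invariant. *)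
Lemma L12norm_clift psi rho theta : W12 B1 psi -> 0 < rho -> rho < theta <= 3 / 4 ->
  L12norm Om (d * rho) (d * theta) (clift psi) = half_pow / d * L12norm B1 rho theta psi.
Proof.
move=> Wp r0 /andP[rt t34]; have [Lp _] := Wp.
have dt : d * theta <= d by rewrite ger_pMr //; lra.
have bsub : Ball theta `<=` B1 by apply: Ball_sub; lra.
have sub : Ball (d * theta) `<=` @Ball R n (d * (3 / 4)) by apply: Ball_sub; rewrite ler_pM2l.
rewrite /L12norm.
have wr := weak_grad_rsd Wp; have [LGr _] := wr.
have -> : L2vnorm (Ball (d * theta)) (grad Om (clift psi)) = half_pow / d * L2vnorm (Ball theta) (grad B1 psi).
  rewrite -L2vnorm_glift; last first.
    by apply: L2v_sub bsub _ => //; have [] := grad_spec Wp.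
  apply: (L2vnorm_grad_local oO (@oB _) _ (weak_grad_clift Wp)); last by move=> x /sub; exact: clift_in.
    by apply: subset_trans BO; exact: Ball_sub.
  by apply: weak_grad_sub wr => //; exact: Ball_sub.
have -> : L2norm (Ball (d * theta)) (clift psi) = half_pow * L2norm (Ball theta) psi.
  rewrite (@eq_L2norm _ _ _ _ (dilate d^-1 psi)); last by move=> x /sub; exact: clift_in.
  rewrite -dilated_dVBall L2norm_dilate // ?sqrt_dVn //; by apply: L2_sub bsub Lp.
rewrite -mulrBr; field.
by rewrite subr_eq0 !gt_eqF.
Qed.

(** Only the existence of C matters, for the transported operator to be a
    multiplier: C may depend on d. *)
Lemma W12norm_clift : exists C : R, 0 <= C /\ forall psi, W12 B1 psi ->
  W12norm Om (clift psi) <= C * W12norm B1 psi.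
Proof.
have [M hM] := test_bounded test_etad.
have /choice[N hN] i := test_bounded (test_pderiv i test_etad).
have M0 : 0 <= M by apply: le_trans (hM 0).
pose P : R := \sum_i `|N i| ^+ 2.
have P0 : 0 <= P by apply: sumr_ge0 => i _; exact: sqr_ge0.
have pg x : dot (pgrad etad x) (pgrad etad x) <= P.
  apply: ler_sum => i _; rewrite pgradE -expr2 -(real_normK (num_real (pderiv i etad x))).
  by rewrite ler_sqr ?nnegrE //; apply: le_trans (hN i x) (ler_norm _).
(* the terms bound eta psi, eta grad psi and psi grad eta, in this order *)
exists (Num.sqrt (M ^+ 2 * half_pow ^+ 2 + 2 * M ^+ 2 * (half_pow / d) ^+ 2 + 2 * P * half_pow ^+ 2)).
split; first exact: sqrtr_ge0.
move=> psi Wp; have [Lp _] := Wp; have wJ := weak_grad_clift Wp.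
have [LG _] := grad_spec Wp.
rewrite (W12normE oO wJ) /W12norm -sqrtrM; last first.
  have := mulr_ge0 (sqr_ge0 M) (sqr_ge0 half_pow); have := mulr_ge0 (sqr_ge0 M) (sqr_ge0 (half_pow / d)).
  by have := mulr_ge0 P0 (sqr_ge0 half_pow); lra.
rewrite ler_wsqrtr //.
have Lr := L2_rsd Lp.
have LGx : L2v (Ball d) (glift (grad B1 psi)) by rewrite -(mulr1 d); exact: L2v_glift.
have nr : L2norm (Ball d) (dilate d^-1 psi) = half_pow * L2norm B1 psi.
  by rewrite -rsB1 L2norm_dilate // sqrt_dVn.
have nG : L2vnorm (Ball d) (glift (grad B1 psi)) = half_pow / d * L2vnorm B1 (grad B1 psi).
  by rewrite -{1}(mulr1 d) L2vnorm_glift.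
have ce := test_Coo test_etad.
have h1 : L2norm Om (clift psi) ^+ 2 <= M ^+ 2 * (half_pow ^+ 2 * L2norm B1 psi ^+ 2).
  rewrite L2norm_ext // -!exprMn -nr ler_sqr ?nnegrE ?L2norm_ge0 ?mulr_ge0 ?L2norm_ge0 //.
  rewrite -{1}(ger0_norm M0) -L2normZ //; apply: L2norm_le => //.
  - by apply: L2_mulb Lr => //; exact: Coo_measurable ce.
  - exact: L2Z.
  - by move=> x _; rewrite !normrM ler_wpM2r //; apply: le_trans (hM x) (ler_norm _).
have h2 : L2vnorm Om (clift_grad psi) ^+ 2 <=
   2 * M ^+ 2 * ((half_pow / d) ^+ 2 * L2vnorm B1 (grad B1 psi) ^+ 2) +
   2 * P * (half_pow ^+ 2 * L2norm B1 psi ^+ 2).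
  rewrite L2vnorm_ext // -!exprMn -nr -nG !sqr_L2vnorm sqr_L2norm.
  have iG := L2v_integrable_dot (mB d) LGx LGx; have ir := integrable_sqr Lr.
  rewrite -!RintegralZl // -RintegralD //; last 2 first.
  - exact: (integrableZl (mB d) _ iG).
  - exact: (integrableZl (mB d) _ ir).
  have [LJ _] := wJ.
  have LJ' : L2v (Ball d) (fun x => etad x *: glift (grad B1 psi) x + dilate d^-1 psi x *: pgrad etad x).
    move=> i; have := L2v_sub mO (mB d) BO LJ i; apply: eq_L2 => x Dx.
    by rewrite /clift_grad ext_in.
  apply: le_Rintegral => //.
  - exact: L2v_integrable_dot.
  - apply: (integrableD (mB d) (integrableZl (mB d) _ iG) (integrableZl (mB d) _ ir)).
  move=> x _; set a := glift _ x; set b := pgrad etad x; set r := dilate _ _ x.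
  have q : 0 <= dot (etad x *: a - r *: b) (etad x *: a - r *: b) := dot_ge0 _.
  have e1 : etad x ^+ 2 * dot a a <= M ^+ 2 * dot a a.
    rewrite ler_wpM2r ?dot_ge0 // -(real_normK (num_real (etad x))).
    by rewrite ler_sqr ?nnegrE // hM.
  have e2 : dot b b * r ^+ 2 <= P * r ^+ 2 by rewrite ler_wpM2r ?sqr_ge0 // pg.
  clearbody a b r; move: q; rewrite -scaleNr !dotDl !dotDr !dotZl !dotZr (dotC b a) => q.
  by nra.
rewrite [leRHS](_ : _ =
  M ^+ 2 * (half_pow ^+ 2 * L2norm B1 psi ^+ 2) + (2 * M ^+ 2 * ((half_pow / d) ^+ 2 * L2vnorm B1 (grad B1 psi) ^+ 2) +
   2 * P * (half_pow ^+ 2 * L2norm B1 psi ^+ 2)) + (M ^+ 2 * half_pow ^+ 2 * L2vnorm B1 (grad B1 psi) ^+ 2 +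
   2 * M ^+ 2 * (half_pow / d) ^+ 2 * L2norm B1 psi ^+ 2 + 2 * P * half_pow ^+ 2 * L2vnorm B1 (grad B1 psi) ^+ 2)); last by ring.
apply: ler_wpDr; last exact: lerD.
have q1 := sqr_ge0 (L2norm B1 psi); have q2 := sqr_ge0 (L2vnorm B1 (grad B1 psi)).
have := mulr_ge0 (mulr_ge0 (sqr_ge0 M) (sqr_ge0 half_pow)) q2.
have := mulr_ge0 (mulr_ge0 (sqr_ge0 M) (sqr_ge0 (half_pow / d))) q1.
by have := mulr_ge0 (mulr_ge0 P0 (sqr_ge0 half_pow)) q2; lra.
Qed.

End scale.
End transfer.

(** * Improvement of an affine approximation at one scale *)

Section one_step.
Context {R : realType} {n : nat}.
Local Notation E := 'rV[R]_n.
Local Notation leb := (@lebesgue_rV R n).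
Local Notation B1 := (@Ball R n 1).
Local Notation pexp := ((n + 2)%:R / (2 * n)%:R : R).
Local Notation sgn r := (@half_pow R n r).
Hypothesis hn : (3 <= n)%N.

(** The exponent is chosen so that the n-dimensional volume becomes r^(n/2 + 1). *)
Lemma vol_powR (r : R) : 0 < r ->
  vol (@Ball R n r) `^ pexp = vol B1 `^ pexp * (sgn r * r).
Proof.
move=> r0; have v0 := vol_gt0 (n := n) (@ltr01 R).
rewrite vol_Ball // powRM ?exprn_ge0 ?ltW // mulrC; congr (_ * _).
rewrite -powR_mulrn ?ltW // -powRrM.
have -> : n%:R * pexp = n%:R * 2^-1 + 1 :> R.
  have nn : n%:R != 0 :> R by rewrite pnatr_eq0; case: n hn.
  by rewrite natrD natrM; field.
rewrite powRD; last by rewrite gt_eqF // implybT.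
by rewrite powRr1 ?ltW // powRrM powR_mulrn ?(ltW r0) // powR12_sqrt // exprn_ge0 // ltW.
Qed.

(** The quotient is r^((n-2)/2). *)
Lemma half_pow_div_mono (r d : R) : 0 < r -> r <= d -> sgn r / r <= sgn d / d.
Proof.
move=> r0 rd; have d0 : 0 < d := lt_le_trans r0 rd.
have e (t : R) : 0 < t -> sgn t / t = Num.sqrt (t ^+ n.-2).
  move=> t0; rewrite /half_pow -{1}(ltn_predK hn) -[n.-1](@ltn_predK 1) ?exprS; last by case: n hn => [|[]].
  by rewrite mulrA -expr2 sqrtrM ?sqr_ge0 // sqrtr_sqr gtr0_norm // [t * _]mulrC mulfK // gt_eqF.
rewrite !e // ler_wsqrtr //; by apply: lerXn2r => //; rewrite nnegrE ltW.
Qed.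

Variables (C0 lam delta0 : R) (hconst : @approximation_constants R n C0 lam delta0).
Variables (Om : set E) (V : (E -> R) -> (E -> R) -> R) (f : E -> E) (g : (E -> R) -> R)
  (u : E -> R) (R0 : R) (omega1 omega2 : R -> R).
Hypotheses (oO : open Om) (hV : multiplier Om V) (hf : L2v Om f)
  (af : admissible Om (fun x => dot (f x) (f x))) (hg : Wm12 Om g)
  (hu : weak_solution Om V f g u) (BO : Ball R0 `<=` Om).
Hypotheses (w1m : forall r s : R, 0 <= r -> r <= s -> omega1 r <= omega1 s) (w10 : omega1 0 = 0)
  (w2m : forall r s : R, 0 <= r -> r <= s -> omega2 r <= omega2 s) (w20 : omega2 0 = 0).
Hypothesis hloc : forall (r : R) (psi phi : E -> R), 0 < r <= R0 / 2 ->
       W12 Om psi -> W012 Om phi -> esupp Om phi `<=` cBall r ->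
       [/\ forall s : R, r < s <= 2 * r ->
             `|V psi phi| <= omega1 s * L12norm Om r s psi *
                             L2vnorm (Ball r) (grad Om phi),
           (\int[lebesgue_rV n]_(x in Ball r)
               (dot (f x) (f x) * phi x ^+ 2)%:E <=
            (omega2 r ^+ 2 * \int[lebesgue_rV n]_(x in Ball r)
               dot (grad Om phi x) (grad Om phi x))%R%:E)%E
         & `|g phi| <= omega2 r / r ^+ 2 *
              vol (@Ball R n r) `^ pexp *
              L2vnorm (Ball r) (grad Om phi)].

(** Collects what is lost in the rescaled bounds: 1 for f, the volume factor for g,
    and 4 |B_1|^(1/2) for V applied to an affine function. *)
Definition kappa : R := 1 + vol B1 `^ pexp + 4 * Num.sqrt (vol B1).

Section at_scale.
Variables (d T a : R) (b : E).
Hypotheses (d0 : 0 < d) (dR : d <= R0) (T0 : 0 < T).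
Hypothesis havg : L2avg (Ball d) (fun x => u x - affine a b x) <= T.
Hypothesis hw1 : 2 * omega1 d <= delta0.
Hypothesis hw2 : kappa * (omega2 d + omega1 d * (`|a| + eucl b * d)) <= delta0 * T.
Variable eta : E -> R.
Hypotheses (teta : test_fun B1 eta) (eta1 : forall x, Ball (3 / 4) x -> eta x = 1).

Let BdO : Ball d `<=` Om. Proof. by apply: subset_trans BO; exact: Ball_sub. Qed.
Let mB r : measurable (@Ball R n r). Proof. exact: measurable_Ball. Qed.
Let mO : measurable Om. Proof. exact: open_measurable_rV. Qed.
Let Wu : W12 Om u. Proof. by case: hu. Qed.
Let Lu : L2 Om u. Proof. by case: Wu. Qed.
Let sd0 : 0 < sgn d. Proof. exact: half_pow_gt0. Qed.
Let eB : dilated d (@Ball R n d) = B1. Proof. by rewrite -{2}(mulr1 d) dilated_dBall. Qed.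
Let w1_ge0 r : 0 <= r -> 0 <= omega1 r. Proof. by move=> r0; rewrite -w10 w1m. Qed.
Let w2_ge0 r : 0 <= r -> 0 <= omega2 r. Proof. by move=> r0; rewrite -w20 w2m. Qed.

Let l := affine a b.
Let z : E -> R := fun x => u x - l x.
Let zG : E -> E := fun x => grad Om u x - b.
(** The deviation from the affine function, brought to the unit ball and divided
    by T so that its average is at most 1. *)
Let w : E -> R := fun x => T^-1 * dilate d z x.
Let wG : E -> E := fun x => T^-1 *: (d *: dilate d zG x).
(** d^(2-n) makes up for the scaling of the Dirichlet integral. *)
Let k : R := d ^+ 2 / d ^+ n.
Let Vt (psi phi : E -> R) : R := k * V (clift d eta psi) (zlift d phi).
Let ft : E -> E := fun x => (d / T) *: dilate d f x.
(** The part of u that the lift of w leaves out: the affine function, inside the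
    ball of radius 3d/4. *)
Let res : E -> R := fun x => u x - T * clift d eta w x.
(** V u is T times V applied to the lift of w, plus V res. Where test functions are
    supported res is affine, so that V res is a source on a par with g. *)
Let gt (phi : E -> R) : R := k / T * (g (zlift d phi) - V res (zlift d phi)).

Let bB r : bounded_set (@Ball R n r). Proof. exact: bounded_Ball. Qed.
Let bBd : bounded_set (@Ball R n d). Proof. exact: bB. Qed.

Let Ll : L2 (Ball d) l. Proof. exact: affine_L2. Qed.
Let Lud : L2 (Ball d) u. Proof. exact: L2_sub Lu. Qed.
Let Lz : L2 (Ball d) z. Proof. exact: L2B. Qed.
Let wgu : weak_grad Om u (grad Om u). Proof. exact: grad_spec. Qed.

Let wz : weak_grad (Ball d) z zG.
Proof.
have h1 := weak_grad_sub oO (@open_Ball R n d) BdO wgu.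
have h2 := weak_grad_affine a b bBd (@open_Ball R n d).
have := weak_grad_lin (-1) (@open_Ball R n d) Ll Lud h2 h1.
by apply: eq_weak_grad => x _; rewrite ?mulN1r ?scaleN1r addrC.
Qed.

Let LzG : L2v (Ball d) zG. Proof. by case: wz. Qed.

Let Lw : L2 B1 w. Proof. by apply: L2Z => //; rewrite -eB; exact: L2_dilate. Qed.

Let ww : weak_grad B1 w wG.
Proof.
have h := weak_grad_dilate d0 (@open_Ball R n d) Lz wz; rewrite eB in h.
have L1 : L2 B1 (dilate d z) by rewrite -eB; exact: L2_dilate.
have p0 i : pderiv i (cst 0 : E -> R) = fun=> 0.
  by apply/funext => x; rewrite /pderiv derive_cst.
have h0 : weak_grad B1 (cst 0) (pgrad (cst 0)).
  apply: weak_grad_Coo; [exact: open_Ball|exact: Coo_cst|].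
  by move=> i; rewrite p0; exact: L2_0.
have := weak_grad_lin T^-1 (@open_Ball R n 1) L1 (L2_0 (mB 1)) h h0.
apply: eq_weak_grad => x _; first by rewrite addr0.
by apply/rowP => i; rewrite !mxE p0 addr0.
Qed.

Let Ww : W12 B1 w. Proof. exact: W12_intro ww. Qed.

Let WJ psi : W12 B1 psi -> W12 Om (clift d eta psi).
Proof. by move=> Wp; apply: W12_clift. Qed.

Let WE phi : W012 B1 phi -> W012 Om (zlift d phi).
Proof. by move=> Wp; exact: W012_zlift. Qed.

Let Wres : W12 Om res.
Proof.
have := W12_lin (- T) oO (WJ Ww) Wu.
by congr (W12 _ _); apply/funext => x; rewrite /res mulNr addrC.
Qed.

Let V_linu (c : R) p q v : W12 Om p -> W12 Om q -> W012 Om v ->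
  V (fun x => c * p x + q x) v = c * V p v + V q v.
Proof. by case: hV => _ h _; exact: h. Qed.

Let V_linv (c : R) p v v' : W12 Om p -> W012 Om v -> W012 Om v' ->
  V p (fun x => c * v x + v' x) = c * V p v + V p v'.
Proof. by case: hV => h _ _ Wp; case: (h p Wp) => hl _; exact: hl. Qed.

Let k_gt0 : 0 < k. Proof. by rewrite divr_gt0 ?exprn_gt0. Qed.
Let k_sg : k * (sgn d / d) * (sgn d / d) = 1.
Proof.
have : sgn d ^+ 2 = d ^+ n by exact: half_pow_sqr.
by rewrite /k => <-; field; rewrite !gt_eqF.
Qed.

Let mult_Vt : multiplier B1 Vt.
Proof.
have [_ _ [C hC]] := hV.
have [CJ [CJ0 hJ]] := W12norm_clift d0 oO BdO teta.
have bnd psi phi : W12 B1 psi -> W012 B1 phi ->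
   `|Vt psi phi| <= (k * `|C| * CJ * (sgn d / d)) * W12norm B1 psi * L2vnorm B1 (grad B1 phi).
  move=> Wp Wf; rewrite /Vt normrM (gtr0_norm k_gt0).
  have h := hC _ _ (WJ Wp) (WE Wf); rewrite (zlift_norm_Om d0 oO BdO Wf) in h.
  move: h; set q := L2vnorm B1 _ => h.
  have q0 : 0 <= sgn d / d * q.
    by rewrite mulr_ge0 ?L2vnorm_ge0 // divr_ge0 // ltW.
  rewrite [leRHS](_ : _ = k * (`|C| * (CJ * W12norm B1 psi) * (sgn d / d * q))); last by ring.
  apply: ler_wpM2l; first exact: ltW.
  apply: (le_trans h); apply: ler_wpM2r => //.
  apply: (@le_trans _ _ (`|C| * W12norm Om (clift d eta psi))).
    by apply: ler_wpM2r; [exact: W12norm_ge0|exact: ler_norm].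
  by apply: ler_wpM2l => //; exact: hJ.
split.
- move=> psi Wp; split.
    move=> c v v' Wv Wv'; rewrite /Vt (zlift_lin d c v v') (V_linv c (WJ Wp) (WE Wv) (WE Wv')); ring.
  by exists (k * `|C| * CJ * (sgn d / d) * W12norm B1 psi) => v Wv; exact: bnd.
- move=> c p q v Wp Wq Wv; rewrite /Vt (clift_lin d eta c p q) (V_linu c (WJ Wp) (WJ Wq) (WE Wv)); ring.
- by exists (k * `|C| * CJ * (sgn d / d)) => psi phi; exact: bnd.
Qed.

Let Lft : L2v B1 ft.
Proof.
apply: L2vZ => //; rewrite -eB; apply: L2v_dilate => //; exact: L2v_sub hf.
Qed.

Let Wm_gt : Wm12 B1 gt.
Proof.
have [hgl [C hC]] := hg; have [h _ _] := hV; have [_ [C' hC']] := h res Wres.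
split.
  move=> c v v' Wv Wv'; rewrite /gt (zlift_lin d c v v') (V_linv c Wres (WE Wv) (WE Wv')).
  by rewrite (hgl c _ _ (WE Wv) (WE Wv')); ring.
exists (k / T * (`|C| + `|C'|) * (sgn d / d)) => v Wv.
have kT : 0 < k / T by rewrite divr_gt0.
rewrite /gt normrM (gtr0_norm kT).
rewrite [leRHS](_ : _ = k / T * ((`|C| + `|C'|) * (sgn d / d * L2vnorm B1 (grad B1 v)))); last by ring.
apply: ler_wpM2l; first exact: ltW.
apply: le_trans (ler_normB _ _) _.
rewrite -(zlift_norm_Om d0 oO BdO Wv) mulrDl; apply: lerD.
  apply: (le_trans (hC _ (WE Wv))); apply: ler_wpM2r; [exact: L2vnorm_ge0|exact: ler_norm].
apply: (le_trans (hC' _ (WE Wv))); apply: ler_wpM2r; [exact: L2vnorm_ge0|exact: ler_norm].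
Qed.

(** The equation of u is tested with a lifted function. The gradient of the
    affine function disappears, since grad phi has mean zero. *)
Let wsol : weak_solution B1 Vt ft gt w.
Proof.
split; first exact: Ww.
move=> phi Wf; have [_ hs] := hu; have := hs _ (WE Wf).
have [Wf1 _] := Wf; have [LGf _] := grad_spec Wf1.
have [LGu _] := wgu.
rewrite (zlift_int_dot d0 oO BdO Wf LGu) (zlift_int_dot d0 oO BdO Wf hf).
set X := \int[leb]_(x in B1) _; set Y := \int[leb]_(x in B1) _ => hXY.
have [LwG _] := ww.
rewrite (ae_int_dot (mB 1) (grad_L2v ww) LwG LGf (grad_ae (@open_Ball R n 1) ww)).
have Lru : L2v B1 (dilate d (grad Om u)) by rewrite -eB; apply: L2v_dilate => //; exact: L2v_sub LGu.
have Lrf : L2v B1 (dilate d f) by rewrite -eB; apply: L2v_dilate => //; exact: L2v_sub hf.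
have Lb : L2v B1 (fun=> b).
  by have [] := weak_grad_affine a b (bB 1) (@open_Ball R n 1).
have b0 : \int[leb]_(x in B1) dot b (grad B1 phi x) = 0.
  rewrite (L2v_dot_sum (mB 1) Lb LGf) big1 // => i _.
  rewrite RintegralZl //; first by rewrite (W012_int_grad0 i (@open_Ball R n 1) (Ball_leb 1) Wf) mulr0.
  have L1 : L2 B1 (fun=> 1 : R).
    by apply: (@L2_bounded _ _ _ _ 1) => //; [exact: Ball_leb|move=> x _; rewrite normr1].
  have := integrableM_L2 (mB 1) (LGf i) L1; congr (integrable _ _ _).
  by apply/funext => x /=; rewrite mulr1.
have iu := L2v_integrable_dot (mB 1) Lru LGf.
have ib := L2v_integrable_dot (mB 1) Lb LGf.
have if_ := L2v_integrable_dot (mB 1) Lrf LGf.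
have -> : \int[leb]_(x in B1) dot (wG x) (grad B1 phi x) = d / T * X.
  have -> : \int[leb]_(x in B1) dot (wG x) (grad B1 phi x) =
     d / T * (\int[leb]_(x in B1) (dot (dilate d (grad Om u) x) (grad B1 phi x) - dot b (grad B1 phi x))).
    rewrite -RintegralZl //; last exact: (integrableB (mB 1) iu ib).
    apply: eq_Rintegral => x _; rewrite /wG !dotZl /zG /dilate dotDl -scaleN1r dotZl mulN1r.
    by rewrite mulrA [T^-1 * d]mulrC.
  by rewrite RintegralB // b0 subr0.
have -> : \int[leb]_(x in B1) dot (ft x) (grad B1 phi x) = d / T * Y.
  rewrite -RintegralZl //; apply: eq_Rintegral => x _; by rewrite /ft dotZl.
rewrite /Vt /gt.
have -> : V res (zlift d phi) = V u (zlift d phi) - T * V (clift d eta w) (zlift d phi).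
  have := V_linu (- T) (WJ Ww) Wu (WE Wf).
  rewrite (_ : (fun x => _) = res); first by move=> ->; ring.
  by apply/funext => x; rewrite /res mulNr addrC.
have dn : d ^+ n != 0 by rewrite gt_eqF // exprn_gt0.
have dd : d != 0 by rewrite gt_eqF.
have TT : T != 0 by rewrite gt_eqF.
have eX : d / T * X = k / T * (d ^+ n / d * X) by rewrite /k; field; rewrite dd TT dn.
have eY : d / T * Y = k / T * (d ^+ n / d * Y) by rewrite /k; field; rewrite dd TT dn.
have -> : d / T * X = k / T * (d ^+ n / d * Y + g (zlift d phi) - V u (zlift d phi)).
  by rewrite eX -hXY; ring.
by rewrite eY; field; rewrite ?dd ?TT ?dn.
Qed.

Let zlift_in phi x : B1 x -> zlift d phi (d *: x) = phi x.
Proof.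
move=> Bx; rewrite /zlift ext_in; last first.
  by rewrite /Ball /= euclZ gtr0_norm // -ltr_pdivlMl // mulVf ?gt_eqF.
by rewrite /dilate dilate_inv.
Qed.

Let int_ft phi rho : W12 B1 phi -> rho <= 1 ->
  (\int[leb]_(x in Ball rho) (dot (ft x) (ft x) * phi x ^+ 2)%:E =
   ((d / T) ^+ 2 / d ^+ n)%:E *
   \int[leb]_(x in Ball (d * rho)) (dot (f x) (f x) * zlift d phi x ^+ 2)%:E)%E.
Proof.
move=> Wf r1; have [Lp _] := Wf; have [mp _] := Lp.
have sub1 : Ball rho `<=` B1 by exact: Ball_sub.
have sub2 : Ball (d * rho) `<=` @Ball R n d by apply: Ball_sub; rewrite ger_pMr.
pose h x := dot (f x) (f x) * zlift d phi x ^+ 2.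
have mh : measurable_fun (Ball (d * rho)) h.
  apply: measurable_funM.
    by apply: measurable_dot => i; have [m _] := hf i;
      apply: measurable_funS m => //; exact: subset_trans BdO.
  apply: measurable_funX; apply: (measurable_funS (mB d)) => //.
  apply: measurable_ext => //; have := measurable_dilate (c := d^-1) (mB 1) mp.
  by rewrite dilated_dVBall // mulr1.
have h0 x : 0 <= h x by rewrite mulr_ge0 ?dot_ge0 ?sqr_ge0.
have := ge0_int_dilate d0 (mB (d * rho)) mh (fun x _ => h0 x); rewrite dilated_dBall // => e.
transitivity (\int[leb]_(x in Ball rho) (((d / T) ^+ 2)%:E * (dilate d h x)%:E))%E.
  apply: eq_integral => x /[!inE] bx; rewrite -EFinM; congr _%:E.
  rewrite /ft dotZl dotZr /dilate /h zlift_in; last exact: sub1.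
  by ring.
rewrite ge0_integralZl_EFin //; last 3 first.
- by move=> x _; rewrite lee_fin; exact: h0.
- apply/measurable_EFinP; have := measurable_dilate (c := d) (mB (d * rho)) mh.
  by rewrite dilated_dBall.
- exact: sqr_ge0.
by rewrite e muleA -EFinM.
Qed.

Let dT2 : 0 <= (d / T) ^+ 2 / d ^+ n.
Proof. by rewrite divr_ge0 ?sqr_ge0 ?exprn_ge0 ?(ltW d0). Qed.

Let adm_ft : admissible B1 (fun x => dot (ft x) (ft x)).
Proof.
have [_ _ [C hC]] := af.
split; [by move=> x _; exact: dot_ge0|exact: L2v_integrable_dot|].
exists ((d / T) ^+ 2 / d ^+ n * (C * (sgn d / d) ^+ 2)) => phi Wf; have [Wf1 _] := Wf.
under eq_integral do rewrite mulrC.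
rewrite (int_ft Wf1 (lexx 1)) mulr1.
rewrite -[X in (_ <= X%:E)%E]mulrA [X in (_ <= X)%E]EFinM; apply: lee_wpmul2l; first by rewrite lee_fin.
apply: (@le_trans _ _ (\int[leb]_(x in Om) (zlift d phi x ^+ 2 * dot (f x) (f x))%:E)%E).
  under eq_integral do rewrite mulrC.
  apply: ge0_subset_integral => //.
    apply/measurable_EFinP; apply: measurable_funM.
      by apply: measurable_funX; have [[[] ]] := WE Wf.
    by apply: measurable_dot => i; have [] := hf i.
  by move=> x _; rewrite lee_fin mulr_ge0 ?dot_ge0 ?sqr_ge0.
apply: le_trans (hC _ (WE Wf)) _; rewrite (zlift_norm_Om d0 oO BdO Wf) lee_fin.
by rewrite exprMn mulrA.
Qed.

Let avg_w : (vol B1)^-1 * \int[leb]_(x in B1) (w x ^+ 2) <= 1.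
Proof.
have Lz1 : L2 (Ball (d * 1)) z by rewrite mulr1.
have e := L2avg_dilate d0 ltr01 Lz1; rewrite mulr1 in e.
have L1 : L2 B1 (dilate d z) by rewrite -eB; exact: L2_dilate.
have v0 := vol_gt0 (n := n) (@ltr01 R).
have -> : \int[leb]_(x in B1) (w x ^+ 2) = T ^- 2 * \int[leb]_(x in B1) (dilate d z x ^+ 2).
  rewrite -RintegralZl //; last exact: integrable_sqr.
  by apply: eq_Rintegral => x _; rewrite /w exprMn exprVn.
rewrite mulrCA.
have -> : (vol B1)^-1 * \int[leb]_(x in B1) (dilate d z x ^+ 2) = L2avg B1 (dilate d z) ^+ 2.
  rewrite sqr_sqrtr // mulr_ge0 // ?invr_ge0 ?(ltW v0) //.
  by apply: Rintegral_ge0 => x _; exact: sqr_ge0.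
rewrite e mulrC ler_pdivrMr ?exprn_gt0 // mul1r ler_sqr ?nnegrE ?(ltW T0) //.
exact: sqrtr_ge0.
Qed.

Section local_bounds.
Variables (rho : R) (phi : E -> R).
Hypotheses (rho0 : 0 < rho) (rho12 : rho <= 2^-1) (Wf : W012 B1 phi)
  (sp : esupp B1 phi `<=` cBall rho).
Let r := d * rho.
Let r0 : 0 < r. Proof. by rewrite mulr_gt0. Qed.
Let rR : 0 < r <= R0 / 2.
Proof.
rewrite r0 /= /r; apply: (@le_trans _ _ (d * 2^-1)); first by rewrite ler_pM2l.
by rewrite ler_wpM2r // invr_ge0.
Qed.
Let rho1 : rho <= 1. Proof. by apply: le_trans rho12 _; lra. Qed.
Let rd : r <= d. Proof. by rewrite ger_pMr. Qed.
Let spE : esupp Om (zlift d phi) `<=` cBall r.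
Proof.
apply: esupp_ext BdO _; have di : 0 < d^-1 by rewrite invr_gt0.
have := esupp_dilate di rho0 sp; rewrite dilated_dVBall // mulr1 invrK mulrC; exact.
Qed.
Let N := L2vnorm (Ball rho) (grad B1 phi).
Let N0 : 0 <= N. Proof. exact: L2vnorm_ge0. Qed.
Let EN : L2vnorm (Ball r) (grad Om (zlift d phi)) = sgn d / d * N.
Proof. exact: zlift_norm. Qed.
Let sd_ge0 : 0 <= sgn d / d. Proof. by rewrite divr_ge0 // ltW. Qed.

(** Shrinking the outer radius divides the gap to rho by 2 at most. *)
Let L12_le psi th theta : W12 B1 psi -> rho < th -> th <= theta -> theta <= 1 ->
  theta - rho <= 2 * (th - rho) ->
  L12norm B1 rho th psi <= 2 * L12norm B1 rho theta psi.
Proof.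
move=> Wp rt tt t1 h; have [Lp _] := Wp; have [LG _] := grad_spec Wp.
have s1 : Ball th `<=` @Ball R n theta by exact: Ball_sub.
have s2 : Ball theta `<=` B1 by exact: Ball_sub.
have L1 := L2_sub (mB 1) (mB theta) s2 Lp; have L2' := L2v_sub (mB 1) (mB theta) s2 LG.
have q1 := L2norm_mono (mB theta) (mB th) s1 L1.
have q2 := L2vnorm_mono (mB theta) (mB th) s1 L2'.
have q3 := L2norm_ge0 (Ball theta) psi; have q4 := L2vnorm_ge0 (Ball th) (grad B1 psi).
have q5 := L2norm_ge0 (Ball th) psi.
have t0 : 0 < th - rho by rewrite subr_gt0.
have t0' : 0 < theta - rho by rewrite subr_gt0 (lt_le_trans rt).
rewrite /L12norm mulrDr; apply: lerD; last by lra.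
rewrite mulrA ler_pdivrMr // mulrAC ler_pdivlMr //.
by nra.
Qed.

(** The radius theta may be as large as 1, but the cutoff is 1 only on the ball of
    radius 3/4. The bound on V is used with the smaller of both radii, at the
    price of a factor 2, which the smallness condition on omega1 absorbs. *)
Let Vt_bound psi theta : W12 B1 psi -> rho < theta <= 2 * rho ->
  `|Vt psi phi| <= delta0 * L12norm B1 rho theta psi * N.
Proof.
move=> Wp /andP[rt t2].
pose th := Num.min theta (3 / 4).
have h12 : 2 * rho <= 1 by rewrite -ler_pdivlMl // mulr1.
have th1 : rho < th by rewrite lt_min rt /=; lra.
have th2 : th <= 3 / 4 by rewrite ge_min lexx orbT.
have th3 : th <= theta by rewrite ge_min lexx.
have [hV1 _ _] := hloc rR (WJ Wp) (WE Wf) spE.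
have hs : r < d * th <= 2 * r.
  by rewrite /r ltr_pM2l // th1 mulrCA ler_pM2l //= (le_trans th3).
have := hV1 _ hs; rewrite EN (L12norm_clift d0 oO BdO teta eta1 Wp rho0); last first.
  by rewrite th1 th2.
have q := L12_le Wp th1 th3.
have t1 : theta <= 1 by lra.
have := q t1; set L := L12norm B1 rho th psi; set L' := L12norm B1 rho theta psi => qq.
have LL : L <= 2 * L'.
  apply: qq; rewrite /th /Num.min; case: ltP => h; lra.
have L0 : 0 <= L.
  by rewrite addr_ge0 ?L2vnorm_ge0 // divr_ge0 ?L2norm_ge0 // subr_ge0 ltW.
move=> hb.
have w1d : omega1 (d * th) <= omega1 d.
  apply: w1m; last by rewrite ger_pMr //; lra.
  by rewrite mulr_ge0 ?(ltW d0) //; lra.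
rewrite /Vt normrM (gtr0_norm k_gt0).
apply: (@le_trans _ _ (k * (omega1 (d * th) * (sgn d / d * L) * (sgn d / d * N)))).
  by rewrite ler_wpM2l ?(ltW k_gt0).
rewrite [leLHS](_ : _ = (k * (sgn d / d) * (sgn d / d)) * (omega1 (d * th) * L * N)); last by ring.
rewrite k_sg mul1r; apply: ler_wpM2r; first exact: N0.
have w0 := w1_ge0 (ltW d0).
apply: (@le_trans _ _ (omega1 d * (2 * L'))).
  apply: (@le_trans _ _ (omega1 d * L)); first exact: (ler_wpM2r L0 w1d).
  exact: (ler_wpM2l w0 LL).
rewrite mulrA [omega1 d * 2]mulrC; apply: ler_wpM2r; [lra|exact: hw1].
Qed.

Let f_bound :
  (\int[leb]_(x in Ball rho) (dot (ft x) (ft x) * phi x ^+ 2)%:E <=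
   (delta0 ^+ 2 * \int[leb]_(x in Ball rho)
       dot (grad B1 phi x) (grad B1 phi x))%R%:E)%E.
Proof.
have [Wf1 _] := Wf; rewrite (int_ft Wf1 rho1) -sqr_L2vnorm -/N.
have [_ hf1 _] := hloc rR Wu (WE Wf) spE.
apply: (@le_trans _ _ (((d / T) ^+ 2 / d ^+ n)%:E * (omega2 r ^+ 2 * (sgn d / d * N) ^+ 2)%:E)%E).
  apply: lee_wpmul2l; first by rewrite lee_fin.
  by apply: le_trans hf1 _; rewrite -sqr_L2vnorm EN.
rewrite -EFinM lee_fin.
have sn : sgn d ^+ 2 = d ^+ n by exact: half_pow_sqr.
have -> : (d / T) ^+ 2 / d ^+ n * (omega2 r ^+ 2 * (sgn d / d * N) ^+ 2) = (omega2 r / T) ^+ 2 * N ^+ 2.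
  by rewrite -sn; field; rewrite !gt_eqF.
rewrite ler_wpM2r ?sqr_ge0 //.
have w0 := w2_ge0 (ltW r0); have w2d := w2m (ltW r0) rd.
have w1d := w1_ge0 (ltW d0).
have q0 : 0 <= omega2 r / T by rewrite divr_ge0 // ltW.
have q1 : omega2 r / T <= delta0.
  rewrite ler_pdivrMr //; apply: le_trans hw2; apply: (le_trans w2d).
  have e0 := eucl_ge0 b; have ka : 1 <= kappa.
    by rewrite /kappa -addrA lerDl addr_ge0 ?powR_ge0 // mulr_ge0 ?sqrtr_ge0.
  have y0 : 0 <= omega1 d * (`|a| + eucl b * d).
    by rewrite mulr_ge0 // addr_ge0 // mulr_ge0 // ltW.
  have z0 := le_trans w0 w2d.
  apply: (@le_trans _ _ (1 * (omega2 d + omega1 d * (`|a| + eucl b * d)))).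
    by rewrite mul1r lerDl.
  by rewrite ler_wpM2r // addr_ge0.
by rewrite ler_sqr ?nnegrE // (le_trans q0).
Qed.

Let res_in x : Ball (d * (3 / 4)) x -> res x = l x.
Proof.
move=> bx; rewrite /res (clift_in d0 eta1 w bx) /w /dilate dilate_inv' // mulrA mulfV ?gt_eqF //.
by rewrite mul1r /z opprB addrC subrK.
Qed.

Let cst_norm s c : 0 < s -> L2norm (Ball s) (fun _ : E => c) = `|c| * (sgn s * Num.sqrt (vol B1)).
Proof.
move=> s0; rewrite /L2norm Rintegral_cst // sqrtrM ?sqr_ge0 // sqrtr_sqr; congr (_ * _).
by have := vol_Ball (n := n) s0; rewrite /vol => ->; rewrite sqrtrM // exprn_ge0 // ltW.
Qed.

(** As r <= d/2, this outer radius remains in the ball where res is affine. *)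
Let s := 3 / 2 * r.
Let s0 : 0 < s. Proof. by rewrite /s; have := r0; lra. Qed.
Let s_le : s <= d * (3 / 4).
Proof. by rewrite /s /r; have : d * rho <= d * 2^-1 by [rewrite ler_pM2l]; lra. Qed.
Let sd : s <= d. Proof. by apply: le_trans s_le _; rewrite ger_pMr //; lra. Qed.

(** The factor 4 is 1 + 3, where 3 comes from s - r = s / 3. *)
Let L12_res : L12norm Om r s res <= 4 * Num.sqrt (vol B1) * (sgn d / d) * (`|a| + eucl b * d).
Proof.
have sub1 : Ball s `<=` @Ball R n (d * (3 / 4)) by exact: Ball_sub.
have sO : Ball s `<=` Om by apply: subset_trans BdO; exact: Ball_sub.
rewrite /L12norm.
have -> : L2norm (Ball s) res = L2norm (Ball s) l.
  by apply: eq_L2norm => x /sub1; exact: res_in.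
have -> : L2vnorm (Ball s) (grad Om res) = eucl b * (sgn s * Num.sqrt (vol B1)).
  rewrite (L2vnorm_grad_local oO (@open_Ball R n s) sO (grad_spec Wres)
     (weak_grad_affine a b (bB s) (@open_Ball R n s))); last by move=> x /sub1; exact: res_in.
  rewrite /L2vnorm -sqr_eucl; have := cst_norm (eucl b) s0; rewrite /L2norm => ->.
  by rewrite ger0_norm // eucl_ge0.
have Lls : L2 (Ball s) l by apply: affine_L2.
have h1 : L2norm (Ball s) l <= (`|a| + eucl b * s) * (sgn s * Num.sqrt (vol B1)).
  have q0 : 0 <= `|a| + eucl b * s by rewrite addr_ge0 // mulr_ge0 ?eucl_ge0 // ltW.
  rewrite -[X in X * _](ger0_norm q0) -cst_norm //; apply: L2norm_le => //.
    by apply: (@L2_bounded _ _ _ _ (`|a| + eucl b * s)) => //; [exact: Ball_leb|move=> x _; rewrite ger0_norm].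
  move=> x bx; rewrite (ger0_norm q0); apply: le_trans (ler_normD _ _) _; rewrite lerD2l.
  apply: le_trans (cauchy_dot _ _) _; rewrite ler_wpM2l ?eucl_ge0 //; exact: ltW.
have e1 : s - r = s / 3 by rewrite /s; field.
have sv0 := sqrtr_ge0 (vol B1).
have sg0 : 0 < sgn s by exact: half_pow_gt0.
apply: (@le_trans _ _ ((`|a| + eucl b * s) * (sgn s * Num.sqrt (vol B1)) / (s / 3) +
   eucl b * (sgn s * Num.sqrt (vol B1)))).
  by rewrite lerD2r e1 ler_wpM2r // invr_ge0 divr_ge0 // ltW.
have e0 := eucl_ge0 b; have a0 := normr_ge0 a.
rewrite [leLHS](_ : _ = Num.sqrt (vol B1) * ((sgn s / s) * (3 * `|a| + 4 * eucl b * s))); last first.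
  by field; rewrite gt_eqF.
rewrite [leRHS](_ : _ = Num.sqrt (vol B1) * ((sgn d / d) * (4 * (`|a| + eucl b * d)))); last by ring.
apply: ler_wpM2l => //; apply: ler_pM.
- by rewrite divr_ge0 // ltW.
- by have := mulr_ge0 e0 (ltW s0); lra.
- exact: half_pow_div_mono.
- by have := ler_wpM2l e0 sd; lra.
Qed.

Let gt_bound : `|gt phi| <= delta0 * N.
Proof.
have [_ _ hg1] := hloc rR Wu (WE Wf) spE.
have [hV1 _ _] := hloc rR Wres (WE Wf) spE.
have hs : r < s <= 2 * r by rewrite /s; apply/andP; split; have := r0; lra.
have b1 := hV1 _ hs; rewrite EN in b1; rewrite EN (vol_powR r0) in hg1.
have kT : 0 < k / T by rewrite divr_gt0.
rewrite /gt normrM (gtr0_norm kT).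
set vp := vol B1 `^ pexp in hg1; set sv := Num.sqrt (vol B1).
have vp0 : 0 <= vp by exact: powR_ge0.
have sv0 : 0 <= sv := sqrtr_ge0 _.
have w2d := w2m (ltW r0) rd; have w20' := w2_ge0 (ltW r0).
have w1d := w1m (ltW s0) sd; have w10' := w1_ge0 (ltW s0).
have al0 : 0 <= `|a| + eucl b * d by rewrite addr_ge0 // mulr_ge0 ?eucl_ge0 // ltW.
have c1 : `|g (zlift d phi)| <= (vp * omega2 d) * ((sgn d / d) * (sgn d / d * N)).
  apply: (le_trans hg1).
  rewrite [leLHS](_ : _ = (vp * omega2 r) * ((sgn r / r) * (sgn d / d * N))); last first.
    by field; rewrite !gt_eqF.
  apply: ler_pM; first by rewrite mulr_ge0.
  - by apply: mulr_ge0; [rewrite divr_ge0 ?(ltW r0) // ltW // half_pow_gt0|rewrite mulr_ge0].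
  - by rewrite ler_wpM2l.
  - by apply: ler_wpM2r; [rewrite mulr_ge0|exact: half_pow_div_mono].
have c2 : `|V res (zlift d phi)| <=
    (4 * sv * (omega1 d * (`|a| + eucl b * d))) * ((sgn d / d) * (sgn d / d * N)).
  apply: (le_trans b1).
  rewrite [leRHS](_ : _ = omega1 d * (4 * sv * (sgn d / d) * (`|a| + eucl b * d)) * (sgn d / d * N)); last by ring.
  apply: ler_wpM2r; first by rewrite mulr_ge0.
  apply: ler_pM; [exact: w10'| |exact: w1d|exact: L12_res].
  by rewrite addr_ge0 ?L2vnorm_ge0 // divr_ge0 ?L2norm_ge0 // subr_ge0 /s; have := r0; lra.
apply: (@le_trans _ _ (k / T * ((vp * omega2 d + 4 * sv * (omega1 d * (`|a| + eucl b * d))) *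
    ((sgn d / d) * (sgn d / d * N))))).
  rewrite ler_wpM2l ?(ltW kT) // mulrDl; apply: le_trans (ler_normB _ _) _; exact: lerD.
rewrite [leLHS](_ : _ = (k * (sgn d / d) * (sgn d / d)) *
   ((vp * omega2 d + 4 * sv * (omega1 d * (`|a| + eucl b * d))) / T * N)); last by ring.
rewrite k_sg mul1r; apply: ler_wpM2r; first exact: N0.
rewrite ler_pdivrMr //; apply: le_trans hw2.
have z1 := le_trans w20' w2d; have z2 := mulr_ge0 (le_trans w10' w1d) al0.
rewrite /kappa -/vp -/sv; move: z1 z2; set p := omega2 d; set q := omega1 d * _ => z1 z2.
have := mulr_ge0 vp0 z2; have := mulr_ge0 sv0 z1; lra.
Qed.

Lemma scaled_local_bounds psi : W12 B1 psi ->
  [/\ forall theta : R, rho < theta <= 2 * rho ->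
        `|Vt psi phi| <= delta0 * L12norm B1 rho theta psi * L2vnorm (Ball rho) (grad B1 phi),
      `|gt phi| <= delta0 * L2vnorm (Ball rho) (grad B1 phi)
    & (\int[leb]_(x in Ball rho) (dot (ft x) (ft x) * phi x ^+ 2)%:E <=
       (delta0 ^+ 2 * \int[leb]_(x in Ball rho)
          dot (grad B1 phi x) (grad B1 phi x))%R%:E)%E].
Proof. by move=> Wp; split => [theta ht||]; [exact: Vt_bound|exact: gt_bound|exact: f_bound]. Qed.

End local_bounds.

(** The approximation property applies to w: the two smallness conditions are
    what its local bounds amount to after rescaling. *)
Lemma improve_at_scale : exists (a' : R) (b' : E),
  L2avg (Ball (d * lam)) (fun x => u x - affine a' b' x) <= 2^-1 * lam * T /\
  `|a' - a| + eucl (b' - b) * d <= C0 * T.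
Proof.
have [_ /andP[l0 l1] _ H] := hconst.
have [|a1 [b1 [h1 h2]]] := H Vt ft gt w mult_Vt Lft adm_ft Wm_gt wsol avg_w.
  move=> rho psi phi /andP[rho0 rho12] Wp Wf sp; exact: scaled_local_bounds.
exists (a + T * a1), (b + (T / d) *: b1); split; last first.
  have -> : a + T * a1 - a = T * a1 by ring.
  have -> : b + (T / d) *: b1 - b = (T / d) *: b1 by rewrite addrAC subrr add0r.
  rewrite euclZ normrM (gtr0_norm T0) (gtr0_norm (divr_gt0 T0 d0)).
  rewrite [leLHS](_ : _ = T * (`|a1| + eucl b1)); last by field; rewrite gt_eqF.
  by rewrite mulrC ler_wpM2r // ltW.
set Z := fun x => _.
have LZ : L2 (Ball (d * lam)) Z.
  have sub : Ball (d * lam) `<=` @Ball R n d by apply: Ball_sub; rewrite ger_pMr // ltW.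
  by apply: L2B => //; [exact: L2_sub Lud|exact: affine_L2].
rewrite -(L2avg_dilate d0 l0 LZ).
have e : dilate d Z = fun x => T * (w x - (a1 + dot b1 x)).
  apply/funext => x; rewrite /dilate /Z /w /dilate /z /l /affine dotDl dotZl !dotZr.
  by field; rewrite !gt_eqF.
have Lwl : L2 (Ball lam) (fun x => w x - (a1 + dot b1 x)).
  apply: L2B => //; last exact: (affine_L2 a1 b1 (bB lam)).
  by apply: L2_sub Lw => //; apply: Ball_sub; exact: ltW.
have v0 := ltW (vol_gt0 (n := n) l0).
rewrite e (L2avgE _ v0) L2normZ // (gtr0_norm T0) mulrCA -(L2avgE _ v0) mulrC.
by rewrite ler_wpM2r // ltW.
Qed.

End at_scale.
End one_step.

(** * Dini moduli and their integrals *)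

Section moduli_facts.
Context {R : realType}.
Local Notation mu := (@lebesgue_measure R).
Implicit Types (omega : R -> R) (r s t rb : R).

Lemma mod_ge0 omega r : modulus omega -> 0 <= r -> 0 <= omega r.
Proof. by move=> [h0 hm _ _] r0; rewrite -h0 hm. Qed.

Lemma mod_natmul omega k r : modulus omega -> 0 <= r -> omega (k%:R * r) <= k%:R * omega r.
Proof.
move=> [h0 _ hs _] r0; elim: k => [|k ih]; first by rewrite !mul0r h0.
rewrite -natr1 !mulrDl !mul1r; apply: le_trans (hs _ _ _ _) _ => //.
  by rewrite mulr_ge0.
by rewrite lerD2r.
Qed.

(** Subadditivity bounds omega r by this multiple of omega (lam r). *)
Definition doubling (lam : R) : R := (Num.truncn lam^-1).+1%:R.

Lemma doubling_ge1 lam : 1 <= doubling lam. Proof. by rewrite /doubling ler1n. Qed.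

Lemma mod_doubling omega lam r : modulus omega -> 0 < lam -> 0 <= r ->
  omega r <= doubling lam * omega (lam * r).
Proof.
move=> mo l0 r0; apply: le_trans (mod_natmul _ mo _); last by rewrite mulr_ge0 // ltW.
have [_ hm _ _] := mo; apply: hm => //; rewrite mulrA ler_peMl //.
by rewrite -ler_pdivrMr // mul1r; apply/ltW/truncnS_gt.
Qed.

Lemma mod_measurable omega r : modulus omega -> 0 <= r -> measurable_fun `]r, +oo[ omega.
Proof.
move=> [_ _ _ hc] r0; apply: subspace_continuous_measurable_fun => //.
by apply: continuous_subspaceW hc => x; rewrite /= in_itv /= andbT => /ltW; exact: le_trans.
Qed.

Lemma measurable_invX p : measurable_fun (`]0%R, +oo[%classic : set R) (fun s : R => (s ^+ p)^-1).
Proof.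
apply: open_continuous_measurable_fun; first exact: interval_open.
move=> x; rewrite inE /= in_itv /= andbT => x0.
apply: (continuous_comp (@exprn_continuous _ p x)).
by apply: inv_continuous; rewrite expf_neq0 // gt_eqF.
Qed.

Lemma mod_div_measurable omega p r rb : modulus omega -> 0 <= r ->
  measurable_fun `]r, rb[ (fun s => omega s / s ^+ p).
Proof.
move=> mo r0.
have sub : `]r, rb[%classic `<=` `]0%R, +oo[%classic.
  by move=> x /=; rewrite !in_itv /= andbT => /andP[h _]; exact: le_lt_trans h.
apply: (measurable_funS _ sub) => //; apply: measurable_funM; last exact: measurable_invX.
exact: mod_measurable.
Qed.

Lemma mod_div_ge0 omega p s : modulus omega -> 0 <= s -> 0 <= omega s / s ^+ p.
Proof. by move=> mo s0; apply: divr_ge0; [exact: mod_ge0|exact: exprn_ge0]. Qed.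

Lemma dini_integrable R0 omega r : Dini_modulus R0 omega -> r <= R0 ->
  mu.-integrable `]0%R, r[ (EFin \o (fun s => omega s / s)).
Proof.
move=> [mo foo] rR.
have iR : mu.-integrable `]0%R, R0[ (EFin \o (fun s => omega s / s)).
  apply/integrableP; split.
    by apply/measurable_EFinP; have := mod_div_measurable 1 (rb := R0) mo (lexx 0).
  apply: le_lt_trans foo; rewrite le_eqVlt; apply/orP; left; apply/eqP.
  apply: eq_integral => x; rewrite inE /= in_itv /= => /andP[x0 _].
  by rewrite ger0_norm //; exact: (mod_div_ge0 1 mo (ltW x0)).
apply: integrableS iR => // x /=; rewrite !in_itv /= => /andP[-> h] /=.
exact: lt_le_trans rR.
Qed.

Lemma tail_integrable omega s rb : modulus omega -> 0 < s ->
  mu.-integrable `]s, rb[ (EFin \o (fun t => omega t / t ^+ 2)).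
Proof.
move=> mo s0; have [_ hm _ _] := mo.
have [srb|rbs] := ltP s rb; last first.
  by rewrite set_itv_ge ?bnd_simp -?leNgt //; exact: integrable_set0.
apply: measurable_bounded_integrable => //.
- by rewrite /= lebesgue_measure_itv /= lte_fin srb -EFinB ltry.
- exact: mod_div_measurable (ltW s0).
exists (omega rb / s ^+ 2); split; first exact: num_real.
move=> M hM x /=; rewrite in_itv /= => /andP[sx xr]; apply: le_trans (ltW hM).
have x0 : 0 < x := lt_trans s0 sx.
rewrite ger0_norm; last exact: mod_div_ge0 mo (ltW x0).
apply: ler_pM.
- by rewrite mod_ge0 // ltW.
- by rewrite invr_ge0 exprn_ge0 // ltW.
- by rewrite hm // ltW.
- by rewrite lef_pV2 ?posrE ?exprn_gt0 // ler_sqr ?nnegrE ltW.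
Qed.

Lemma Rint_split (f : R -> R) (a m b : R) : a <= m -> m <= b ->
  mu.-integrable `]a, b[ (EFin \o f) ->
  \int[mu]_(x in `]a, b[) f x = \int[mu]_(x in `]a, m[) f x + \int[mu]_(x in `]m, b[) f x.
Proof.
move=> am mb fi.
have [mb'|bm] := ltP m b; last first.
  have -> : m = b by apply/le_anti/andP.
  by rewrite [X in _ = _ + Rintegral _ X _]set_itv_ge ?bnd_simp ?ltxx // Rintegral_set0 addr0.
have i1 : mu.-integrable `]a, m[ (EFin \o f).
  apply: integrableS fi => // x /=; rewrite !in_itv /= => /andP[-> h] /=; exact: lt_trans mb'.
have := @Rintegral_itvB R f (BRight a) (BLeft b) m fi.
rewrite !bnd_simp => /(_ am mb') <-.
by rewrite -Rintegral_itv_bndo_bndc // addrC subrK.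
Qed.

Lemma Rint_lower (f : R -> R) (a b c : R) : a <= b ->
  mu.-integrable `]a, b[ (EFin \o f) -> (forall x, a < x < b -> c <= f x) ->
  c * (b - a) <= \int[mu]_(x in `]a, b[) f x.
Proof.
move=> ab fi hc.
have <- : \int[mu]_(x in `]a, b[) c = c * (b - a).
  rewrite Rintegral_cst //; congr (_ * _); rewrite /= lebesgue_measure_itv /= lte_fin.
  by case: ltP => h //=; apply/eqP; rewrite eq_sym subr_eq0; apply/eqP/le_anti/andP.
apply: le_Rintegral => //.
  apply: measurable_bounded_integrable => //.
    by rewrite /= lebesgue_measure_itv /= lte_fin; case: ifP => _; rewrite ?ltry // -EFinB ltry.
  by exists `|c|; split => // M hM x _; exact: ltW.
Qed.

Lemma dini_ge0 omega r : modulus omega -> 0 <= dini_int omega r.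
Proof.
move=> mo; apply: Rintegral_ge0 => x /=; rewrite in_itv /= => /andP[x0 _].
exact: (mod_div_ge0 1 mo (ltW x0)).
Qed.

Lemma tail_ge0 omega s rb : modulus omega -> 0 <= s -> 0 <= tail_int omega s rb.
Proof.
move=> mo s0; apply: Rintegral_ge0 => x /=; rewrite in_itv /= => /andP[x0 _].
by apply: mod_div_ge0 mo _; apply: le_trans s0 (ltW x0).
Qed.

(** On ]s, r[ the integrand is at least omega s / r. Summed over a geometric
    sequence of scales, this bounds sums of values of omega by the integral. *)
Lemma dini_step R0 omega s r : Dini_modulus R0 omega -> 0 < s -> s <= r -> r <= R0 ->
  dini_int omega s + omega s / r * (r - s) <= dini_int omega r.
Proof.
move=> Do s0 sr rR; have [mo _] := Do; have [_ hm _ _] := mo.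
have ir := dini_integrable Do rR.
rewrite /dini_int (Rint_split (ltW s0) sr ir) lerD2l; apply: Rint_lower => //.
  by apply: integrableS ir => // x /=; rewrite !in_itv /= => /andP[h ->]; rewrite (lt_trans s0).
move=> x /andP[sx xr]; have x0 := lt_trans s0 sx; apply: ler_pM.
- by rewrite mod_ge0 // ltW.
- by rewrite invr_ge0 ltW // (lt_trans x0).
- by rewrite hm // ltW.
- by rewrite lef_pV2 ?posrE // ?(lt_trans x0) // ltW.
Qed.

Lemma dini_mono R0 omega s r : Dini_modulus R0 omega -> 0 < s -> s <= r -> r <= R0 ->
  dini_int omega s <= dini_int omega r.
Proof.
move=> Do s0 sr rR; have [mo _] := Do; apply: le_trans (dini_step Do s0 sr rR).
rewrite lerDl mulr_ge0 ?subr_ge0 // divr_ge0 ?mod_ge0 ?(ltW s0) //.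
by rewrite (le_trans (ltW s0)).
Qed.

Lemma tail_step omega s r rb : modulus omega -> 0 < s -> s <= r -> r <= rb ->
  tail_int omega r rb + omega s / r ^+ 2 * (r - s) <= tail_int omega s rb.
Proof.
move=> mo s0 sr rR; have [_ hm _ _] := mo.
have ir := tail_integrable rb mo s0.
rewrite /tail_int (Rint_split sr rR ir) addrC lerD2r; apply: Rint_lower => //.
  by apply: tail_integrable.
move=> x /andP[sx xr]; have x0 := lt_trans s0 sx; apply: ler_pM.
- by rewrite mod_ge0 // ltW.
- by rewrite invr_ge0 exprn_ge0 // ltW // (lt_trans x0).
- by rewrite hm // ltW.
- by rewrite lef_pV2 ?posrE ?exprn_gt0 // ?(lt_trans x0) // ler_sqr ?nnegrE ltW // (lt_trans x0).
Qed.

Lemma tail_mono omega s r rb : modulus omega -> 0 < s -> s <= r -> r <= rb ->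
  tail_int omega r rb <= tail_int omega s rb.
Proof.
move=> mo s0 sr rR; apply: le_trans (tail_step mo s0 sr rR).
rewrite lerDl; apply: mulr_ge0; last by rewrite subr_ge0.
by apply: divr_ge0; [exact: mod_ge0 mo (ltW s0)|apply: exprn_ge0; rewrite (le_trans (ltW s0))].
Qed.

Lemma tail_mono_r omega s r rb : modulus omega -> 0 < s -> s <= r -> r <= rb ->
  tail_int omega s r <= tail_int omega s rb.
Proof.
move=> mo s0 sr rR; rewrite /tail_int (Rint_split sr rR (tail_integrable rb mo s0)) lerDl.
by apply: tail_ge0 => //; rewrite (le_trans (ltW s0)).
Qed.

Lemma integrable_lin (D : set R) (f h : R -> R) (c : R) : measurable D ->
  mu.-integrable D (EFin \o f) -> mu.-integrable D (EFin \o h) ->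
  mu.-integrable D (EFin \o (fun x => f x + c * h x)).
Proof.
move=> mD fi hi.
rewrite (_ : _ \o _ = (EFin \o f) \+ (fun x => c%:E * (EFin \o h) x))%E.
  by apply: integrableD => //; apply: integrableZl.
by apply/funext => x /=; rewrite EFinD EFinM.
Qed.

Lemma Rintegral_lin (D : set R) (f h : R -> R) (c : R) : measurable D ->
  mu.-integrable D (EFin \o f) -> mu.-integrable D (EFin \o h) ->
  \int[mu]_(x in D) (f x + c * h x) = \int[mu]_(x in D) f x + c * \int[mu]_(x in D) h x.
Proof.
move=> mD fi hi; rewrite -RintegralZl // -RintegralD //.
rewrite (_ : _ \o _ = (fun x => c%:E * (EFin \o h) x))%E; first exact: integrableZl.
by apply/funext => x /=; rewrite EFinM.
Qed.

Lemma mod_lin (c : R) omega1 omega2 : 0 <= c -> modulus omega1 -> modulus omega2 ->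
  modulus (fun s => omega2 s + c * omega1 s).
Proof.
move=> c0 [z1 m1 s1 c1] [z2 m2 s2 c2]; split => [|r s r0 rls|r s r0 s0|x].
- by rewrite z1 z2 mulr0 addr0.
- by rewrite lerD ?m2 // ler_wpM2l // m1.
- rewrite [leRHS](_ : _ = omega2 r + omega2 s + c * (omega1 r + omega1 s)); last by ring.
  by rewrite lerD ?s2 // ler_wpM2l // s1.
- by apply: cvgD; [exact: c2|apply: cvgM; [exact: cvg_cst|exact: c1]].
Qed.

Lemma Dini_lin (c : R) R0 omega1 omega2 : 0 <= c -> Dini_modulus R0 omega1 ->
  Dini_modulus R0 omega2 -> Dini_modulus R0 (fun s => omega2 s + c * omega1 s).
Proof.
move=> c0 D1 D2; have [m1 _] := D1; have [m2 _] := D2.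
have mm := mod_lin c0 m1 m2; split => //.
have i1 := dini_integrable D1 (lexx R0); have i2 := dini_integrable D2 (lexx R0).
have /integrableP[_] := integrable_lin c (measurable_itv _) i2 i1.
apply: le_lt_trans; rewrite le_eqVlt; apply/orP; left; apply/eqP.
apply: eq_integral => x; rewrite inE /= in_itv /= => /andP[x0 _].
rewrite mulrA -mulrDl ger0_norm //.
exact: (mod_div_ge0 1 mm (ltW x0)).
Qed.

Lemma dini_int_lin (c : R) R0 omega1 omega2 r : Dini_modulus R0 omega1 ->
  Dini_modulus R0 omega2 -> r <= R0 ->
  dini_int (fun s => omega2 s + c * omega1 s) r = dini_int omega2 r + c * dini_int omega1 r.
Proof.
move=> D1 D2 rR; have i1 := dini_integrable D1 rR; have i2 := dini_integrable D2 rR.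
rewrite /dini_int -Rintegral_lin //.
by apply: eq_Rintegral => x _; rewrite mulrDl mulrA.
Qed.

Lemma tail_int_lin (c : R) omega1 omega2 s rb : modulus omega1 -> modulus omega2 -> 0 < s ->
  tail_int (fun s => omega2 s + c * omega1 s) s rb = tail_int omega2 s rb + c * tail_int omega1 s rb.
Proof.
move=> m1 m2 s0; have i1 := tail_integrable rb m1 s0; have i2 := tail_integrable rb m2 s0.
rewrite /tail_int -Rintegral_lin //.
by apply: eq_Rintegral => x _; rewrite mulrDl mulrA.
Qed.

End moduli_facts.

Definition scale {R : realType} (d0 lam : R) k := d0 * lam ^+ k.

(** * Decay along a geometric sequence of scales *)

Section geometric_decay.
Context {R : realType}.
Variables (R0 lam gam d0 : R) (W : R -> R) (X : nat -> R).
Hypotheses (DW : Dini_modulus R0 W) (l01 : 0 < lam < 1) (g0 : 0 <= gam)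
  (d00 : 0 < d0) (dR : d0 <= R0) (X0 : forall k, 0 <= X k).
Local Notation d := (scale d0 lam).
Hypothesis HX : forall k, X k.+1 <= lam * X k + gam * W (d k.+1).
Let l0 : 0 < lam. Proof. by case/andP: l01. Qed.
Let l1 : lam < 1. Proof. by case/andP: l01. Qed.
Let l1' : 0 < 1 - lam. Proof. by rewrite subr_gt0. Qed.
Let mW : modulus W. Proof. by case: DW. Qed.

Let d_gt0 k : 0 < d k. Proof. by rewrite mulr_gt0 // exprn_gt0. Qed.
Let dS k : d k.+1 = lam * d k. Proof. by rewrite /scale exprS mulrCA. Qed.
Let d_le k : d k.+1 <= d k. Proof. by rewrite dS ler_piMl // ltW. Qed.
Let d_le0 k : d k <= d0.
Proof. by rewrite /scale ler_piMr // ?(ltW d00) // exprn_ile1 // ltW. Qed.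
Let d_leR k : d k <= R0. Proof. exact: le_trans (d_le0 k) dR. Qed.
Let Wd_ge0 k : 0 <= W (d k). Proof. by rewrite mod_ge0 // ltW. Qed.

Lemma scale_dini k : (1 - lam) * W (d k.+1) <= dini_int W (d k) - dini_int W (d k.+1).
Proof.
have := dini_step DW (d_gt0 k.+1) (d_le k) (d_leR k).
rewrite [X in _ + X](_ : _ = (1 - lam) * W (d k.+1)); last first.
  by rewrite dS; field; rewrite gt_eqF.
by rewrite lerBrDr addrC.
Qed.

Lemma scale_tail k : (1 - lam) * W (d k.+1) / d k <= tail_int W (d k.+1) d0 - tail_int W (d k) d0.
Proof.
have := tail_step mW (d_gt0 k.+1) (d_le k) (d_le0 k).
rewrite [X in _ + X](_ : _ = (1 - lam) * W (d k.+1) / d k); last first.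
  by rewrite dS; field; rewrite gt_eqF.
by rewrite lerBrDr addrC.
Qed.

Lemma scale_doubling k : W (d k) <= doubling lam * W (d k.+1).
Proof. by rewrite dS; apply: mod_doubling => //; exact: ltW. Qed.

(** A telescoping majorant: as it loses at least X k at each step, it bounds the
    sum of X over all finer scales. *)
Definition potential k := X k / (1 - lam) + gam / (1 - lam) ^+ 2 * dini_int W (d k).

Lemma potential_ge0 k : 0 <= potential k.
Proof.
by rewrite addr_ge0 // ?divr_ge0 ?(ltW l1') // mulr_ge0 ?dini_ge0 // divr_ge0 // exprn_ge0 // ltW.
Qed.

Lemma potential_step k : X k <= potential k - potential k.+1.
Proof.
rewrite /potential -subr_ge0.
have e1 := HX k; have e2 := scale_dini k.
rewrite [leRHS](_ : _ = (lam * X k + gam * W (d k.+1) - X k.+1) / (1 - lam) +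
  gam / (1 - lam) ^+ 2 * (dini_int W (d k) - dini_int W (d k.+1) - (1 - lam) * W (d k.+1))); last first.
  by field; rewrite gt_eqF.
apply: addr_ge0; first by rewrite divr_ge0 ?subr_ge0 // ltW.
by rewrite mulr_ge0 ?subr_ge0 // divr_ge0 // exprn_ge0 // ltW.
Qed.

(** Unrolled, the recurrence gives d k times a sum of W (d j) / d j, which the
    tail integral controls, except for the last term W (d k). *)
Lemma decay_tail k :
  X k <= d k * (X 0 / d0 + gam * doubling lam / (1 - lam) * tail_int W (d k) d0) + gam * W (d k).
Proof.
have N1 := doubling_ge1 lam; have N0 : 0 <= doubling lam := le_trans ler01 N1.
elim: k => [|k ih].
  have e : d 0 = d0 by rewrite /scale expr0 mulr1.
  rewrite mulrDr {1}e mulrCA divff ?gt_eqF // mulr1 -addrA lerDl addr_ge0 //; last exact: mulr_ge0.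
  by rewrite mulr_ge0 ?(ltW (d_gt0 0)) // mulr_ge0 ?tail_ge0 ?(ltW (d_gt0 0)) // divr_ge0 ?mulr_ge0 // ltW.
apply: le_trans (HX k) _; rewrite lerD2r.
apply: le_trans (ler_wpM2l (ltW l0) ih) _.
have e1 := scale_doubling k; have e2 := scale_tail k.
have e3 : W (d k) / d k <= doubling lam / (1 - lam) * (tail_int W (d k.+1) d0 - tail_int W (d k) d0).
  apply: (@le_trans _ _ (doubling lam * W (d k.+1) / d k)); first by rewrite ler_wpM2r // invr_ge0 ltW.
  rewrite [leLHS](_ : _ = doubling lam / (1 - lam) * ((1 - lam) * W (d k.+1) / d k)); last first.
    by field; rewrite !gt_eqF.
  by rewrite ler_wpM2l // divr_ge0 // ltW.
rewrite dS -subr_ge0 [leRHS](_ : _ = lam * d k * gam * (doubling lam / (1 - lam) * (tail_int W (lam * d k) d0 -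
  tail_int W (d k) d0) - W (d k) / d k)); last by field; rewrite !gt_eqF.
apply: mulr_ge0; last by rewrite -dS subr_ge0.
by apply: mulr_ge0 => //; apply: mulr_ge0; exact: ltW.
Qed.

Lemma scale_exists r : 0 < r -> r <= d0 -> exists k, d k.+1 < r <= d k.
Proof.
move=> r0 rd.
have ex : exists k, d k.+1 < r.
  have : (fun k => d0 * lam ^+ k) @ \oo --> (0 : R).
    rewrite -(mulr0 d0); apply: cvgM; first exact: cvg_cst.
    by apply: cvg_expr; rewrite ger0_norm ?ltW.
  move=> /cvgrPdist_lt/(_ r r0)[N _ hN]; exists N.
  have := hN N.+1 (leqnSn _); rewrite /= sub0r normrN gtr0_norm //; exact: d_gt0.
case: (ex_minnP ex) => k hk mk; exists k; rewrite hk /=.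
case: k hk mk => [_ _|k hk mk]; first by rewrite /scale expr0 mulr1.
by rewrite leNgt; apply/negP => /mk; rewrite ltnn.
Qed.

(** Doubling twice leads to W (d k.+2), which bounds W from below on the interval
    ]d k.+2, d k.+1[, contained in ]0, r[. *)
Lemma scale_le_dini k r : d k.+1 < r -> r <= d k ->
  W (d k) <= doubling lam ^+ 2 / (1 - lam) * dini_int W r.
Proof.
move=> h1 h2; have N0 : 0 <= doubling lam := le_trans ler01 (doubling_ge1 lam).
apply: le_trans (scale_doubling k) _.
apply: le_trans (ler_wpM2l N0 (scale_doubling k.+1)) _.
rewrite mulrA -expr2 -mulrA ler_wpM2l ?exprn_ge0 // ler_pdivlMl //.
apply: le_trans (scale_dini k.+1) _; rewrite lerBlDr ler_wpDr ?dini_ge0 //.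
by apply: dini_mono DW _ (ltW h1) _ => //; rewrite (le_trans h2).
Qed.

Let N0 : 0 <= doubling lam. Proof. exact: le_trans (doubling_ge1 lam). Qed.

Definition decay_rate r := X 0 * (r / d0) + r * tail_int W r d0 + dini_int W r.

Definition decay_const := lam^-1 + gam * doubling lam / (lam * (1 - lam)) +
  gam * doubling lam ^+ 2 / (1 - lam).

Definition potential_const := decay_const / (1 - lam) +
  gam * (doubling lam ^+ 2 + 1) / (1 - lam) ^+ 2.

Lemma decay_const_ge0 : 0 <= decay_const.
Proof.
rewrite /decay_const !addr_ge0 //; first by rewrite invr_ge0 ltW.
  by rewrite divr_ge0 ?mulr_ge0 // ltW.
by rewrite divr_ge0 ?mulr_ge0 ?exprn_ge0 // ltW.
Qed.

Lemma decay_at k r : d k.+1 < r -> r <= d k -> X k <= decay_const * decay_rate r.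
Proof.
move=> h1 h2; have r0 : 0 < r := lt_trans (d_gt0 k.+1) h1.
have rd : r <= d0 := le_trans h2 (d_le0 k).
apply: le_trans (decay_tail k) _.
have dr : d k <= lam^-1 * r by rewrite ler_pdivlMl // -dS ltW.
have t0 : 0 <= tail_int W r d0 by rewrite tail_ge0 // ltW.
have D0 : 0 <= dini_int W r by exact: dini_ge0.
have tr : tail_int W (d k) d0 <= tail_int W r d0 by exact: tail_mono.
have Wr := scale_le_dini h1 h2.
have A0 : 0 <= X 0 * (r / d0) by rewrite mulr_ge0 // divr_ge0 // ltW.
have B0 : 0 <= r * tail_int W r d0 by rewrite mulr_ge0 // ltW.
have c10 : 0 <= lam^-1 by rewrite invr_ge0 ltW.
have c20 : 0 <= gam * doubling lam / (lam * (1 - lam)) by rewrite divr_ge0 ?mulr_ge0 // ltW.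
have c30 : 0 <= gam * doubling lam ^+ 2 / (1 - lam) by rewrite divr_ge0 ?mulr_ge0 ?exprn_ge0 // ltW.
apply: (@le_trans _ _ (lam^-1 * (X 0 * (r / d0)) +
   gam * doubling lam / (lam * (1 - lam)) * (r * tail_int W r d0) +
   gam * doubling lam ^+ 2 / (1 - lam) * dini_int W r)); last first.
  rewrite /decay_const /decay_rate -subr_ge0.
  move: A0 B0 D0 c10 c20 c30; set A := X 0 * _; set B := r * _; set D := dini_int _ _.
  set c1 := lam^-1; set c2 := _ / _; set c3 := _ / (1 - lam) => A0 B0 D0 c10 c20 c30.
  rewrite [leRHS](_ : _ = c1 * B + c1 * D + c2 * A + c2 * D + c3 * A + c3 * B); last by ring.
  by rewrite !addr_ge0 // mulr_ge0.
rewrite mulrDr; apply: lerD; first apply: lerD.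
- rewrite [leRHS](_ : _ = lam^-1 * r * (X 0 / d0)); last by ring.
  by rewrite ler_wpM2r // divr_ge0 // ltW.
- rewrite [leRHS](_ : _ = lam^-1 * r * (gam * doubling lam / (1 - lam) * tail_int W r d0)); last first.
    by field; rewrite !gt_eqF.
  apply: ler_pM => //; first exact: ltW.
    by rewrite mulr_ge0 ?tail_ge0 ?(ltW (d_gt0 k)) // divr_ge0 ?mulr_ge0 // ltW.
  by rewrite ler_wpM2l // divr_ge0 ?mulr_ge0 // ltW.
- rewrite [leRHS](_ : _ = gam * (doubling lam ^+ 2 / (1 - lam) * dini_int W r)); last by ring.
  by rewrite ler_wpM2l.
Qed.

Lemma potential_at k r : d k.+1 < r -> r <= d k ->
  potential k.+1 <= potential_const * decay_rate r.
Proof.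
move=> h1 h2; have r0 : 0 < r := lt_trans (d_gt0 k.+1) h1.
have rd : r <= d0 := le_trans h2 (d_le0 k).
have D0 : 0 <= dini_int W r by exact: dini_ge0.
have rate : dini_int W r <= decay_rate r.
  rewrite /decay_rate lerDr addr_ge0 // ?mulr_ge0 ?tail_ge0 ?(ltW r0) //.
  by rewrite invr_ge0 ltW.
have Wr : W (d k.+1) <= doubling lam ^+ 2 / (1 - lam) * dini_int W r.
  by apply: le_trans (scale_le_dini h1 h2); case: mW => _ hm _ _; apply: hm => //; exact: ltW.
have Xr := decay_at h1 h2.
have Dr : dini_int W (d k.+1) <= dini_int W r.
  by apply: dini_mono DW _ (ltW h1) _ => //; exact: le_trans dR.
have i0 : 0 <= (1 - lam)^-1 by rewrite invr_ge0 ltW.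
rewrite /potential /potential_const mulrDl; apply: (@le_trans _ _ (
  (X k + gam * W (d k.+1)) / (1 - lam) + gam / (1 - lam) ^+ 2 * dini_int W r)).
  apply: lerD; last by rewrite ler_wpM2l // divr_ge0 // exprn_ge0 // ltW.
  rewrite ler_wpM2r //; apply: le_trans (HX k) _; rewrite lerD2r ler_piMl //; exact: ltW.
rewrite mulrDl -addrA; apply: lerD; first by rewrite [leRHS]mulrAC ler_wpM2r.
apply: (@le_trans _ _ (gam * (doubling lam ^+ 2 + 1) / (1 - lam) ^+ 2 * dini_int W r)); last first.
  apply: ler_wpM2l => //; apply: divr_ge0; last by rewrite exprn_ge0 // ltW.
  by rewrite mulr_ge0 // addr_ge0 // exprn_ge0.
rewrite [leRHS](_ : _ = gam * (doubling lam ^+ 2 / (1 - lam) * dini_int W r) / (1 - lam) +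
  gam / (1 - lam) ^+ 2 * dini_int W r); last by field; rewrite gt_eqF.
by rewrite lerD2r ler_wpM2r // ler_wpM2l.
Qed.

End geometric_decay.

(** * Averages of deviations from affine functions *)

Section affine_average.
Context {R : realType} {n : nat}.
Local Notation E := 'rV[R]_n.

Lemma L2_cst_Ball r (M : R) : L2 (@Ball R n r) (fun=> M).
Proof.
apply: (@L2_bounded _ _ _ _ `|M|); [exact: measurable_Ball|exact: Ball_leb|exact: measurable_cst|by []].
Qed.

Lemma L2avg_affine_cst (v : E -> R) (r a K : R) (b : E) : 0 < r -> L2 (Ball r) v ->
  L2avg (Ball r) (fun x => v x - K) <=
  L2avg (Ball r) (fun x => v x - affine a b x) + (`|a - K| + eucl b * r).
Proof.
move=> r0 Lv; have mB := @measurable_Ball R n r; have v0 := vol_gt0 (n := n) r0.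
have bB := @bounded_Ball R n r.
have La := affine_L2 a b bB mB.
have Lc (M : R) := L2_cst_Ball r M.
have L1 : L2 (Ball r) (fun x => v x - affine a b x) by exact: L2B.
have L3 : L2 (Ball r) (fun x => affine a b x - K) by exact: L2B.
pose M := `|a - K| + eucl b * r.
have M0 : 0 <= M by rewrite addr_ge0 // mulr_ge0 ?eucl_ge0 // ltW.
rewrite !L2avgE ?(ltW v0) //.
rewrite (eq_L2norm (v := fun x => (v x - affine a b x) + (affine a b x - K))); last first.
  by move=> x _; ring.
apply: le_trans (ler_wpM2l _ (minkowski_L2 mB L1 L3)) _; first exact: sqrtr_ge0.
rewrite mulrDr lerD2l -/M.
apply: le_trans (ler_wpM2l (sqrtr_ge0 _) (L2norm_le mB L3 (Lc M) _)) _.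
  move=> x Bx; rewrite (ger0_norm M0) /affine -addrA [dot b x + _]addrC addrA.
  apply: le_trans (ler_normD _ _) _; rewrite lerD2l; apply: le_trans (cauchy_dot _ _) _.
  by rewrite ler_wpM2l ?eucl_ge0 // ltW.
rewrite /L2norm Rintegral_cst // sqrtrM ?sqr_ge0 // sqrtr_sqr (ger0_norm M0) mulrCA -sqrtrM ?invr_ge0 ?(ltW v0) //.
by rewrite mulVf ?gt_eqF // sqrtr1 mulr1.
Qed.

End affine_average.

(** * Iteration over the scales *)

Section iteration.
Context {R : realType} {n : nat}.
Local Notation E := 'rV[R]_n.
Variables (u : E -> R) (R0 lam C0 q d0 T0 : R) (omega1 omega2 : R -> R).
Local Notation d := (scale d0 lam).
Hypotheses (D1 : Dini_modulus R0 omega1) (D2 : Dini_modulus R0 omega2)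
  (l01 : 0 < lam < 1) (C0_gt0 : 0 < C0) (q_ge0 : 0 <= q) (T0_gt0 : 0 < T0)
  (d00 : 0 < d0) (dR : d0 <= R0).
Let l0 : 0 < lam. Proof. by case/andP: l01. Qed.
Let l1 : lam < 1. Proof. by case/andP: l01. Qed.
Let l1' : 0 < 1 - lam. Proof. by rewrite subr_gt0. Qed.
Let m1 : modulus omega1. Proof. by case: D1. Qed.
Let m2 : modulus omega2. Proof. by case: D2. Qed.
Let d_gt0 k : 0 < d k. Proof. by rewrite mulr_gt0 // exprn_gt0. Qed.
Let dS k : d k.+1 = lam * d k. Proof. by rewrite /scale exprS mulrCA. Qed.
Let d_le k : d k.+1 <= d k. Proof. by rewrite dS ler_piMl // ltW. Qed.
Let d_le0 k : d k <= d0.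
Proof. by rewrite /scale ler_piMr // ?(ltW d00) // exprn_ile1 // ltW. Qed.
Let w1_ge0 k : 0 <= omega1 (d k). Proof. by rewrite mod_ge0 // ltW. Qed.
Let w2_ge0 k : 0 <= omega2 (d k). Proof. by rewrite mod_ge0 // ltW. Qed.

(** The error of the affine approximation at scale k, together with a bound for
    the size |a| + |b| d of this approximation. The second summand of the error
    is what the next improvement requires; the first is what this one provides. *)
Fixpoint errsize k : R * R :=
  if k is k'.+1 then
    let: (T, N) := errsize k' in
    (lam / 2 * T + q * (omega2 (d k) + omega1 (d k) * (N + C0 * T)), N + C0 * T)
  else (T0, 0).
Definition err k := (errsize k).1.
Definition size_bound k := (errsize k).2.

Lemma size_boundS k : size_bound k.+1 = size_bound k + C0 * err k.
Proof. by rewrite /size_bound /err /=; case: (errsize k). Qed.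

Lemma errS k : err k.+1 =
  lam / 2 * err k + q * (omega2 (d k.+1) + omega1 (d k.+1) * size_bound k.+1).
Proof. by rewrite /size_bound /err /=; case: (errsize k). Qed.

Lemma errsize_pos k : 0 < err k /\ 0 <= size_bound k.
Proof.
elim: k => [|k [e0 s0]]; first by [].
have s0' : 0 <= size_bound k.+1 by rewrite size_boundS addr_ge0 // mulr_ge0 // ltW.
split=> //; rewrite errS ltr_wpDr ?mulr_gt0 ?divr_gt0 //.
by rewrite mulr_ge0 // addr_ge0 // mulr_ge0.
Qed.

Let err_gt0 k : 0 < err k. Proof. by case: (errsize_pos k). Qed.
Let size_ge0 k : 0 <= size_bound k. Proof. by case: (errsize_pos k). Qed.

(** The constant of the discrete Gronwall inequality below. *)
Definition growth := expR (2 * C0 * q * ((1 - lam)^-1 * dini_int omega1 d0)) *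
  (2 * C0 * T0 + 2 * C0 * q * ((1 - lam)^-1 * dini_int omega2 d0)).

Lemma sum_scale_le omega k : Dini_modulus R0 omega ->
  \sum_(j < k) omega (d j.+1) <= (1 - lam)^-1 * dini_int omega d0.
Proof.
move=> Do; have [mo _] := Do; rewrite ler_pdivlMl //.
apply: (@le_trans _ _ (dini_int omega d0 - dini_int omega (d k))); last first.
  by rewrite gerBl dini_ge0.
elim: k => [|k ih]; first by rewrite big_ord0 mulr0 /scale expr0 mulr1 subrr.
rewrite big_ord_recr /= mulrDr; have := scale_dini Do l01 d00 dR k; move: ih; lra.
Qed.

(** The sum [size + 2 C0 err] grows by the factor 1 + 2 C0 q omega1 (d k) at most,
    up to the contribution of omega2. The product of these factors converges by
    the Dini condition. *)
Lemma size_bound_le k : size_bound k <= growth.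
Proof.
pose al := 2 * C0.
have al0 : 0 <= al by rewrite mulr_ge0 // ltW.
pose s1 k := \sum_(j < k) omega1 (d j.+1); pose s2 k := \sum_(j < k) omega2 (d j.+1).
have s10 j : 0 <= s1 j by rewrite sumr_ge0.
have s20 j : 0 <= s2 j by rewrite sumr_ge0.
have aq : 0 <= al * q by exact: mulr_ge0.
have key j : size_bound j + al * err j <= expR (al * q * s1 j) * (al * T0 + al * q * s2 j).
  elim: j => [|j ih].
    by rewrite /s1 /s2 !big_ord0 !mulr0 expR0 mul1r addr0 /size_bound /err /= add0r.
  rewrite /s1 /s2 !big_ord_recr /= -/(s1 j) -/(s2 j).
  set w1 := omega1 (d j.+1); set w2 := omega2 (d j.+1).
  set P := size_bound j + al * err j in ih.
  have P0 : 0 <= P by rewrite addr_ge0 // mulr_ge0 // ltW.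
  have st : size_bound j.+1 + al * err j.+1 <= (1 + al * q * w1) * P + al * q * w2.
    rewrite errS -/w1 -/w2 size_boundS /P.
    have h1 : 0 <= al * q * w1 * (C0 * err j).
      apply: mulr_ge0; last by apply: mulr_ge0; exact: ltW.
      by apply: mulr_ge0 => //; exact: w1_ge0.
    have h2 : 0 <= C0 * err j * (1 - lam).
      by apply: mulr_ge0; [apply: mulr_ge0|]; exact: ltW.
    rewrite -subr_ge0 [leRHS](_ : _ = C0 * err j * (1 - lam) + al * q * w1 * (C0 * err j)); last first.
      by rewrite /al; field.
    exact: addr_ge0.
  apply: (le_trans st); rewrite [al * q * (_ + w1)]mulrDr expRD.
  set e := expR (al * q * s1 j) in ih *; set Q := al * T0 + al * q * s2 j in ih *.
  have Q0 : 0 <= Q by rewrite addr_ge0 // mulr_ge0 // ltW.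
  have e0 : 0 < e by exact: expR_gt0.
  have w10 : 0 <= al * q * w1 by rewrite mulr_ge0 // w1_ge0.
  have w20 : 0 <= al * q * w2 by rewrite mulr_ge0 // w2_ge0.
  have e1 : 1 <= e by rewrite /e -expR0 ler_expR mulr_ge0.
  have f1 : 1 + al * q * w1 <= expR (al * q * w1) := expR_ge1Dx _.
  have f2 : 1 <= expR (al * q * w1) by apply: le_trans f1; rewrite lerDl.
  rewrite [leRHS](_ : _ = expR (al * q * w1) * (e * Q) + e * expR (al * q * w1) * (al * q * w2)); last first.
    by rewrite /Q; ring.
  apply: lerD; first by apply: ler_pM => //; rewrite addr_ge0.
  by rewrite ler_peMl // mulr_ege1.
apply: le_trans (_ : size_bound k + al * err k <= _); first by rewrite lerDl mulr_ge0 // ltW.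
apply: le_trans (key k) _; rewrite /growth -/al; apply: ler_pM.
- exact: expR_ge0.
- by rewrite addr_ge0 // mulr_ge0 // ltW.
- by rewrite ler_expR ler_wpM2l // sum_scale_le.
- by rewrite lerD2l ler_wpM2l // sum_scale_le.
Qed.

Lemma growth_ge0 : 0 <= growth.
Proof. exact: le_trans (size_ge0 0) (size_bound_le 0). Qed.

(** With bounded sizes, the two moduli act through a single one. *)
Definition total_modulus s := omega2 s + growth * omega1 s.

Lemma total_modulus_Dini : Dini_modulus R0 total_modulus.
Proof. exact: Dini_lin growth_ge0 D1 D2. Qed.

Lemma err_step k : err k.+1 <= lam / 2 * err k + q * total_modulus (d k.+1).
Proof.
rewrite errS lerD2l ler_wpM2l // lerD2l mulrC ler_wpM2r //; exact: size_bound_le.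
Qed.

Hypothesis Lu : L2 (Ball d0) u.
Hypothesis start : L2avg (Ball d0) u <= T0.
Hypothesis start2 : q * omega2 d0 <= T0.
Hypothesis improve : forall (r T a : R) (b : E), 0 < r -> r <= d0 -> 0 < T ->
  L2avg (Ball r) (fun x => u x - affine a b x) <= T ->
  q * (omega2 r + omega1 r * (`|a| + eucl b * r)) <= T ->
  exists (a' : R) (b' : E),
    L2avg (Ball (r * lam)) (fun x => u x - affine a' b' x) <= 2^-1 * lam * T /\
    `|a' - a| + eucl (b' - b) * r <= C0 * T.

(** The bound on the size is carried along, because the next improvement needs it. *)
Lemma approximating_affine : exists (a : nat -> R) (b : nat -> E), [/\ a 0%N = 0, b 0%N = 0,
  forall k, L2avg (Ball (d k)) (fun x => u x - affine (a k) (b k) x) <= err k &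
  forall k, `|a k.+1 - a k| + eucl (b k.+1 - b k) * d k <= C0 * err k].
Proof.
pose good k (p : R * E) := L2avg (Ball (d k)) (fun x => u x - affine p.1 p.2 x) <= err k /\
  `|p.1| + eucl p.2 * d k <= size_bound k.
have next (kp : nat * (R * E)) : exists p' : R * E, good kp.1 kp.2 -> good kp.1.+1 p' /\
    `|p'.1 - kp.2.1| + eucl (p'.2 - kp.2.2) * d kp.1 <= C0 * err kp.1.
  case: kp => k [a b] /=; have [[h1 h2]|ng] := pselect (good k (a, b)); last first.
    (* any value will do: the invariant holds along the sequence *)
    by exists (0, 0) => /ng.
  have [|a' [b' [h3 h4]]] := improve (d_gt0 k) (d_le0 k) (err_gt0 k) h1.
  - case: k h1 h2 => [|k] h1 h2.
      by move: h2; rewrite /size_bound /= => /(ler_wpM2l (w1_ge0 0)); rewrite mulr0 => h;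
        apply: le_trans start2; rewrite ler_wpM2l // /scale expr0 mulr1 gerDl; move: h; rewrite /scale expr0 mulr1.
    apply: (@le_trans _ _ (q * (omega2 (d k.+1) + omega1 (d k.+1) * size_bound k.+1))).
      by rewrite ler_wpM2l // lerD2l ler_wpM2l.
    by rewrite errS lerDr mulr_ge0 ?divr_ge0 // ltW.
  exists (a', b') => _; split => //; split => /=.
    rewrite (_ : d k.+1 = d k * lam); last by rewrite dS mulrC.
    apply: le_trans h3 _; rewrite errS [2^-1 * lam]mulrC lerDl.
    by rewrite mulr_ge0 // addr_ge0 // mulr_ge0.
  rewrite size_boundS; apply: le_trans (lerD h2 h4); rewrite addrACA; apply: lerD.
    by rewrite -{1}(subrK a a') addrC ler_normD.
  rewrite -mulrDl dS mulrA ler_wpM2r ?(ltW (d_gt0 k)) //.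
  apply: (@le_trans _ _ (eucl b')); first by rewrite ler_piMr ?eucl_ge0 // ltW.
  by rewrite -{1}(subrK b b') addrC euclD.
have [F hF] := choice next.
pose s := fix s k : R * E := if k is k'.+1 then F (k', s k') else (0, 0).
have gs k : good k (s k).
  elim: k => [|k ih]; last by have [] := hF (k, s k) ih.
  split; rewrite /= ?normr0 ?eucl0 ?mul0r ?addr0 // /scale expr0 mulr1.
  rewrite (_ : (fun x => _) = u) //; apply/funext => x.
  by rewrite /affine dot0l addr0 subr0.
exists (fun k => (s k).1), (fun k => (s k).2); split => // k; first by have [] := gs k.
by have [] := hF (k, s k) (gs k).
Qed.

(** The slope term contracts with ratio lam and gains lam C0 err. The errors
    contract with ratio lam / 2, and the other half pays for this gain. *)
Definition excess (b : nat -> E) k := eucl (b k) * d k + 2 * C0 * err k.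

Lemma excess_ge0 b k : 0 <= excess b k.
Proof. apply: addr_ge0; apply: mulr_ge0; first exact: eucl_ge0.
- exact: ltW.
- by rewrite mulr_ge0 // ltW.
- exact: ltW. Qed.

Lemma excess_step b k : eucl (b k.+1 - b k) * d k <= C0 * err k ->
  excess b k.+1 <= lam * excess b k + 2 * C0 * q * total_modulus (d k.+1).
Proof.
move=> hb.
have h1 : eucl (b k.+1) * d k.+1 <= lam * (eucl (b k) * d k + C0 * err k).
  rewrite dS mulrCA ler_wpM2l ?(ltW l0) //; apply: le_trans (lerD (lexx _) hb).
  by rewrite -mulrDl ler_wpM2r ?(ltW (d_gt0 k)) // -{1}(subrK (b k) (b k.+1)) addrC euclD.
have h2 : 2 * C0 * err k.+1 <= 2 * C0 * (lam / 2 * err k + q * total_modulus (d k.+1)).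
  by rewrite ler_wpM2l ?err_step // mulr_ge0 // ltW.
apply: le_trans (lerD h1 h2) _; rewrite le_eqVlt; apply/orP; left; apply/eqP; rewrite /excess.
by field.
Qed.

Definition shape_rate r := 2 * C0 * T0 * (r / d0) + r * tail_int total_modulus r d0 +
  dini_int total_modulus r.

Definition shape_const :=
  Num.sqrt (lam ^- n) * (((2 * C0)^-1 + 2) * decay_const lam (2 * C0 * q) +
    potential_const lam (2 * C0 * q)).

Definition limit_bound := 2 * C0 * T0 / (1 - lam) +
  2 * C0 * q / (1 - lam) ^+ 2 * dini_int total_modulus d0.

(** The sequences P + a and P - a are nonincreasing for the potential P of the
    excess, so that a converges. The limit is the value at the origin, and P
    bounds the distance to it. *)
Lemma L2_decay : exists K : R, [/\ `|K| <= limit_bound,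
  L2avg (Ball r) (fun x => u x - K) @[r --> 0^'+] --> (0 : R) &
  forall r, 0 < r -> r <= d0 -> L2avg (Ball r) (fun x => u x - K) <= shape_const * shape_rate r].
Proof.
have [a [b [a0 b0 hab step]]] := approximating_affine.
have DW := total_modulus_Dini.
have gam0 : 0 <= 2 * C0 * q by rewrite !mulr_ge0 // ltW.
pose X := excess b.
have X0 k : 0 <= X k := excess_ge0 b k.
have stepb k : eucl (b k.+1 - b k) * d k <= C0 * err k by apply: le_trans (step k); rewrite lerDr.
have HX k : X k.+1 <= lam * X k + 2 * C0 * q * total_modulus (d k.+1) := excess_step (stepb k).
pose P := potential lam (2 * C0 * q) d0 total_modulus X.
have P0 k : 0 <= P k := potential_ge0 d0 DW l01 gam0 X0 k.
have PS k : X k <= P k - P k.+1 := potential_step DW l01 gam0 d00 dR HX k.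
have aS k : `|a k.+1 - a k| <= X k.
  apply: (@le_trans _ _ (C0 * err k)).
    by apply: le_trans (step k); rewrite lerDl mulr_ge0 ?eucl_ge0 // ltW.
  have := err_gt0 k; have := X0 k; rewrite /X /excess => h1 h2.
  have h3 := mulr_ge0 (eucl_ge0 (b k)) (ltW (d_gt0 k)).
  have h4 := mulr_ge0 (ltW C0_gt0) (ltW h2); lra.
have Pdec : {homo P : i j / (i <= j)%N >-> j <= i}.
  by apply/nonincreasing_seqP => k; have := PS k; have := X0 k; lra.
have apdec : {homo (fun k => a k + P k) : i j / (i <= j)%N >-> j <= i}.
  by apply/nonincreasing_seqP => k; have := PS k; have := aS k; rewrite ler_norml => /andP[]; lra.
have amdec : {homo (fun k => P k - a k) : i j / (i <= j)%N >-> j <= i}.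
  by apply/nonincreasing_seqP => k; have := PS k; have := aS k; rewrite ler_norml => /andP[]; lra.
have cP : cvgn P by apply: nonincreasing_is_cvgn => //; exists 0 => _ [k _ <-].
have cap : cvgn (fun k => a k + P k).
  apply: nonincreasing_is_cvgn => //; exists (- P 0%N) => _ [k _ <-].
  by have := amdec _ _ (leq0n k); have := P0 k; rewrite a0; lra.
have cam : cvgn (fun k => P k - a k).
  apply: nonincreasing_is_cvgn => //; exists (- P 0%N) => _ [k _ <-].
  by have := apdec _ _ (leq0n k); have := P0 k; rewrite a0; lra.
pose L := limn P; pose K := limn (fun k => a k + P k) - L.
have limK : limn (fun k => P k - a k) = L - K.
  have -> : (fun k => P k - a k) = (fun k => (P k + P k) - (a k + P k)).
    by apply/funext => k; ring.
  apply/cvg_lim => //; rewrite [X in _ --> X](_ : _ = L + L - limn (fun k => a k + P k)).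
    by apply: cvgB => //; apply: cvgD.
  by rewrite /K; ring.
have aK k : `|a k - K| <= P k - L.
  have := nonincreasing_cvgn_ge apdec cap k; have := nonincreasing_cvgn_ge amdec cam k.
  rewrite limK (_ : limn (fun k => a k + P k) = K + L) => [h1 h2|]; last by rewrite /K subrK.
  by rewrite ler_norml; apply/andP; split; lra.
have L0 : 0 <= L by apply: limr_ge => //; apply: nearW.
have LP k : L <= P k by exact: nonincreasing_cvgn_ge.
have LB r : r <= d0 -> L2 (Ball r) u.
  by move=> rd; apply: L2_sub Lu; [exact: measurable_Ball|exact: measurable_Ball|exact: Ball_sub].
pose c := (2 * C0)^-1 + 1.
have c0 : 0 <= c by rewrite addr_ge0 // invr_ge0 mulr_ge0 // ltW.
have avgk k : L2avg (Ball (d k)) (fun x => u x - K) <= c * X k + `|a k - K|.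
  apply: le_trans (L2avg_affine_cst (a k) K (b k) (d_gt0 k) (LB _ (d_le0 k))) _.
  have := hab k; set A := L2avg _ _ => hA.
  have e1 : err k <= (2 * C0)^-1 * X k.
    rewrite ler_pdivlMl ?mulr_gt0 // /X /excess lerDr mulr_ge0 ?eucl_ge0 // ltW //.
  have e2 : eucl (b k) * d k <= X k.
    by rewrite /X /excess lerDl mulr_ge0 ?mulr_ge0 // ltW.
  rewrite /c mulrDl mul1r; move: hA e1 e2; set y := _^-1 * _; lra.
pose rho := Num.sqrt (lam ^- n) : R.
have rho0 : 0 <= rho := sqrtr_ge0 _.
(* Ball r lies in a ball of the sequence of at most lam^-n times its volume *)
have avgr k r : d k.+1 < r -> r <= d k ->
    L2avg (Ball r) (fun x => u x - K) <= rho * L2avg (Ball (d k)) (fun x => u x - K).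
  move=> h1 h2; have r0 : 0 < r := lt_trans (d_gt0 k.+1) h1.
  have vr := vol_gt0 (n := n) r0; have vd := vol_gt0 (n := n) (d_gt0 k).
  have Lc : L2 (Ball (d k)) (fun x => u x - K).
    apply: L2B; [exact: measurable_Ball|exact: LB|].
    exact: L2_cst_Ball.
  apply: le_trans (L2avg_mono (@measurable_Ball _ _ _) (@measurable_Ball _ _ _) (Ball_sub h2) Lc vr vd) _.
  apply: ler_wpM2r; first exact: sqrtr_ge0.
  rewrite ler_wsqrtr // (vol_Ball r0) (vol_Ball (d_gt0 k)).
  have v1 := vol_gt0 (n := n) (@ltr01 R).
  rewrite [leLHS](_ : _ = (d k / r) ^+ n); last by rewrite expr_div_n; field; rewrite !gt_eqF ?exprn_gt0.
  rewrite -exprVn; apply: lerXn2r; rewrite ?nnegrE ?invr_ge0 ?divr_ge0 ?(ltW l0) ?(ltW r0) ?(ltW (d_gt0 k)) //.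
  by rewrite ler_pdivrMr // ler_pdivlMl // -dS ltW.
have X0E : X 0%N = 2 * C0 * T0 by rewrite /X /excess b0 eucl0 mul0r add0r.
exists K; split.
- have := aK 0%N; rewrite a0 sub0r normrN => h; apply: le_trans h _.
  by rewrite /P /potential X0E /limit_bound /scale expr0 mulr1 gerBl.
- apply/cvgrPdist_lt => e e0.
  have /cvgrPdist_lt/(_ (e / (1 + rho * (c + 1)))) : P @ \oo --> L by exact: cP.
  have den : 0 < 1 + rho * (c + 1) by rewrite ltr_pwDl // mulr_ge0 // addr_ge0.
  move=> /(_ (divr_gt0 e0 den))[N _ hN].
  near=> r.
  have r0 : 0 < r by near: r; exact: nbhs_right_gt.
  have rN : r < d N by near: r; exact: nbhs_right_lt.
  have [k /andP[h1 h2]] := scale_exists l01 d00 r0 (le_trans (ltW rN) (d_le0 N)).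
  have Nk : (N <= k)%N.
    rewrite leqNgt; apply/negP => kN; have : d N <= d k.+1.
      by rewrite /scale ler_wpM2l ?(ltW d00) // ler_wiXn2l // ltW.
    by move=> h; have := lt_trans h1 rN; rewrite ltNge h.
  have := hN k Nk; rewrite distrC ger0_norm ?subr_ge0 // => hk.
  rewrite sub0r normrN ger0_norm; last exact: sqrtr_ge0.
  apply: le_lt_trans (avgr _ _ h1 h2) _.
  have b1 : L2avg (Ball (d k)) (fun x => u x - K) <= (c + 1) * (P k - L).
    rewrite mulrDl mul1r; apply: le_trans (avgk k) _; apply: lerD; last exact: aK.
    by rewrite ler_wpM2l //; have := PS k; have := LP k.+1; lra.
  apply: le_lt_trans (ler_wpM2l rho0 b1) _; rewrite mulrA.
  apply: (@le_lt_trans _ _ ((1 + rho * (c + 1)) * (P k - L))).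
    by rewrite ler_wpM2r ?subr_ge0 // lerDr.
  by rewrite mulrC -ltr_pdivlMr.
- move=> r r0 rd; have [k /andP[h1 h2]] := scale_exists l01 d00 r0 rd.
  apply: le_trans (avgr _ _ h1 h2) _; rewrite /shape_const -/rho -mulrA ler_wpM2l //.
  have xr := decay_at DW l01 gam0 d00 dR X0 HX h1 h2.
  have pr := potential_at DW l01 gam0 d00 dR X0 HX h1 h2.
  have eR : decay_rate d0 total_modulus X r = shape_rate r by rewrite /decay_rate X0E.
  rewrite eR in xr pr; apply: le_trans (avgk k) _.
  have ak : `|a k - K| <= X k + P k.+1.
    have -> : a k - K = (a k - a k.+1) + (a k.+1 - K) by ring.
    apply: le_trans (ler_normD _ _) _; apply: lerD; first by rewrite distrC.
    by apply: le_trans (aK k.+1) _; rewrite gerBl.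
  apply: le_trans (lerD (lexx _) ak) _; rewrite [leRHS]mulrDl addrA; apply: lerD => //.
  rewrite [leLHS](_ : _ = ((2 * C0)^-1 + 2) * X k); last by rewrite /c; ring.
  rewrite -[leRHS]mulrA; apply: ler_wpM2l => //.
  by rewrite addr_ge0 // invr_ge0 mulr_ge0 // ltW.
Unshelve. all: by end_near.
Qed.

End iteration.

(** * Starting scales *)

Section small_scales.
Context {R : realType}.

(** The value at the last of k scales is the smallest, and the sum of the values
    is bounded by the Dini integral. *)
Lemma small_scale (R0 lam r : R) omega k : Dini_modulus R0 omega -> 0 < lam < 1 ->
  0 < r -> r <= R0 -> k%:R * omega (scale r lam k) <= (1 - lam)^-1 * dini_int omega r.
Proof.
move=> Do l01 r0 rR; have [[_ hm _ _] _] := Do; have /andP[l0 l1] := l01.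
apply: le_trans (sum_scale_le l01 r0 rR k Do).
rewrite mulr_natl -[X in _ *+ X]card_ord -sumr_const; apply: ler_sum => i _.
apply: hm; first by rewrite mulr_ge0 ?exprn_ge0 // ltW.
by rewrite ler_wpM2l ?(ltW r0) // ler_wiXn2l // ltW.
Qed.

Lemma Omega_ge0 (C A rb r : R) omega1 omega2 : modulus omega1 -> modulus omega2 ->
  0 <= C -> 0 <= A -> 0 < rb -> 0 < r -> 0 <= Omega1 C A rb omega1 r + Omega2 C A rb omega2 r.
Proof.
move=> m1 m2 C0 A0 rb0 r0; rewrite /Omega1 /Omega2; case: ifP => _; last by rewrite addr_ge0 // mulr_ge0.
apply: addr_ge0; apply: mulr_ge0; rewrite ?mulr_ge0 //; apply: addr_ge0; try exact: dini_ge0.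
  by apply: addr_ge0; [rewrite divr_ge0 // ltW|rewrite mulr_ge0 ?tail_ge0 // ltW].
by rewrite mulr_ge0 ?tail_ge0 // ltW.
Qed.

End small_scales.

(** * The modulus of continuity at the origin *)

Section conclusion.
Context {R : realType} {n : nat}.
Local Notation E := 'rV[R]_n.
Local Notation B1 := (@Ball R n 1).
Local Notation pexp := ((n + 2)%:R / (2 * n)%:R : R).
Hypothesis hn : (3 <= n)%N.
Variables (C0 lam delta0 : R) (hconst : @approximation_constants R n C0 lam delta0).
Local Notation vp := (vol B1 `^ pexp).
Local Notation q := (@kappa R n / delta0).

Let C0_gt0 : 0 < C0. Proof. by case: hconst. Qed.
Let l01 : 0 < lam < 1. Proof. by case: hconst. Qed.
Let l0 : 0 < lam. Proof. by case/andP: l01. Qed.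
Let l1 : lam < 1. Proof. by case/andP: l01. Qed.
Let l1' : 0 < 1 - lam. Proof. by rewrite subr_gt0. Qed.
Let del_gt0 : 0 < delta0. Proof. by case: hconst. Qed.
Let vp_gt0 : 0 < vp. Proof. by apply: powR_gt0; exact: vol_gt0. Qed.
Let kap_gt0 : 0 < @kappa R n.
Proof. by rewrite /kappa -addrA ltr_pwDl // addr_ge0 ?mulr_ge0 ?sqrtr_ge0 // ltW. Qed.
Let q_gt0 : 0 < q. Proof. exact: divr_gt0. Qed.

(** The bound on the Dini integral of omega1 that the equation for rbar provides. *)
Definition dini_cap : R := delta0 / (128 * C0 * vp).
(** After this number of dilations of rbar by lam, omega1 is at most delta0 / 2. *)
Definition depth : nat := (Num.truncn (64 * C0 * vp)^-1).+1.
Definition start_const : R := Num.sqrt ((lam ^+ depth) ^- n) + @kappa R n / (4 * vp).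
Definition source_const : R := delta0 / (4 * vp).
Definition growth_const : R := expR (2 * C0 * q * dini_cap) *
  (2 * C0 * start_const + 2 * C0 * q * source_const).
Definition limit_const : R := 2 * C0 * start_const / (1 - lam) +
  2 * C0 * q / (1 - lam) * (source_const + growth_const * dini_cap).
Definition near_const : R := @shape_const R n lam C0 q *
  (2 * C0 * start_const / lam ^+ depth + growth_const + 1).
Definition far_const : R := (Num.sqrt ((lam ^+ depth) ^- n) + limit_const) / lam ^+ depth.
Definition final_const : R := far_const + near_const + limit_const + 1.

Let cap_gt0 : 0 < dini_cap. Proof. by rewrite divr_gt0 // !mulr_gt0. Qed.
Let lm_gt0 : 0 < lam ^+ depth. Proof. exact: exprn_gt0. Qed.
Let start_gt0 : 0 < start_const.
Proof. by apply: ltr_wpDl; [exact: sqrtr_ge0|rewrite divr_gt0 // mulr_gt0]. Qed.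
Let source_gt0 : 0 < source_const. Proof. by rewrite divr_gt0 // mulr_gt0. Qed.
Let growth_gt0 : 0 < growth_const.
Proof.
apply: mulr_gt0; first exact: expR_gt0.
apply: addr_gt0; apply: mulr_gt0 => //; first exact: mulr_gt0.
by apply: mulr_gt0 => //; exact: mulr_gt0.
Qed.
Let limit_gt0 : 0 < limit_const.
Proof.
apply: addr_gt0; first by apply: divr_gt0 => //; apply: mulr_gt0 => //; exact: mulr_gt0.
apply: mulr_gt0; first by apply: divr_gt0 => //; apply: mulr_gt0 => //; exact: mulr_gt0.
by apply: addr_gt0 => //; exact: mulr_gt0.
Qed.
Let shape_ge0 : 0 <= @shape_const R n lam C0 q.
Proof.
have N0 : 0 <= doubling lam := le_trans ler01 (doubling_ge1 lam).
have g0 : 0 <= 2 * C0 * q by apply: mulr_ge0; [rewrite mulr_ge0 // ltW|exact: ltW].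
have d0 : 0 <= decay_const lam (2 * C0 * q) by exact: decay_const_ge0.
apply: mulr_ge0; first exact: sqrtr_ge0.
apply: addr_ge0; first by apply: mulr_ge0 => //; rewrite addr_ge0 // invr_ge0 mulr_ge0 // ltW.
apply: addr_ge0; first by rewrite divr_ge0 // ltW.
apply: divr_ge0; last by rewrite exprn_ge0 // ltW.
by apply: mulr_ge0 => //; rewrite addr_ge0 // exprn_ge0.
Qed.
Let near_ge0 : 0 <= near_const.
Proof.
apply: mulr_ge0; first exact: shape_ge0.
apply: addr_ge0 => //; apply: addr_ge0; last exact: ltW.
by rewrite divr_ge0 ?(ltW lm_gt0) // mulr_ge0 ?mulr_ge0 // ltW.
Qed.
Let far_ge0 : 0 <= far_const.
Proof. by apply: divr_ge0; [apply: addr_ge0; [exact: sqrtr_ge0|exact: ltW]|exact: ltW]. Qed.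

Let consts_le_final :
  [/\ far_const <= final_const, near_const <= final_const & limit_const <= final_const].
Proof.
have h (x y z : R) : 0 <= x -> 0 <= y -> 0 <= z ->
  [/\ x <= x + y + z + 1, y <= x + y + z + 1 & z <= x + y + z + 1] by move=> *; split; lra.
exact: h far_ge0 near_ge0 (ltW limit_gt0).
Qed.

Lemma final_const_gt0 : 0 < final_const.
Proof. by rewrite /final_const ltr_wpDl // addr_ge0 ?(ltW limit_gt0) // addr_ge0. Qed.

Variables (Om : set E) (V : (E -> R) -> (E -> R) -> R) (f : E -> E) (g : (E -> R) -> R)
  (u : E -> R) (R0 : R) (omega1 omega2 : R -> R).
Hypotheses (oO : open Om) (hV : multiplier Om V) (hf : L2v Om f)
  (af : admissible Om (fun x => dot (f x) (f x))) (hg : Wm12 Om g)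
  (hu : weak_solution Om V f g u) (R0_gt0 : 0 < R0) (BO : Ball R0 `<=` Om).
Hypotheses (D1 : Dini_modulus R0 omega1) (D2 : Dini_modulus R0 omega2).
Hypothesis hloc : forall (r : R) (psi phi : E -> R), 0 < r <= R0 / 2 ->
       W12 Om psi -> W012 Om phi -> esupp Om phi `<=` cBall r ->
       [/\ forall s : R, r < s <= 2 * r ->
             `|V psi phi| <= omega1 s * L12norm Om r s psi *
                             L2vnorm (Ball r) (grad Om phi),
           (\int[lebesgue_rV n]_(x in Ball r)
               (dot (f x) (f x) * phi x ^+ 2)%:E <=
            (omega2 r ^+ 2 * \int[lebesgue_rV n]_(x in Ball r)
               dot (grad Om phi x) (grad Om phi x))%R%:E)%E
         & `|g phi| <= omega2 r / r ^+ 2 *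
              vol (@Ball R n r) `^ ((n + 2)%:R / (2 * n)%:R) *
              L2vnorm (Ball r) (grad Om phi)].
Let m1 : modulus omega1. Proof. by case: D1. Qed.
Let m2 : modulus omega2. Proof. by case: D2. Qed.

Lemma L2_solution r : r <= R0 -> L2 (Ball r) u.
Proof.
move=> rR; have [[Lu _] _] := hu.
apply: L2_sub Lu; [exact: open_measurable_rV|exact: measurable_Ball|].
by apply: subset_trans BO; exact: Ball_sub.
Qed.

Lemma solution_decay d0 T0 : 0 < d0 -> d0 <= R0 -> 0 < T0 -> 2 * omega1 d0 <= delta0 ->
  L2avg (Ball d0) u <= T0 -> q * omega2 d0 <= T0 ->
  exists K : R, [/\ `|K| <= limit_bound lam C0 q d0 T0 omega1 omega2,
    L2avg (Ball r) (fun x => u x - K) @[r --> 0^'+] --> (0 : R) &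
    forall r, 0 < r -> r <= d0 -> L2avg (Ball r) (fun x => u x - K) <=
      @shape_const R n lam C0 q * shape_rate lam C0 q d0 T0 omega1 omega2 r].
Proof.
move=> d00 dR T00 w1 st1 st2; have [z1 mo1 _ _] := m1; have [z2 mo2 _ _] := m2.
apply: (L2_decay D1 D2 l01 C0_gt0 (ltW q_gt0) T00 d00 dR (L2_solution dR) st1 st2).
move=> r T a b r0 rd T1 avg hq; have [eta [teta eta1]] := @cutoff_exists R n.
apply: (improve_at_scale hn hconst oO hV hf af hg hu BO mo1 z1 mo2 z2 hloc r0 _ T1 avg _ _ teta eta1).
- exact: le_trans dR.
- apply: le_trans w1; rewrite ler_wpM2l // mo1 //; exact: ltW.
- by move: hq; rewrite mulrAC ler_pdivrMr // [T * _]mulrC.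
Qed.

(** Any scale at which omega1 is small enough can start the iteration. *)
Lemma solution_L2_continuous : L2_continuous_at0 u.
Proof.
pose c := (1 - lam)^-1 * dini_int omega1 R0.
pose k := (Num.truncn (2 * c / delta0)).+1.
pose d0 := scale R0 lam k.
have d00 : 0 < d0 by rewrite mulr_gt0 // exprn_gt0.
have dR : d0 <= R0 by rewrite ler_piMr ?(ltW R0_gt0) // exprn_ile1 // ltW.
have w1 : 2 * omega1 d0 <= delta0.
  have := small_scale k D1 l01 R0_gt0 (lexx R0); rewrite -/d0 -/c => h.
  have k1 : 2 * c / delta0 < k%:R by exact: truncnS_gt.
  have k0 : 0 < k%:R :> R by rewrite ltr0n.
  rewrite -(ler_pM2l k0); move: k1; rewrite ltr_pdivrMr // => k1; lra.
pose T0 := L2avg (Ball d0) u + q * omega2 d0 + 1.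
have a0 : 0 <= L2avg (Ball d0) u := sqrtr_ge0 _.
have b0 : 0 <= q * omega2 d0 by apply: mulr_ge0; [exact: ltW|exact: mod_ge0 m2 (ltW d00)].
have [||||K [_ h _]] := @solution_decay d0 T0 d00 dR; rewrite /T0 //; try lra.
by exists K.
Qed.

Section modulus.
Variable rb : R.
Hypotheses (rb0 : 0 < rb) (rbR : rb <= R0).
Hypothesis rbE : C0 * vp * (omega1 rb + (1 - lam)^-1 * dini_int omega1 rb) = delta0 / 128.
Definition solution_size : R := Num.sqrt ((vol (@Ball R n rb))^-1 *
  \int[lebesgue_rV n]_(x in Ball R0) (u x ^+ 2)).
Definition source_size : R := 4 * vp / delta0 * (omega2 R0 + (1 - lam)^-1 * dini_int omega2 R0).
Local Notation A1 := solution_size.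
Local Notation A2 := source_size.
Local Notation A := (A1 + A2).
Local Notation d0 := (scale rb lam depth).
Local Notation T0 := (start_const * A).

Let d00 : 0 < d0. Proof. exact: mulr_gt0. Qed.
Let d_rb : d0 <= rb.
Proof. by rewrite ler_piMr ?(ltW rb0) // exprn_ile1 // ltW. Qed.
Let dR : d0 <= R0. Proof. exact: le_trans d_rb rbR. Qed.
Let A1_ge0 : 0 <= A1. Proof. exact: sqrtr_ge0. Qed.
Let src_ge0 : 0 <= omega2 R0 + (1 - lam)^-1 * dini_int omega2 R0.
Proof.
apply: addr_ge0; first exact: mod_ge0 m2 (ltW R0_gt0).
by apply: mulr_ge0; [rewrite invr_ge0 ltW|exact: dini_ge0].
Qed.
Let A2_ge0 : 0 <= A2.
Proof. by apply: mulr_ge0; [rewrite divr_ge0 ?mulr_ge0 // ltW|exact: src_ge0]. Qed.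
Let A_ge0 : 0 <= A. Proof. exact: addr_ge0. Qed.

Let dini1_cap : (1 - lam)^-1 * dini_int omega1 rb <= dini_cap.
Proof.
rewrite /dini_cap ler_pdivlMr; last by rewrite !mulr_gt0.
have w0 : 0 <= omega1 rb by rewrite mod_ge0 // ltW.
have := mulr_ge0 (mulr_ge0 (ltW C0_gt0) (ltW vp_gt0)) w0; move: rbE.
rewrite mulrDr => h1 h2.
rewrite [leLHS](_ : _ = 128 * (C0 * vp * ((1 - lam)^-1 * dini_int omega1 rb))); last by ring.
by move: h1 h2; set x := C0 * vp * omega1 rb; set y := C0 * vp * _; lra.
Qed.

Let dini1_d0 : (1 - lam)^-1 * dini_int omega1 d0 <= dini_cap.
Proof.
apply: le_trans dini1_cap; rewrite ler_wpM2l ?invr_ge0 ?(ltW l1') //.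
exact: dini_mono D1 d00 d_rb rbR.
Qed.

Let w1_small : 2 * omega1 d0 <= delta0.
Proof.
(* depth is larger than 1 / (64 C0 vp), and 64 C0 vp times dini_cap is delta0 / 2 *)
have h := le_trans (small_scale depth D1 l01 rb0 rbR) dini1_cap.
have c0 : 0 < 64 * C0 * vp by rewrite !mulr_gt0.
have k1 : (64 * C0 * vp)^-1 < depth%:R by exact: truncnS_gt.
have w0 : 0 <= omega1 d0 by rewrite mod_ge0 // ltW.
have h2 := le_trans (ler_wpM2r w0 (ltW k1)) h.
move: h2; rewrite mulrC ler_pdivrMr // /dini_cap => h2; apply: le_trans (ler_wpM2l _ h2) _ => //.
by rewrite le_eqVlt; apply/orP; left; apply/eqP; field; rewrite !gt_eqF.
Qed.

Let src_split : omega2 R0 <= source_const * A2 /\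
  (1 - lam)^-1 * dini_int omega2 R0 <= source_const * A2.
Proof.
have -> : source_const * A2 = omega2 R0 + (1 - lam)^-1 * dini_int omega2 R0.
  by rewrite /source_const /source_size; field; rewrite !gt_eqF.
have w0 : 0 <= omega2 R0 by rewrite mod_ge0 // ltW.
by split; [rewrite lerDl mulr_ge0 ?dini_ge0 // invr_ge0 ltW|rewrite lerDr].
Qed.

Let src_le : source_const * A2 <= source_const * A.
Proof. by rewrite ler_wpM2l ?(ltW source_gt0) // lerDr. Qed.

Let w2_d0 : omega2 d0 <= source_const * A.
Proof.
apply: le_trans src_le; apply: le_trans (proj1 src_split); have [_ h _ _] := m2.
by apply: h => //; exact: ltW.
Qed.

Let dini2_d0 : (1 - lam)^-1 * dini_int omega2 d0 <= source_const * A.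
Proof.
apply: le_trans src_le; apply: le_trans (proj2 src_split).
by rewrite ler_wpM2l ?invr_ge0 ?(ltW l1') //; exact: dini_mono D2 d00 dR (lexx _).
Qed.

Let avg_u r : 0 < r -> r <= R0 -> L2avg (Ball r) u <= Num.sqrt (vol (@Ball R n rb) / vol (@Ball R n r)) * A1.
Proof.
move=> r0 rR; have vr := vol_gt0 (n := n) r0; have vb := vol_gt0 (n := n) rb0.
rewrite /solution_size /L2avg -sqrtrM; last by rewrite divr_ge0 // ltW.
set I := \int[_]_(x in Ball R0) _.
have -> : vol (@Ball R n rb) / vol (@Ball R n r) * ((vol (@Ball R n rb))^-1 * I) = (vol (@Ball R n r))^-1 * I.
  by field; rewrite !gt_eqF.
rewrite ler_wsqrtr //; apply: ler_wpM2l; first by rewrite invr_ge0 ltW.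
apply: Rintegral_mono; [exact: measurable_Ball|exact: measurable_Ball|exact: Ball_sub| |].
- by apply: integrable_sqr; exact: L2_solution.
- by move=> x _; exact: sqr_ge0.
Qed.

Let avg_far r : d0 <= r -> r <= R0 -> L2avg (Ball r) u <= Num.sqrt ((lam ^+ depth) ^- n) * A.
Proof.
move=> dr rR; have r0 : 0 < r := lt_le_trans d00 dr.
apply: le_trans (avg_u r0 rR) _; apply: ler_pM; [exact: sqrtr_ge0|exact: A1_ge0| |by rewrite lerDl].
rewrite ler_wsqrtr // (vol_Ball r0) (vol_Ball rb0).
have v1 := vol_gt0 (n := n) (@ltr01 R).
rewrite [leLHS](_ : _ = (rb / r) ^+ n); last by rewrite expr_div_n; field; rewrite !gt_eqF ?exprn_gt0.
rewrite -exprVn; apply: lerXn2r; rewrite ?nnegrE ?invr_ge0 ?divr_ge0 ?(ltW lm_gt0) ?(ltW r0) ?(ltW rb0) //.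
by rewrite ler_pdivrMr // ler_pdivlMl // mulrC.
Qed.

(** The iteration starts from lam^depth rbar with an error proportional to A.
    Beyond this scale the averages of u are bounded by A directly. The iteration
    needs a positive error; if A = 0, then u vanishes almost everywhere in the
    ball and K = 0. *)
Lemma solution_modulus : exists K : R, `|K| <= final_const * A /\
  forall r : R, 0 < r <= R0 -> L2avg (Ball r) (fun x => u x - K) <=
    Omega1 final_const A rb omega1 r + Omega2 final_const A rb omega2 r.
Proof.
have fc := final_const_gt0.
have [A0|An] := eqVneq A 0.
  exists 0; rewrite A0 mulr0 normr0; split => // r /andP[r0 rR].
  apply: (@le_trans _ _ 0); last by apply: Omega_ge0 => //; exact: ltW.
  rewrite (_ : (fun x => _) = u); last by apply/funext => x; rewrite subr0.
  apply: le_trans (avg_u r0 rR) _.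
  have -> : A1 = 0 by apply/le_anti; rewrite A1_ge0 andbT -A0 lerDl.
  by rewrite mulr0.
have Apos : 0 < A by rewrite lt_neqAle eq_sym An.
have T00 : 0 < T0 by exact: mulr_gt0.
have st1 : L2avg (Ball d0) u <= T0.
  apply: le_trans (avg_far (lexx _) dR) _; rewrite ler_wpM2r // /start_const lerDl.
  by rewrite divr_ge0 ?mulr_ge0 // ltW.
have st2 : q * omega2 d0 <= T0.
  apply: le_trans (ler_wpM2l (ltW q_gt0) w2_d0) _; rewrite mulrA ler_wpM2r //.
  rewrite /start_const (_ : q * source_const = @kappa R n / (4 * vp)); first by rewrite lerDr sqrtr_ge0.
  by rewrite /source_const; field; rewrite !gt_eqF.
have [K [hK _ hr]] := solution_decay d00 dR T00 w1_small st1 st2.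
have g0 : 0 <= 2 * C0 * q by apply: mulr_ge0; [rewrite mulr_ge0 // ltW|exact: ltW].
have gr : growth lam C0 q d0 T0 omega1 omega2 <= growth_const * A.
  rewrite /growth /growth_const -[leRHS]mulrA; apply: ler_pM; first exact: expR_ge0.
  - apply: addr_ge0; first by rewrite mulr_ge0 ?mulr_ge0 // ltW.
    by rewrite mulr_ge0 // mulr_ge0 ?dini_ge0 // invr_ge0 ltW.
  - by rewrite ler_expR ler_wpM2l.
  - rewrite [leRHS](_ : _ = 2 * C0 * T0 + 2 * C0 * q * (source_const * A)); last by ring.
    by rewrite lerD2l ler_wpM2l.
have gr0 := growth_ge0 D1 D2 l01 C0_gt0 (ltW q_gt0) T00 d00 dR.
have hK' : `|K| <= limit_const * A.
  apply: le_trans hK _; rewrite /limit_bound /limit_const.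
  rewrite (dini_int_lin _ D1 D2 dR) [leRHS]mulrDl; apply: lerD.
    by rewrite mulrA [leLHS]mulrAC.
  rewrite [leLHS](_ : _ = 2 * C0 * q / (1 - lam) * ((1 - lam)^-1 * dini_int omega2 d0 +
    growth lam C0 q d0 T0 omega1 omega2 * ((1 - lam)^-1 * dini_int omega1 d0))); last first.
    by field; rewrite !gt_eqF.
  rewrite -[leRHS]mulrA; apply: ler_wpM2l; first by rewrite divr_ge0 // ltW.
  rewrite [leRHS]mulrDl; apply: lerD => //.
  rewrite [leRHS]mulrAC; apply: ler_pM => //.
  by rewrite mulr_ge0 ?dini_ge0 // invr_ge0 ltW.
have [far_le near_le limit_le] := consts_le_final.
exists K; split.
  by apply: le_trans hK' _; rewrite ler_wpM2r.
move=> r /andP[r0 rR].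
have far : d0 <= r -> L2avg (Ball r) (fun x => u x - K) <= far_const * lam ^+ depth * A.
  move=> dr; apply: le_trans (L2avg_affine_cst 0 K 0 r0 (L2_solution rR)) _.
  rewrite (_ : (fun x => _) = u); last first.
    by apply/funext => x; rewrite /affine dot0l addr0 subr0.
  rewrite sub0r normrN eucl0 mul0r addr0 /far_const divfK ?gt_eqF // [leRHS]mulrDl.
  by apply: lerD => //; exact: avg_far.
have lm1 : lam ^+ depth <= 1 by rewrite exprn_ile1 // ltW.
rewrite /Omega1 /Omega2; have [rrb|rbr] := leP r rb; last first.
  apply: le_trans (far (le_trans d_rb (ltW rbr))) _.
  apply: (@le_trans _ _ (final_const * A)); last by rewrite lerDl mulr_ge0 // ltW.
  by rewrite ler_wpM2r //; apply: le_trans far_le; rewrite ler_piMr.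
have t1 : 0 <= r * tail_int omega1 r rb by rewrite mulr_ge0 ?tail_ge0 // ltW.
have t2 : 0 <= r * tail_int omega2 r rb by rewrite mulr_ge0 ?tail_ge0 // ltW.
have i1 : 0 <= dini_int omega1 r := dini_ge0 r m1.
have i2 : 0 <= dini_int omega2 r := dini_ge0 r m2.
have x0 : 0 <= r / rb by rewrite divr_ge0 // ltW.
set B := A * (r / rb + r * tail_int omega1 r rb + dini_int omega1 r).
set D := r * tail_int omega2 r rb + dini_int omega2 r.
have B0 : 0 <= B by rewrite mulr_ge0 // !addr_ge0.
have D0 : 0 <= D by rewrite addr_ge0.
rewrite -[final_const * A * _]mulrA -/B -mulrDr.
have [rd|dr] := leP r d0; last first.
  apply: le_trans (far (ltW dr)) _; apply: (@le_trans _ _ (final_const * B)); last first.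
    by rewrite ler_wpM2l ?(ltW fc) // lerDl.
  have lx : lam ^+ depth <= r / rb by rewrite ler_pdivlMr // mulrC ltW.
  rewrite -mulrA; apply: ler_pM => //; first by rewrite mulr_ge0 // ltW.
  by rewrite mulrC ler_wpM2l // -addrA; apply: le_trans lx _; rewrite lerDl addr_ge0.
apply: le_trans (hr _ r0 rd) _.
apply: (@le_trans _ _ (near_const * (B + D))); last first.
  by rewrite ler_wpM2r // addr_ge0.
rewrite /near_const -[leRHS]mulrA; apply: ler_wpM2l; first exact: shape_ge0.
rewrite /shape_rate (dini_int_lin _ D1 D2 (le_trans rd dR)) (tail_int_lin _ _ m1 m2 r0).
have tm1 : r * tail_int omega1 r d0 <= r * tail_int omega1 r rb.
  by rewrite ler_wpM2l ?(ltW r0) //; exact: tail_mono_r.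
have tm2 : r * tail_int omega2 r d0 <= r * tail_int omega2 r rb.
  by rewrite ler_wpM2l ?(ltW r0) //; exact: tail_mono_r.
have gA := ltW growth_gt0.
set G := growth lam C0 q d0 T0 omega1 omega2 in gr gr0 *.
have b1 : G * (r * tail_int omega1 r d0) <= growth_const * A * (r * tail_int omega1 r rb).
  by apply: ler_pM => //; rewrite mulr_ge0 ?tail_ge0 // ltW.
have b2 : G * dini_int omega1 r <= growth_const * A * dini_int omega1 r.
  by rewrite ler_wpM2r.
set c1 := 2 * C0 * start_const / lam ^+ depth.
have c10 : 0 <= c1 by rewrite divr_ge0 ?(ltW lm_gt0) // mulr_ge0 ?mulr_ge0 // ltW.
have e1 : 2 * C0 * T0 * (r / d0) = c1 * (A * (r / rb)).
  have e (x y z t l : R) : x * y * z * (t / (rb * l)) = x * y / l * (z * (t / rb)).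
    by rewrite invfM; ring.
  by rewrite /c1 /scale [2 * C0 * T0]mulrA e.
rewrite e1; move: t1 t2 i1 i2 x0 tm1 tm2 b1 b2; rewrite /B /D.
rewrite [r * (_ + G * _)]mulrDr [r * (G * _)]mulrCA.
set t1 := r * tail_int omega1 r rb; set t2 := r * tail_int omega2 r rb.
set s1 := r * tail_int omega1 r d0; set s2 := r * tail_int omega2 r d0.
set i1 := dini_int omega1 r; set i2 := dini_int omega2 r; set x := r / rb.
move=> t10 t20 i10 i20 x0 tm1 tm2 b1 b2.
apply: (@le_trans _ _ (c1 * (A * x) + (t2 + growth_const * A * t1) +
  (i2 + growth_const * A * i1))); first by rewrite !lerD.
rewrite -subr_ge0 [leRHS](_ : _ = c1 * (A * t1) + c1 * (A * i1) + c1 * t2 + c1 * i2 +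
  growth_const * (A * x) + growth_const * t2 + growth_const * i2 +
  A * x + A * t1 + A * i1); last by ring.
by do 9 (apply: addr_ge0; last by repeat (done || apply: mulr_ge0)); repeat (done || apply: mulr_ge0).
Qed.

End modulus.
End conclusion.

Theorem theorem1p1 (R : realType) (n : nat) (hn : (3 <= n)%N)
    (C0 lam delta0 : R) (hconst : @approximation_constants R n C0 lam delta0) :
  exists C : R, 0 < C /\
  forall (Om : set 'rV[R]_n) (V : ('rV[R]_n -> R) -> ('rV[R]_n -> R) -> R)
    (f : 'rV[R]_n -> 'rV[R]_n) (g : ('rV[R]_n -> R) -> R) (u : 'rV[R]_n -> R)
    (R0 : R) (omega1 omega2 : R -> R),
    open Om -> connected Om -> bounded_set Om -> Om 0 ->
    multiplier Om V ->
    L2v Om f -> admissible Om (fun x => dot (f x) (f x)) ->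
    Wm12 Om g ->
    weak_solution Om V f g u ->
    0 < R0 <= 1 -> Ball R0 `<=` Om ->
    Dini_modulus R0 omega1 -> Dini_modulus R0 omega2 ->
    (forall (r : R) (psi phi : 'rV[R]_n -> R), 0 < r <= R0 / 2 ->
       W12 Om psi -> W012 Om phi -> esupp Om phi `<=` cBall r ->
       [/\ forall s : R, r < s <= 2 * r ->
             `|V psi phi| <= omega1 s * L12norm Om r s psi *
                             L2vnorm (Ball r) (grad Om phi),
           (\int[lebesgue_rV n]_(x in Ball r)
               (dot (f x) (f x) * phi x ^+ 2)%:E <=
            (omega2 r ^+ 2 * \int[lebesgue_rV n]_(x in Ball r)
               dot (grad Om phi x) (grad Om phi x))%R%:E)%E
         & `|g phi| <= omega2 r / r ^+ 2 *
              vol (@Ball R n r) `^ ((n + 2)%:R / (2 * n)%:R) *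
              L2vnorm (Ball r) (grad Om phi)]) ->
    L2_continuous_at0 u /\
    forall rbar : R, 0 < rbar <= R0 ->
      C0 * vol (@Ball R n 1) `^ ((n + 2)%:R / (2 * n)%:R) *
        (omega1 rbar + (1 - lam)^-1 * dini_int omega1 rbar) = delta0 / 128 ->
      let A :=
        Num.sqrt ((vol (@Ball R n rbar))^-1 *
                  \int[lebesgue_rV n]_(x in Ball R0) (u x ^+ 2)) +
        4 * vol (@Ball R n 1) `^ ((n + 2)%:R / (2 * n)%:R) / delta0 *
          (omega2 R0 + (1 - lam)^-1 * dini_int omega2 R0) in
      exists K : R, `|K| <= C * A /\
        forall r : R, 0 < r <= R0 ->
          L2avg (Ball r) (fun x => u x - K) <=
          Omega1 C A rbar omega1 r + Omega2 C A rbar omega2 r.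
Proof.
exists (@final_const R n C0 lam delta0); split; first exact: final_const_gt0.
move=> Om V f g u R0 omega1 omega2 oO _ _ _ hV hf af hg hu /andP[R00 _] BO D1 D2 hloc.
split; first exact: (solution_L2_continuous hn hconst oO hV hf af hg hu R00 BO D1 D2 hloc).
move=> rbar /andP[rb0 rbR] rbE.
exact: (solution_modulus hn hconst oO hV hf af hg hu R00 BO D1 D2 hloc rb0 rbR rbE).
Qed.
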